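(* Let $f,h,q,\Phi$ be as in the context and assume: (1) there is $\underline{m}>0$ with $\nabla_x^\top h(x)\nabla_x h(x)\succeq \underline{m} I$ for all $x\in\mathbb{R}^n$; (2) the set $\{x\in\mathbb{R}^n:h(x)=0\}$ is connected and $\tilde f(\eta)=f(\Phi^{-1}(0,\eta))$ is $\rho_\eta$-strongly convex on $\mathbb{R}^{n-m}$, $\rho_\eta>0$; (3) $\mathcal{G}:\mathbb{R}^m\to\mathbb{R}^m$ is such that the origin of $\dot y=\mathcal{G}(y)$ is globally exponentially stable: there exist $c_g\ge1$, $\rho_g>0$ with $\|y(t)\|\le c_g e^{-\rho_g t}\|y(0)\|$ for all $y(0)\in\mathbb{R}^m$, $t\ge0$; (4) $\Phi$ and $\Phi^{-1}$ are globally Lipschitz on $\mathbb{R}^n$, with constants $L_\Phi$ and $L_\Psi$; (5) there is $L_1>0$ such that for all $y\in\mathbb{R}^m$, $\eta\in\mathbb{R}^{n-m}$, with $\tilde x=\Phi^{-1}(y,\eta)$ and $p=\Phi^{-1}(0,\eta)$, $$\big\|\nabla_x^\top q(\tilde x)\nabla_x f(\tilde x)-\nabla_x^\top q(p)\nabla_x f(p)\big\|\le L_1\|y\|.$$ Then the feedback-linearization dynamics $$\dot x=-\nabla_x f(x)-\nabla_x h(x)\lambda,\qquad \lambda=[\nabla_x^\top h(x)\nabla_x h(x)]^{-1}\big(-\nabla_x^\top h(x)\nabla_x f(x)+\mathcal{G}(y)\big),\quad y=h(x),$$ is globally exponentially stable. Specifically, for any rate $\rho_1<\min\{\underline{q}\rho_\eta,\rho_g\}$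 there exists a real $c_1\ge1$ such that, for all $x(0)\in\mathbb{R}^n$ and $t\ge0$, $$\|x(t)-x^\star\|\le c_1 e^{-\rho_1 t}\|x(0)-x^\star\|.$$
   Context: $\|\cdot\|$ is the Euclidean norm (and the induced matrix norm). For $g:\mathbb{R}^n\to\mathbb{R}^k$, $\nabla_x^\top g(x)\in\mathbb{R}^{k\times n}$ is the Jacobian and $\nabla_x g(x)$ its transpose. $f:\mathbb{R}^n\to\mathbb{R}$ and $h:\mathbb{R}^n\to\mathbb{R}^m$ are smooth; the problem is $\min_x f(x)$ subject to $h(x)=0$. $q:\mathbb{R}^n\to\mathbb{R}^{n-m}$ is a smooth map with $Q(x):=\nabla_x^\top q(x)\nabla_x q(x)\succeq \underline{q} I$ for some $\underline{q}>0$ and all $x$, with $\nabla_x^\top q(x)\nabla_x h(x)=0$ for all $x\in\mathbb{R}^n$, and such that $\Phi(x)=(h(x),q(x))=(y,\eta)$, $y\in\mathbb{R}^m$, $\eta\in\mathbb{R}^{n-m}$, is a global diffeomorphism of $\mathbb{R}^n$. $\rho_\eta$-strong convexity means $\tilde f(\eta_2)\ge\tilde f(\eta_1)+\nabla_\eta^\top\tilde f(\eta_1)(\eta_2-\eta_1)+\frac{\rho_\eta}{2}\|\eta_2-\eta_1\|^2$ for all $\eta_1,\eta_2$. Under (1)–(2) the problem has a unique global optimizer, denoted $x^\star$.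
   Formalization: The sign of G in the multiplier is corrected: λ uses −G(y) instead of +G(y), so that y=h(x) obeys ẏ=G(y); with the printed sign ẏ=−G(y), and the claim fails for h=x₁, q=x₂, f=x₂²/2, G(y)=−y. *)

(* Defs.v *)
(* MathComp-Analysis. Points of R^n are row vectors 'rV[R]_n; gradients and
   multipliers are column vectors. *)
From HB Require Import structures.
From mathcomp Require Import all_boot all_order all_algebra.
From mathcomp Require Import all_classical all_reals all_analysis.
Set Implicit Arguments.
Unset Strict Implicit.
Unset Printing Implicit Defensive.
Import Order.TTheory GRing.Theory Num.Theory.
Import numFieldNormedType.Exports.
Local Open Scope classical_set_scope.
Local Open Scope ring_scope.

(* The library norm `|_| on matrices is the max norm, hence this one. It is only
   applied to row and column vectors. *)
Definition enorm (R : realType) (p r : nat) (u : 'M[R]_(p, r)) : R :=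
  Num.sqrt (\sum_i \sum_j u i j ^+ 2).

Definition enorm2 (R : realType) (p r : nat) (w : 'rV[R]_p * 'rV[R]_r) : R :=
  Num.sqrt (enorm w.1 ^+ 2 + enorm w.2 ^+ 2).

Definition loewner_ge (R : realType) (p : nat) (A B : 'M[R]_p) : Prop :=
  (A - B)^T = A - B /\
  forall v : 'cV[R]_p, 0 <= (v^T *m (A - B) *m v) 0 0.

Fixpoint Ck (R : realType) (V W : normedModType R) (k : nat) (f : V -> W) : Prop :=
  match k with
  | 0 => continuous f
  | k'.+1 => (forall x, differentiable f x) /\ forall v : V, Ck k' ('D_v f)
  end.

Definition smooth (R : realType) (V W : normedModType R) (f : V -> W) : Prop :=
  forall k, Ck k f.

Definition diffeomorphism (R : realType) (V W : normedModType R)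
    (Phi : V -> W) (Psi : W -> V) : Prop :=
  [/\ smooth Phi, smooth Psi, cancel Phi Psi & cancel Psi Phi].

(* For g : R^n -> R^k the library's [jacobian g x], built for row vectors, is
   the n x k matrix with (i, j) entry d_i g_j (x): it is the transpose of the
   usual Jacobian. *)
Definition nabla (R : realType) (n k : nat) (g : 'rV[R]_n -> 'rV[R]_k)
    (x : 'rV[R]_n) : 'M[R]_(n, k) := jacobian g x.

Definition grad (R : realType) (n : nat) (f : 'rV[R]_n -> R) (x : 'rV[R]_n) :
    'cV[R]_n := \col_i 'D_(delta_mx 0 i) f x.

Definition gram (R : realType) (n k : nat) (g : 'rV[R]_n -> 'rV[R]_k)
    (x : 'rV[R]_n) : 'M[R]_k := (nabla g x)^T *m nabla g x.

Definition strongly_convex (R : realType) (p : nat) (rho : R)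
    (F : 'rV[R]_p -> R) : Prop :=
  forall u v : 'rV[R]_p,
    F u + ((grad F u)^T *m (v - u)^T) 0 0 + rho / 2 * enorm (v - u) ^+ 2 <= F v.

Definition global_minimizer (R : realType) (n m : nat) (f : 'rV[R]_n -> R)
    (h : 'rV[R]_n -> 'rV[R]_m) (z : 'rV[R]_n) : Prop :=
  h z = 0 /\ forall x, h x = 0 -> f z <= f x.

Definition solution (R : realType) (n : nat) (F : 'rV[R]_n -> 'rV[R]_n)
    (x : R -> 'rV[R]_n) : Prop :=
  {within `[0, +oo[, continuous x} /\
  forall t : R, 0 < t -> is_derive t 1 x (F (x t)).

(* As F need not be regular, solvability on [0, +oo[ from every initial point is
   part of the notion, and the estimate is required of all solutions. *)
Definition globally_exp_stable (R : realType) (n : nat)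
    (F : 'rV[R]_n -> 'rV[R]_n) (xe : 'rV[R]_n) (c rho : R) : Prop :=
  (forall x0 : 'rV[R]_n, exists2 x, solution F x & x 0 = x0) /\
  forall x, solution F x -> forall t : R, 0 <= t ->
    enorm (x t - xe) <= c * expR (- rho * t) * enorm (x 0 - xe).

(* The sign of G is the one for which y = h(x) obeys y' = G(y), see
   [fl_field_output]. *)
Definition fl_multiplier (R : realType) (n m : nat) (f : 'rV[R]_n -> R)
    (h : 'rV[R]_n -> 'rV[R]_m) (G : 'rV[R]_m -> 'rV[R]_m) (x : 'rV[R]_n) :
    'cV[R]_m :=
  invmx (gram h x) *m (- ((nabla h x)^T *m grad f x) - (G (h x))^T).

Definition fl_field (R : realType) (n m : nat) (f : 'rV[R]_n -> R)
    (h : 'rV[R]_n -> 'rV[R]_m) (G : 'rV[R]_m -> 'rV[R]_m) (x : 'rV[R]_n) :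
    'rV[R]_n :=
  (- grad f x - nabla h x *m fl_multiplier f h G x)^T.

Lemma fl_field_output (R : realType) (n m : nat) (f : 'rV[R]_n -> R)
    (h : 'rV[R]_n -> 'rV[R]_m) (G : 'rV[R]_m -> 'rV[R]_m) (x : 'rV[R]_n) :
  gram h x \in unitmx -> (nabla h x)^T *m (fl_field f h G x)^T = (G (h x))^T.
Proof.
move=> u; rewrite /fl_field /fl_multiplier trmxK mulmxBr mulmxN mulmxA.
by rewrite -/(gram h x) mulKVmx // opprB opprK addrCA addNr addr0.
Qed.

(* Main.v *)
Require Import Defs.
From HB Require Import structures.
From mathcomp Require Import all_boot all_order all_algebra.
From mathcomp Require Import all_classical all_reals all_analysis.
From mathcomp Require Import ring lra zify.
Set Implicit Arguments.
Unset Strict Implicit.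
Unset Printing Implicit Defensive.
Import Order.TTheory GRing.Theory Num.Theory.
Import numFieldNormedType.Exports.
Local Open Scope classical_set_scope.
Local Open Scope ring_scope.

(** In the coordinates [y = h x], [eta = q x] the closed loop reads [y' = G y],
    [eta' = - w], where [w] is the gradient of [f] contracted with that of [q].
    On the constraint manifold, [w = gram q * grad F] for the reduced cost
    [F eta = f (Psi (0, eta))], because the columns of [nabla q] are tangent to
    it; off the manifold, [w] differs from this by at most [L1 * enorm y]. So
    [eta] descends along the strongly convex [F], driven by an exponentially
    small input. With [us] the minimizer of [F], [V = F eta - F us] and
    [X = enorm (grad F eta)],
<<
  V' <= - q_low * X ^+ 2 + L1 * X * enorm y,    2 * rho_eta * V <= X ^+ 2,
>>
    and [V] decays at every rate below [2 * min (q_low * rho_eta) rho_g].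

    This does not bound [eta] linearly in the initial distance [r] to the
    minimizer: nothing bounds [F] from above by a quadratic with a global
    constant, so [V] at time [0] is not [O(r ^+ 2)]. The linear bound comes from
    geometry. While [eta] is further than [r] from the minimizer, the input is
    dominated by the gradient, so that [eta] crosses the convex sublevel sets of
    [F] inwards at an angle bounded below. Such a curve stays within [C * r] of
    the minimizer, with [C] depending on the angle and the dimension only
    ([continuous_excursion]). Then [V <= X * enorm (eta - us) <= C * r * X]: a
    large [V] forces a large gradient and is burnt within unit time, whence
    [V = O(r ^+ 2)] at time [1] ([gap_at1]). From there on the Lyapunov estimate
    applies ([driven_decay]).

    The bound on the excursion is proved for polygonal paths. Read backwards, the
    path leaves the convex hull of its past, with normals [N] supporting that
    past. If no normal sees a later point higher than [E], the path has length at
    most [C * E] ([outgoing_length]): by induction on the dimension of the space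
    that the normals span approximately, and by a covering argument on the set of
    normals. An excursion far beyond [r] would therefore produce, at each of many
    scales, a normal with a gain comparable to that scale; two of these normals
    are almost equal, and the one from the lower scale cannot support what is
    reached at the higher scale ([discrete_excursion]).

    Solutions exist although [G] need not be continuous: [y] is given by the
    hypothesis on [G], and the equation for [eta] is truncated outside a ball
    that the bound on [V] shows it never leaves ([truncated_solution],
    [existence]). *)

(** * Euclidean geometry of row vectors *)

Definition dot (R : realType) (d : nat) (u v : 'rV[R]_d) : R :=
  \sum_i u 0 i * v 0 i.

Section Euclidean.
Variables (R : realType) (d : nat).
Implicit Types (u v w : 'rV[R]_d) (a : R).

Lemma dotC u v : dot u v = dot v u.
Proof. by apply: eq_bigr => i _; rewrite mulrC. Qed.

Lemma dotDl u v w : dot (u + v) w = dot u w + dot v w.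
Proof. by rewrite -big_split; apply: eq_bigr => i _; rewrite mxE mulrDl. Qed.

Lemma dotZl a u v : dot (a *: u) v = a * dot u v.
Proof. by rewrite mulr_sumr; apply: eq_bigr => i _; rewrite mxE mulrA. Qed.

Lemma dotNl u v : dot (- u) v = - dot u v.
Proof. by rewrite -scaleN1r dotZl mulN1r. Qed.

Lemma dotBl u v w : dot (u - v) w = dot u w - dot v w.
Proof. by rewrite dotDl dotNl. Qed.

Lemma dotDr u v w : dot w (u + v) = dot w u + dot w v.
Proof. by rewrite !(dotC w) dotDl. Qed.

Lemma dotZr a u v : dot u (a *: v) = a * dot u v.
Proof. by rewrite dotC dotZl dotC. Qed.

Lemma dotNr u v : dot u (- v) = - dot u v.
Proof. by rewrite dotC dotNl dotC. Qed.

Lemma dotBr u v w : dot w (u - v) = dot w u - dot w v.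
Proof. by rewrite !(dotC w) dotBl. Qed.

Lemma dot0l v : dot 0 v = 0.
Proof. by rewrite -(scale0r 0) dotZl mul0r. Qed.

Lemma dot0r v : dot v 0 = 0.
Proof. by rewrite dotC dot0l. Qed.

Lemma dot_suml (I : Type) (r : seq I) (P : pred I) (F : I -> 'rV[R]_d) v :
  dot (\sum_(i <- r | P i) F i) v = \sum_(i <- r | P i) dot (F i) v.
Proof.
by elim/big_rec2: _ => [|i x y _ <-]; rewrite ?dot0l ?dotDl.
Qed.

Lemma dot_mulmx u v : (u *m v^T) 0 0 = dot u v.
Proof. by rewrite mxE; apply: eq_bigr => i _; rewrite mxE. Qed.

Lemma dotvv u : dot u u = enorm u ^+ 2.
Proof.
have ge0 : 0 <= \sum_(i < 1) \sum_(j < d) u i j ^+ 2.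
  by apply: sumr_ge0 => i _; apply: sumr_ge0 => j _; exact: sqr_ge0.
by rewrite /enorm sqr_sqrtr // big_ord1; apply: eq_bigr => i _; rewrite expr2.
Qed.

Lemma enorm_ge0 u : 0 <= enorm u.
Proof. exact: sqrtr_ge0. Qed.

Lemma dotvv_ge0 u : 0 <= dot u u.
Proof. by rewrite dotvv sqr_ge0. Qed.

Lemma enormE u : enorm u = Num.sqrt (dot u u).
Proof. by rewrite dotvv sqrtr_sqr ger0_norm // enorm_ge0. Qed.

Lemma enormZ a u : enorm (a *: u) = `|a| * enorm u.
Proof.
by rewrite !enormE dotZl dotZr mulrA -expr2 sqrtrM ?sqr_ge0 // sqrtr_sqr.
Qed.

Lemma enormN u : enorm (- u) = enorm u.
Proof. by rewrite -scaleN1r enormZ normrN1 mul1r. Qed.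

Lemma enormB u v : enorm (u - v) = enorm (v - u).
Proof. by rewrite -enormN opprB. Qed.

Lemma enorm0 : enorm (0 : 'rV[R]_d) = 0.
Proof. by rewrite -(scale0r 0) enormZ normr0 mul0r. Qed.

Lemma enorm_eq0 u : enorm u = 0 -> u = 0.
Proof.
move=> u0; have: dot u u = 0 by rewrite dotvv u0 expr0n.
move/eqP; rewrite psumr_eq0; last by move=> i _; rewrite -expr2 sqr_ge0.
move=> /allP u00; apply/rowP => i; rewrite mxE.
by have := u00 i (mem_index_enum _); rewrite mulf_eq0 orbb => /eqP.
Qed.

Lemma dot_le u v : dot u v <= enorm u * enorm v.
Proof.
have [v0|vn0] := eqVneq (enorm v) 0.
  by rewrite v0 mulr0 (enorm_eq0 v0) dot0r.
have v_gt0 : 0 < enorm v by rewrite lt_neqAle eq_sym vn0 enorm_ge0.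
have [u0|un0] := eqVneq (enorm u) 0.
  by rewrite u0 mul0r (enorm_eq0 u0) dot0l.
have u_gt0 : 0 < enorm u by rewrite lt_neqAle eq_sym un0 enorm_ge0.
have := dotvv_ge0 (enorm v *: u - enorm u *: v).
rewrite !(dotBl, dotBr, dotZl, dotZr) !dotvv (dotC v u) => H.
rewrite -(ler_pM2l (mulr_gt0 u_gt0 v_gt0)).
nra.
Qed.

Lemma normr_dot_le u v : `|dot u v| <= enorm u * enorm v.
Proof.
by rewrite ler_norml dot_le andbT lerNl -dotNl -(enormN u) dot_le.
Qed.

Lemma enormD u v : enorm (u + v) <= enorm u + enorm v.
Proof.
have uv0 : 0 <= enorm u + enorm v by rewrite addr_ge0 ?enorm_ge0.
rewrite -(ler_pXn2r (ltn0Sn 1)) ?nnegrE ?enorm_ge0 // -dotvv.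
rewrite dotDl !dotDr (dotC v u) !dotvv; have := dot_le u v; nra.
Qed.

Lemma enorm_le_sub u v : enorm u <= enorm v + enorm (u - v).
Proof. by have := enormD v (u - v); rewrite addrC subrK. Qed.

Lemma enorm_sum (I : Type) (r : seq I) (P : pred I) (F : I -> 'rV[R]_d) :
  enorm (\sum_(i <- r | P i) F i) <= \sum_(i <- r | P i) enorm (F i).
Proof.
elim/big_rec2: _ => [|i x y _ H]; first by rewrite enorm0.
by apply: le_trans (enormD _ _) _; rewrite lerD2l.
Qed.

Lemma coord_le_enorm u i : `|u 0 i| <= enorm u.
Proof.
rewrite -(ler_pXn2r (ltn0Sn 1)) ?nnegrE ?enorm_ge0 // -dotvv.
rewrite real_normK ?num_real // /dot (bigD1 i) //= -expr2 lerDl.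
by apply: sumr_ge0 => j _; rewrite -expr2 sqr_ge0.
Qed.

Lemma enorm_le_coord u (r : R) : 0 <= r ->
  (forall i, `|u 0 i| <= r) -> enorm u <= d%:R * r.
Proof.
move=> r0 ur; have -> : u = \sum_i u 0 i *: delta_mx 0 i by exact: row_sum_delta.
apply: le_trans (enorm_sum _ _ _) _.
have -> : d%:R * r = \sum_(i < d) r by rewrite sumr_const card_ord mulr_natl.
apply: ler_sum => i _; rewrite enormZ.
have -> : enorm (delta_mx 0 i : 'rV[R]_d) = 1.
  rewrite enormE /dot (bigD1 i) //= big1 ?addr0.
    by rewrite mxE !eqxx mulr1 sqrtr1.
  by move=> j ji; rewrite mxE (negbTE ji) andbF mul0r.
by rewrite mulr1.
Qed.

End Euclidean.

(** * Finite nets and orthonormal frames *)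

(** Bounded sets are totally bounded; the net is given as a finite colouring. *)
Lemma finite_colouring (R : realType) (d : nat) (r B : R) : 0 < r ->
  exists (K : finType) (cell : 'rV[R]_d -> K),
    forall u v, enorm u <= B -> enorm v <= B -> cell u = cell v ->
      enorm (u - v) <= r.
Proof.
move=> r0; set w := r / d.+1%:R.
have w0 : 0 < w by rewrite divr_gt0.
pose q := (Num.truncn ((2 * B) / w)).+1.
exists {ffun 'I_d -> 'I_q.+1}.
exists (fun u => [ffun i => inord (Num.truncn ((u 0 i + B) / w))]).
move=> u v uB vB /ffunP uv.
have d0 : 0 < d.+1%:R :> R by rewrite ltr0n.
have dw : d%:R * w <= r.
  rewrite /w mulrCA ler_piMr ?(ltW r0) // ler_pdivrMr // mul1r ler_nat.
  exact: leqnSn.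
apply: le_trans dw; apply: enorm_le_coord; first exact: ltW.
move=> i; have := uv i; rewrite !ffunE => /(congr1 val) /=.
have bnd (x : 'rV[R]_d) : enorm x <= B ->
    0 <= (x 0 i + B) / w /\ Num.truncn ((x 0 i + B) / w) \in gtn q.+1.
  move=> xB; have := coord_le_enorm x i; rewrite ler_norml => /andP[x1 x2].
  split; first by rewrite divr_ge0 ?(ltW w0) //; lra.
  rewrite inE ltnS /q; apply: leqW; apply: le_truncn.
  by rewrite ler_pM2r ?invr_gt0 //; lra.
have [u1] := bnd _ uB; rewrite inE => u2.
have [v1] := bnd _ vB; rewrite inE => v2.
rewrite !inordK // => e; rewrite !mxE.
have /andP[a1 a2] := truncn_itv u1; have /andP[b1 b2] := truncn_itv v1.
rewrite e in a1 a2; set t := Num.truncn _ in a1 a2 b1 b2.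
have {}a1 : t%:R * w <= u 0 i + B by rewrite -ler_pdivlMr.
have {}b1 : t%:R * w <= v 0 i + B by rewrite -ler_pdivlMr.
have {}a2 : u 0 i + B < t.+1%:R * w by rewrite -ltr_pdivrMr.
have {}b2 : v 0 i + B < t.+1%:R * w by rewrite -ltr_pdivrMr.
rewrite -[t.+1%:R]natr1 mulrDl mul1r in a2 b2.
rewrite ler_norml; apply/andP; split; lra.
Qed.

Section Frames.
Variables (R : realType) (d : nat).
Implicit Types (u v e : 'rV[R]_d).

Lemma exists_unit_perp j (F : 'M[R]_(j, d)) : (j < d)%N ->
  exists e : 'rV[R]_d, e *m F^T = 0 /\ enorm e = 1.
Proof.
move=> jd; have rk : kermx F^T != 0.
  rewrite -mxrank_eq0 mxrank_ker subn_eq0 -ltnNge.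
  by apply: leq_ltn_trans jd; exact: rank_leq_col.
have [i Hi] : exists i, row i (kermx F^T) != 0.
  by apply/existsP; move: rk; apply: contraR; rewrite negb_exists => /forallP H;
     apply/eqP/row_matrixP => i; rewrite row0; apply/eqP; move: (H i); rewrite negbK.
set u := row i _ in Hi.
have un0 : enorm u != 0 by apply: contra Hi => /eqP /enorm_eq0 ->.
exists ((enorm u)^-1 *: u); split.
  by rewrite -scalemxAl /u -row_mul mulmx_ker row0 scaler0.
by rewrite enormZ ger0_norm ?invr_ge0 ?enorm_ge0 // mulVf.
Qed.

Lemma frame_full (F : 'M[R]_d) u : F *m F^T = 1%:M -> u *m F^T = 0 -> u = 0.
Proof.
move=> FF uF; have FtF := mulmx1C FF.
by rewrite -(mulmx1 u) -FtF mulmxA uF mul0mx.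
Qed.

(** Orthonormal families are kept as the rows of a matrix [F]; [u *m F^T = 0] says
    that [u] is orthogonal to them. They grow by one vector whenever the normals
    of a path are confined to a smaller space. *)
Lemma frame_cons j (F : 'M[R]_(j, d)) e : F *m F^T = 1%:M -> e *m F^T = 0 ->
  enorm e = 1 -> col_mx e F *m (col_mx e F)^T = 1%:M.
Proof.
move=> FF eF e1; rewrite tr_col_mx mul_col_row FF eF.
have -> : F *m e^T = 0 by rewrite -(trmxK (F *m e^T)) trmx_mul trmxK eF trmx0.
have -> : e *m e^T = 1%:M.
  by apply/rowP => i; rewrite !ord1 dot_mulmx dotvv e1 expr1n mxE.
by rewrite -scalar_mx_block.
Qed.

Lemma perp_cons j (F : 'M[R]_(j, d)) e u :
  dot u e = 0 -> u *m F^T = 0 -> u *m (col_mx e F)^T = 0.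
Proof.
move=> ue uF; rewrite tr_col_mx mul_mx_row uF.
have -> : u *m e^T = 0 by apply/rowP => i; rewrite !ord1 dot_mulmx ue mxE.
by rewrite row_mx0.
Qed.

Lemma perp_consP j (F : 'M[R]_(j, d)) e u :
  u *m (col_mx e F)^T = 0 -> dot u e = 0 /\ u *m F^T = 0.
Proof.
rewrite tr_col_mx mul_mx_row => /eqP; rewrite row_mx_eq0 => /andP[/eqP ue /eqP uF].
by split=> //; rewrite -dot_mulmx ue mxE.
Qed.

End Frames.

(** The vector rejection of [u] from the unit vector [e]. *)
Definition rej (R : realType) (d : nat) (e u : 'rV[R]_d) : 'rV[R]_d :=
  u - dot u e *: e.

Section Rejection.
Variables (R : realType) (d : nat) (e : 'rV[R]_d).
Hypothesis e1 : enorm e = 1.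

Lemma rej_perp u : dot (rej e u) e = 0.
Proof. by rewrite dotBl dotZl dotvv e1 expr1n mulr1 subrr. Qed.

Lemma enorm_rej u : enorm (rej e u) <= enorm u.
Proof.
rewrite -(ler_pXn2r (ltn0Sn 1)) ?nnegrE ?enorm_ge0 // -!dotvv /rej.
rewrite !(dotBl, dotBr, dotZl, dotZr) (dotC e u) (dotvv e) e1.
nra.
Qed.

Lemma rej_frame j (F : 'M[R]_(j, d)) u : e *m F^T = 0 -> u *m F^T = 0 ->
  rej e u *m (col_mx e F)^T = 0.
Proof.
move=> eF uF; apply: perp_cons; first exact: rej_perp.
by rewrite mulmxBl uF -scalemxAl eF scaler0 subr0.
Qed.

Lemma dot_rej_le u v (a : R) : `|dot u e| <= a ->
  `|dot (rej e u) v - dot u v| <= a * enorm v.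
Proof.
move=> ue; rewrite /rej dotBl dotZl addrAC subrr sub0r normrN normrM.
apply: ler_pM => //; apply: le_trans (normr_dot_le _ _) _.
by rewrite e1 mul1r.
Qed.

End Rejection.

(** * Polygonal paths leaving the convex hull of their past *)

(* The real inequalities of the context are hidden from integer arithmetic,
   which would otherwise process them at great cost. *)
Ltac nlia :=
  repeat match goal with H : ?T |- _ =>
    lazymatch T with
    | nat => fail
    | is_true (leq _ _) => fail
    | is_true (andb _ _) => fail
    | @eq nat _ _ => fail
    | _ => clear H
    end
  end; lia.

(** Confinement of the normals of a window to a neighbourhood of a hyperplane of
    the complement of [F]. *)
Definition thin (R : realType) (d j : nat) (F : 'M[R]_(j, d)) (a : R)
    (N : nat -> 'rV[R]_d) (lo hi : nat) : Prop :=
  exists e : 'rV[R]_d, [/\ e *m F^T = 0, enorm e = 1 &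
    forall i, (lo <= i < hi)%N -> `|dot (N i) e| <= a].

(** The quantitative opposite of [thin]: [k] normals of the window span the
    complement of [F], with coefficients under control. *)
Definition spanning (R : realType) (d j : nat) (F : 'M[R]_(j, d)) (k : nat) (B : R)
    (N : nat -> 'rV[R]_d) (lo hi : nat) : Prop :=
  exists sg : nat -> nat, (forall t, (t < k)%N -> (lo <= sg t < hi)%N) /\
    forall v : 'rV[R]_d, v *m F^T = 0 -> exists b : nat -> R,
      (forall t, (t < k)%N -> `|b t| <= B * enorm v) /\
      v = \sum_(t < k) b t *: N (sg t).

(** A normal longer than [a], if any, joins the frame and the others are projected
    along it, which lowers [k]. It appears divided by its norm in the expansion of
    a vector, whence the factor [1 / a] in the new constant. *)
Lemma thin_or_spanning (R : realType) (d k : nat) (a : R) : 0 < a ->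
  exists2 B : R, 0 < B & forall j (F : 'M[R]_(j, d)) N lo hi,
    (j + k)%N = d -> F *m F^T = 1%:M ->
    (forall i, (lo <= i < hi)%N -> enorm (N i) <= 1 /\ N i *m F^T = 0) ->
    thin F a N lo hi \/ spanning F k B N lo hi.
Proof.
move=> a0; elim: k => [|k [B B0 IH]].
  exists 1 => // j F N lo hi; rewrite addn0 => jd; subst j => FF _; right.
  exists (fun=> 0%N); split=> // v vF; exists (fun=> 0); split=> //.
  by rewrite big_ord0; exact: frame_full FF vF.
have kB0 : 0 <= k%:R * B by rewrite mulr_ge0 // ltW.
exists (B + (1 + k%:R * B) / a); first by rewrite addr_gt0 // divr_gt0 //; lra.
move=> j F N lo hi jk FF HN.
have jd : (j < d)%N by rewrite -jk addnS ltnS leq_addr.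
have [[i0 [i0w Ni0]]|small] :=
    pselect (exists i, (lo <= i < hi)%N /\ a < enorm (N i)); last first.
  left; have [e [eF e1]] := exists_unit_perp F jd; exists e; split=> // i iw.
  apply: le_trans (normr_dot_le _ _) _; rewrite e1 mulr1 leNgt.
  by apply/negP => Hi; apply: small; exists i.
set n0 := enorm (N i0) in Ni0.
have n0_gt0 : 0 < n0 by exact: lt_trans Ni0.
pose g := n0^-1 *: N i0.
have g1 : enorm g = 1.
  by rewrite enormZ ger0_norm ?invr_ge0 ?enorm_ge0 // mulVf // gt_eqF.
have gF : g *m F^T = 0 by rewrite -scalemxAl (HN _ i0w).2 scaler0.
have Nn i : (lo <= i < hi)%N ->
    enorm (rej g (N i)) <= 1 /\ rej g (N i) *m (col_mx g F)^T = 0.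
  move=> /HN[n1 nF]; split; last exact: rej_frame.
  exact: le_trans (enorm_rej g1 _) n1.
have jk1 : (1 + j + k)%N = d by rewrite -jk addnS.
have [[e [eF e1 eN]]|[sg [sgw Hsg]]] :=
    IH _ (col_mx g F) (rej g \o N) lo hi jk1 (frame_cons FF gF g1) Nn.
  left; have [eg eF'] := perp_consP eF.
  exists e; split=> // i /eN.
  by rewrite /= /rej dotBl dotZl (dotC g) eg mulr0 subr0.
right; exists (fun t => if (t < k)%N then sg t else i0); split.
  by move=> t _; case: (ltnP t k) => // tk; exact: sgw.
move=> v vF; have [b [bB vE]] := Hsg (rej g v) (rej_frame g1 gF vF).
have v'v := enorm_rej g1 v.
pose c := dot v g - \sum_(t < k) b t * dot (N (sg t)) g.
exists (fun t => if (t < k)%N then b t else c / n0); split.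
  move=> t tk; have v0 := enorm_ge0 v; case: ltnP => tk'.
    apply: le_trans (bB _ tk') _.
    apply: (@le_trans _ _ (B * enorm v)); first by rewrite ler_wpM2l // ltW.
    by rewrite ler_wpM2r // lerDl divr_ge0 // ?(ltW a0) // addr_ge0.
  have cB : `|c| <= (1 + k%:R * B) * enorm v.
    apply: le_trans (ler_normB _ _) _; rewrite mulrDl mul1r; apply: lerD.
      by apply: le_trans (normr_dot_le _ _) _; rewrite g1 mulr1.
    apply: le_trans (ler_norm_sum _ _ _) _.
    have -> : k%:R * B * enorm v = \sum_(i < k) B * enorm v.
      by rewrite sumr_const card_ord -mulrA mulr_natl.
    apply: ler_sum => i _; rewrite normrM -[leRHS]mulr1; apply: ler_pM => //.
      by apply: le_trans (bB _ (ltn_ord i)) _; rewrite ler_wpM2l // ltW.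
    apply: le_trans (normr_dot_le _ _) _; rewrite g1 mulr1.
    exact: (HN _ (sgw _ (ltn_ord i))).1.
  rewrite normrM normfV (gtr0_norm n0_gt0).
  apply: (@le_trans _ _ ((1 + k%:R * B) * enorm v / a)).
    apply: ler_pM => //; first by rewrite invr_ge0 ltW.
    by rewrite lef_pV2 // ?posrE // ltW.
  rewrite mulrAC ler_wpM2r // lerDr; exact: ltW.
rewrite big_ord_recr /= ltnn -scalerA -/g.
have {1}-> : v = rej g v + dot v g *: g by rewrite subrK.
rewrite [in LHS]vE /=.
under [in LHS]eq_bigr do rewrite /rej scalerBr scalerA.
rewrite sumrB -addrA; congr (_ + _).
  by apply: eq_bigr => t _; rewrite ltn_ord.
by rewrite /c scalerBl [in RHS]addrC; congr (- _ + _); rewrite scaler_suml.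
Qed.

(** A path that leaves the convex hull of its past: [N i] supports the past at
    [p i] and the next step climbs along [N i] at an angle bounded by [s], while
    no normal ever sees a later point higher than [E].

    The function [L] measures length along the path; it is kept fixed when the
    normals are projected, so that a step may move less than it spends. The
    slack [a] in [past] allows for normals that support the past only up to an
    error proportional to the length elapsed. *)
Record outgoing (R : realType) (d : nat) (s a E : R) (p N : nat -> 'rV[R]_d)
    (L : nat -> R) (lo hi : nat) : Prop := Outgoing {
  normal_le1 : forall i, (lo <= i < hi)%N -> enorm (N i) <= 1;
  step_le : forall i, (lo <= i < hi)%N -> enorm (p i.+1 - p i) <= L i.+1 - L i;
  climb : forall i, (lo <= i < hi)%N ->
    s * (L i.+1 - L i) <= dot (N i) (p i.+1 - p i);
  past : forall i j, (lo <= j <= i)%N -> (i < hi)%N ->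
    dot (N i) (p j - p i) <= a * (L i - L j);
  gain_le : forall i j, (lo <= i <= j)%N -> (i < hi)%N -> (j <= hi)%N ->
    dot (N i) (p j - p i) <= E
}.

Lemma outgoing_sub (R : realType) (d : nat) (s a E : R) (p N : nat -> 'rV[R]_d)
    L lo hi lo' hi' :
  outgoing s a E p N L lo hi -> (lo <= lo')%N -> (hi' <= hi)%N ->
  outgoing s a E p N L lo' hi'.
Proof.
by case=> H1 H2 H3 H4 H5 l h; split=> *;
  [apply: H1|apply: H2|apply: H3|apply: H4|apply: H5]; nlia.
Qed.

Lemma outgoing_dist (R : realType) (d : nat) (s a E : R) (p N : nat -> 'rV[R]_d)
    L lo hi i j :
  outgoing s a E p N L lo hi -> (lo <= i <= j)%N -> (j <= hi)%N ->
  enorm (p j - p i) <= L j - L i.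
Proof.
move=> H /andP[li ij]; rewrite -(subnK ij).
elim: (j - i)%N => [|n IH] h; first by rewrite add0n !subrr enorm0.
rewrite addSn in h *.
have := step_le H (i := (n + i)%N); have := IH (ltnW h).
move=> H1 /(_ _)H2.
have {}H2 : enorm (p (n + i).+1 - p (n + i)%N) <= L (n + i).+1 - L (n + i)%N.
  by apply: H2; nlia.
have -> : p (n + i).+1 - p i = (p (n + i).+1 - p (n + i)%N) + (p (n + i)%N - p i).
  by rewrite addrA subrK.
apply: le_trans (enormD _ _) _; lra.
Qed.

(** Induction on the dimension restricts the normals, not the points, to a
    subspace: this is what a projection of the normals preserves. *)
Definition length_bound (R : realType) (d k : nat) (s C a : R) : Prop :=
  forall j (F : 'M[R]_(j, d)) p N L E lo hi b,
    (j + k)%N = d -> F *m F^T = 1%:M ->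
    (forall i, (lo <= i < hi)%N -> N i *m F^T = 0) ->
    0 <= b <= a -> 0 <= E -> (lo <= hi)%N -> outgoing s b E p N L lo hi ->
    L hi - L lo <= C * E.

(** Deleting from each normal its small component along [e] costs only slack,
    which the bound of the next lower dimension absorbs. *)
Lemma thin_length (R : realType) (d k j : nat) (s C a1 a' b E : R)
    (F : 'M[R]_(j, d)) p N L lo hi :
  0 < C -> length_bound d k (s / 2) C a1 ->
  (j + k.+1)%N = d -> F *m F^T = 1%:M ->
  (forall i, (lo <= i < hi)%N -> N i *m F^T = 0) ->
  0 <= a' -> a' <= s / 2 -> a' <= a1 / 2 -> a' * C <= 1 / 2 ->
  0 <= b <= a1 / 2 -> 0 <= E -> (lo <= hi)%N ->
  outgoing s b E p N L lo hi -> thin F a' N lo hi ->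
  L hi - L lo <= 2 * C * E.
Proof.
move=> C0 HC jk FF NF a'0 a's a'a a'C /andP[b0 ba] E0 lohi H [e [eF e1 eN]].
have D i j0 := outgoing_dist H (i := i) (j := j0).
have dL0 : 0 <= L hi - L lo.
  by apply: le_trans (enorm_ge0 _) (D lo hi _ _); rewrite ?leqnn.
suff : L hi - L lo <= C * (E + a' * (L hi - L lo)) by nra.
have jk1 : (1 + j + k)%N = d by rewrite -jk addnS.
have NF' i : (lo <= i < hi)%N -> rej e (N i) *m (col_mx e F)^T = 0.
  by move=> iw; apply: rej_frame => //; exact: NF.
have Dab i j0 v : (lo <= i < hi)%N -> enorm v <= j0 ->
    `|dot (rej e (N i)) v - dot (N i) v| <= a' * j0.
  move=> iw vj; apply: le_trans (dot_rej_le e1 v (eN i iw)) _.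
  by rewrite ler_wpM2l.
apply: (HC _ _ p (rej e \o N) L _ lo hi (b + a') jk1 (frame_cons FF eF e1) NF').
- by apply/andP; split; lra.
- by rewrite addr_ge0 // mulr_ge0.
- by [].
split=> [i iw|i iw|i iw|i i' iw ih|i i' iw ih i'h] /=.
- exact: le_trans (enorm_rej e1 _) (normal_le1 H iw).
- exact: step_le H _ iw.
- have := Dab _ _ _ iw (step_le H iw); have := climb H iw.
  have : 0 <= L i.+1 - L i by apply: le_trans (enorm_ge0 _) (step_le H iw).
  rewrite ler_norml => ? ? /andP[? ?]; nra.
- have iw' : (lo <= i < hi)%N by nlia.
  have P1 := past H iw ih.
  have : enorm (p i' - p i) <= L i - L i' by rewrite enormB; apply: D; nlia.
  move=> /(Dab _ _ _ iw'); rewrite ler_norml => /andP[? ?]; lra.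
- have iw' : (lo <= i < hi)%N by nlia.
  have P1 := gain_le H iw ih i'h.
  have P2 : enorm (p i' - p i) <= L i' - L i by apply: D; nlia.
  have P3 : 0 <= L i - L lo by apply: le_trans (enorm_ge0 _) (D _ _ _ _); nlia.
  have P4 : 0 <= L hi - L i' by apply: le_trans (enorm_ge0 _) (D _ _ _ _); nlia.
  have := Dab _ _ _ iw' P2; rewrite ler_norml => /andP[? ?]; nra.
Qed.

(** * The length of an outgoing path *)

Definition height (R : realType) (g : nat -> R) (lo t : nat) : R :=
  \big[Num.max/g lo]_(lo <= i < t.+1) g i.

Section Height.
Variables (R : realType) (g : nat -> R) (lo : nat).

Lemma height_ge t i : (lo <= i <= t)%N -> g i <= height g lo t.
Proof.
move=> it; apply: (@le_bigmax_seq _ _ _ _ _ i) => //.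
by rewrite mem_index_iota ltnS.
Qed.

Lemma height_le t x : (lo <= t)%N ->
  (forall i, (lo <= i <= t)%N -> g i <= x) -> height g lo t <= x.
Proof.
move=> lot gx; rewrite /height big_nat; apply: bigmax_le => [|i /andP[? ?]].
  by apply: gx; rewrite leqnn.
by apply: gx; apply/andP.
Qed.

Lemma height_mono t t' : (t <= t')%N -> height g lo t <= height g lo t'.
Proof. by move=> tt; apply: le_bigmax_nat. Qed.

End Height.

(** Since finitely many windows share the normal [M], the heights in direction
    [M] account for the length of all of them. The term in [L] turns the slack
    [b] of the past condition into an exact supporting inequality, for normals
    of total weight [W]. *)
Section WindowGain.
Variables (R : realType) (d k : nat) (s b E c' kap : R).
Variables (p N : nat -> 'rV[R]_d) (L : nat -> R) (lo hi t0 t1 i j : nat).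
Variables (sg : nat -> nat) (c : nat -> R).
Hypothesis Hout : outgoing s b E p N L lo hi.
Hypotheses (lot0 : (lo <= t0)%N) (t1hi : (t1 <= hi)%N).
Hypotheses (ti : (t0 <= i <= j)%N) (it1 : (i < t1)%N) (jt1 : (j <= t1)%N).
Hypothesis sgw : forall t, (t < k)%N -> (t0 <= sg t < t1)%N.
Hypothesis cw : forall t, (t < k)%N -> 0 <= c t <= 2 * kap.
Hypothesis (b01 : 0 <= b <= 1).
Hypotheses (kap0 : 0 <= kap) (kapc : 8 * kap * k%:R <= c') (E0 : 0 <= E).
Hypothesis gain : c' * (L t1 - L t0) <= dot (N i) (p j - p i).

Let W : R := 1 + 2 * kap * k%:R.
Let S : R := \sum_(t < k) c t.
Let M := N i + \sum_(t < k) c t *: N (sg t).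
Let g tau := dot M (p tau) + W * b * L tau.
Let wsum (f : nat -> R) : R := f i + \sum_(t < k) c t * f (sg t).
Let base (x : nat) : R := dot (N x) (p x) + b * L x.

Let S_itv : 0 <= S /\ 1 + S <= W.
Proof.
split; first by apply: sumr_ge0 => t _; case/andP: (cw (ltn_ord t)).
rewrite /W lerD2l; have -> : 2 * kap * k%:R = \sum_(t < k) 2 * kap.
  by rewrite sumr_const card_ord mulr_natr.
by apply: ler_sum => t _; case/andP: (cw (ltn_ord t)).
Qed.

Let wsum_le (f f' : nat -> R) :
  (forall x, (t0 <= x < t1)%N -> f x <= f' x) -> wsum f <= wsum f'.
Proof.
move=> ff; apply: lerD; first by apply: ff; nlia.
apply: ler_sum => t _; apply: ler_wpM2l; first by case/andP: (cw (ltn_ord t)).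
exact/ff/sgw.
Qed.

Let wsumD (f : nat -> R) (x : R) : wsum (fun y => f y + x) = wsum f + (1 + S) * x.
Proof.
rewrite /wsum; under eq_bigr do rewrite mulrDr.
rewrite big_split /= -mulr_suml -/S; ring.
Qed.

Let gE tau : g tau =
  wsum (fun x => dot (N x) (p tau) + b * L tau) + (W - (1 + S)) * b * L tau.
Proof.
rewrite wsumD /g /M dotDl dot_suml /wsum.
under eq_bigr do rewrite dotZl.
ring.
Qed.

Let Lmono x y : (lo <= x <= y)%N -> (y <= hi)%N -> L x <= L y.
Proof.
move=> xy yhi; rewrite -subr_ge0.
exact: le_trans (enorm_ge0 _) (outgoing_dist Hout xy yhi).
Qed.

Let Npast x tau : (t0 <= x < t1)%N -> (lo <= tau <= x)%N ->
  dot (N x) (p tau) + b * L tau <= base x.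
Proof.
move=> xw tx; have := past Hout tx; rewrite dotBr /base => H.
have {}H := H ltac:(nlia); lra.
Qed.

Let Nnear x tau : (t0 <= x < t1)%N -> (t0 <= tau <= t1)%N ->
  base x - 2 * (L t1 - L t0) <= dot (N x) (p tau) + b * L tau.
Proof.
move=> xw tw; case/andP: b01 => b0 b1.
have L0x : L t0 <= L x by apply: Lmono; nlia.
have L0tau : L t0 <= L tau by apply: Lmono; nlia.
have Lx1 : L x <= L t1 by apply: Lmono; nlia.
have Ltau1 : L tau <= L t1 by apply: Lmono; nlia.
have pd : enorm (p tau - p x) <= L t1 - L t0.
  case: (leqP x tau) => xt.
    by apply: (@le_trans _ _ (L tau - L x)); [apply: (outgoing_dist Hout); nlia|lra].
  rewrite enormB; apply: (@le_trans _ _ (L x - L tau)).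
    by apply: (outgoing_dist Hout); nlia.
  lra.
have N1 : enorm (N x) <= 1 by apply: (normal_le1 Hout); nlia.
have : `|dot (N x) (p tau - p x)| <= L t1 - L t0.
  apply: le_trans (normr_dot_le _ _) _; rewrite -[leRHS]mul1r.
  by apply: ler_pM => //; exact: enorm_ge0.
rewrite dotBr /base ler_norml => /andP[H _]; nra.
Qed.

(** All the past lies below the level that the window's normals have at their own
    points, up to the slack, whereas at [p j] the normal [N i] has gained
    [c' * (L t1 - L t0)] over it. The weights [c t] are too small for the other
    normals to lose more than half of that. *)
Lemma window_gain :
  c' / 2 * (L t1 - L t0) <= height g lo t1 - height g lo t0.
Proof.
have [S0 SW] := S_itv; case/andP: b01 => b0 b1.
have l0 : 0 <= L t1 - L t0 by rewrite subr_ge0; apply: Lmono; nlia.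
have up : height g lo t0 <= wsum base + (W - (1 + S)) * b * L t0.
  apply: height_le => // tau tw; rewrite gE; apply: lerD.
    by apply: wsum_le => x xw; apply: Npast => //; nlia.
  rewrite ler_wpM2l //; first by rewrite mulr_ge0 // subr_ge0.
  by apply: Lmono; nlia.
have dn : wsum base + c' * (L t1 - L t0) - S * (2 * (L t1 - L t0)) +
    (W - (1 + S)) * b * L t0 <= g j.
  rewrite gE; apply: lerD; last first.
    rewrite ler_wpM2l //; first by rewrite mulr_ge0 // subr_ge0.
    by apply: Lmono; nlia.
  have A1 : base i + c' * (L t1 - L t0) <= dot (N i) (p j) + b * L j.
    have Lij : b * L i <= b * L j by rewrite ler_wpM2l // Lmono //; nlia.
    by move: gain; rewrite /base dotBr; lra.
  have A2 : \sum_(t < k) c t * base (sg t) - S * (2 * (L t1 - L t0)) <=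
      \sum_(t < k) c t * (dot (N (sg t)) (p j) + b * L j).
    rewrite lerBlDr /S mulr_suml -big_split /=.
    apply: ler_sum => t _; rewrite -mulrDr; apply: ler_wpM2l.
      by case/andP: (cw (ltn_ord t)).
    by rewrite -lerBlDr; apply: Nnear; [exact: sgw|nlia].
  rewrite /wsum; lra.
have hj : g j <= height g lo t1 by apply: height_ge; nlia.
have : S * 2 <= c' / 2 by move: SW kapc; rewrite /W; lra.
nra.
Qed.

(** The bound [E] on the gain of each normal of the window limits what [M], their
    combination, can still gain afterwards. *)
Lemma window_room :
  height g lo hi - height g lo t0 <= W * (E + 2 * b * (L hi - L lo) + 2 * (L t1 - L t0)).
Proof.
have [S0 SW] := S_itv; case/andP: b01 => b0 b1.
have l0 : 0 <= L t1 - L t0 by rewrite subr_ge0; apply: Lmono; nlia.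
have L1 : L lo <= L t0 by apply: Lmono; nlia.
have L2 : L t0 <= L hi by apply: Lmono; nlia.
have up : height g lo hi <= wsum base + (1 + S) * (E + b * (L hi - L lo)) +
    (W - (1 + S)) * b * L hi.
  apply: height_le => [|tau tw]; first by nlia.
  rewrite gE; apply: lerD; last first.
    rewrite ler_wpM2l //; first by rewrite mulr_ge0 // subr_ge0.
    by apply: Lmono; nlia.
  rewrite -wsumD; apply: wsum_le => x xw.
  have ? : L lo <= L x by apply: Lmono; nlia.
  have ? : L x <= L hi by apply: Lmono; nlia.
  have ? : L lo <= L tau by apply: Lmono; nlia.
  have ? : L tau <= L hi by apply: Lmono; nlia.
  case: (leqP tau x) => xt.
    have := Npast xw (tau := tau); rewrite /base => H.
    have {}H := H ltac:(nlia).
    by apply: le_trans H _; rewrite lerDl addr_ge0 // mulr_ge0 // subr_ge0; lra.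
  have := gain_le Hout (i := x) (j := tau); rewrite dotBr /base => H.
  have {}H := H ltac:(nlia) ltac:(nlia) ltac:(nlia); nra.
have dn : wsum base - (1 + S) * (2 * (L t1 - L t0)) + (W - (1 + S)) * b * L t0 <= g t0.
  rewrite gE; apply: lerD => //; rewrite -mulrN -wsumD.
  by apply: wsum_le => x xw; apply: Nnear => //; nlia.
have hj : g t0 <= height g lo t0 by apply: height_ge; nlia.
have P1 : (1 + S) * (E + b * (L hi - L lo) + 2 * (L t1 - L t0)) <=
    W * (E + b * (L hi - L lo) + 2 * (L t1 - L t0)).
  rewrite ler_wpM2r // !addr_ge0 // mulr_ge0 //; lra.
have P2 : (W - (1 + S)) * (b * (L hi - L t0)) <= W * (b * (L hi - L lo)).
  apply: ler_pM; rewrite ?mulr_ge0 ?subr_ge0 //; first by lra.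
  by rewrite ler_wpM2l // lerD2l lerN2.
lra.
Qed.

End WindowGain.

(** Without its last step the window is thin, so its length is bounded by the
    largest gain in it. If all gains were small compared with the length of the
    window, this and the climb of the last step would contradict that length. *)
Lemma exists_gain (R : realType) (d k j : nat) (s C a1 a' b E c' : R)
    (F : 'M[R]_(j, d)) p N L lo hi t0 t1 :
  0 < s -> 0 < C -> length_bound d k (s / 2) C a1 ->
  (j + k.+1)%N = d -> F *m F^T = 1%:M ->
  (forall i, (lo <= i < hi)%N -> N i *m F^T = 0) ->
  0 <= a' -> a' <= s / 2 -> a' <= a1 / 2 -> a' * C <= 1 / 2 ->
  0 <= b <= a1 / 2 -> 0 < c' -> c' * (2 * C + s^-1) <= 1 / 2 ->
  outgoing s b E p N L lo hi -> (lo <= t0 < t1)%N -> (t1 <= hi)%N ->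
  thin F a' N t0 t1.-1 ->
  exists i i', [/\ (t0 <= i <= i')%N, (i < t1)%N, (i' <= t1)%N &
    c' * (L t1 - L t0) <= dot (N i) (p i' - p i)].
Proof.
move=> s0 C0 HC jk FF NF a'0 a's a'a a'C b0 c0 cC H tw t1h Hthin.
apply: contrapT => /forallNP noi.
have no i i' : (t0 <= i <= i')%N -> (i < t1)%N -> (i' <= t1)%N ->
    dot (N i) (p i' - p i) < c' * (L t1 - L t0).
  move=> h1 h2 h3; rewrite ltNge; apply/negP => h4.
  by have /forallNP /(_ i') [] := noi i.
have H' : outgoing s b (c' * (L t1 - L t0)) p N L t0 t1.
  have H' : outgoing s b E p N L t0 t1 by apply: (outgoing_sub H); nlia.
  split; [exact: normal_le1 H'|exact: step_le H'|exact: climb H'|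
          exact: past H'|move=> i i' h1 h2 h3; exact/ltW/no].
have l0 : 0 <= L t1 - L t0.
  by apply: le_trans (enorm_ge0 _) (outgoing_dist H' (i := t0) (j := t1) _ _); nlia.
have pos : 0 < c' * (L t1 - L t0).
  by have := no t0 t0; rewrite subrr dot0r; apply; nlia.
have th : L t1.-1 - L t0 <= 2 * C * (c' * (L t1 - L t0)).
  apply: (thin_length (p := p) C0 HC jk FF _ a'0 a's a'a a'C b0 _ _ _ Hthin).
  - by move=> i iw; apply: NF; nlia.
  - exact: ltW.
  - by nlia.
  - by apply: (outgoing_sub H'); nlia.
have last : s * (L t1 - L t1.-1) <= c' * (L t1 - L t0).
  have t1E : t1.-1.+1 = t1 by nlia.
  have := climb H' (i := t1.-1); rewrite t1E => cl.
  apply: le_trans (cl _) _; first by nlia.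
  by apply/ltW/no; nlia.
have {}last : L t1 - L t1.-1 <= s^-1 * (c' * (L t1 - L t0)).
  by rewrite ler_pdivlMl.
nra.
Qed.

(** Cut the path into minimal windows whose normals are not within [a'] of a
    hyperplane. Such a window gains height proportional to its length in one of
    its normals, hence in every direction near the barycentre [Z] of finitely
    many of them, because these span: there, the lower-dimensional bound has been
    traded for a solid cone of directions. Finitely many directions then suffice
    for all windows, and in each of them the total gain is bounded. *)
Theorem outgoing_length (R : realType) (d k : nat) (s : R) : 0 < s ->
  exists C a : R, [/\ 0 < C, 0 < a & length_bound d k s C a].
Proof.
elim: k s => [|k IH] s s0.
  exists 1, 1; split=> // j F p N L E lo hi b; rewrite addn0 => jd; subst j.
  move=> FF NF _ E0 lohi H; rewrite mul1r; apply: le_trans E0.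
  have -> : hi = (hi - lo + lo)%N by nlia.
  have : (hi - lo + lo <= hi)%N by nlia.
  elim: (hi - lo)%N => [|n IHn] h; first by rewrite subrr.
  have iw : (lo <= n + lo < hi)%N by nlia.
  have := climb H iw; rewrite (frame_full FF (NF _ iw)) dot0l pmulr_rle0 //.
  have := IHn (ltnW h); rewrite addSn; lra.
have s20 : 0 < s / 2 by rewrite divr_gt0.
have [C' [a1 [C'0 a10 HC]]] := IH _ s20.
pose a' := Num.min (Num.min (s / 2) (a1 / 2)) (2 * C')^-1.
have a'0 : 0 < a' by rewrite !lt_min s20 divr_gt0 // invr_gt0 mulr_gt0.
have a's : a' <= s / 2 by rewrite !ge_min lexx.
have a'a : a' <= a1 / 2 by rewrite !ge_min lexx orbT.
have a'C : a' * C' <= 1 / 2.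
  have : a' <= (2 * C')^-1 by rewrite ge_min lexx orbT.
  by rewrite invfM -ler_pdivlMr // mul1r.
have [B B0 HB] := thin_or_spanning d k.+1 a'0.
have sV0 : 0 < s^-1 by rewrite invr_gt0.
pose c' := (2 * (2 * C' + s^-1))^-1.
have c0 : 0 < c' by rewrite invr_gt0 mulr_gt0 // addr_gt0 // mulr_gt0.
have cC : c' * (2 * C' + s^-1) <= 1 / 2.
  by rewrite /c' invfM -mulrA mulVf ?mul1r ?mulr1 // gt_eqF // addr_gt0 // mulr_gt0.
have k0 : 0 < k.+1%:R :> R by rewrite ltr0n.
pose kap := c' / (8 * k.+1%:R).
have kap0 : 0 < kap by rewrite divr_gt0 // mulr_gt0.
have kapc : 8 * kap * k.+1%:R <= c'.
  by rewrite mulrAC mulrC /kap mulfVK // gt_eqF // mulr_gt0.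
pose W := 1 + 2 * kap * k.+1%:R.
have W0 : 0 <= W by rewrite addr_ge0 // mulr_ge0 // mulr_ge0 // ltW.
have [K [cell Hcell]] := finite_colouring d W (divr_gt0 kap0 B0).
pose nK : R := #|K|%:R.
have nK0 : 0 <= nK by exact: ler0n.
have nKW0 : 0 <= nK * W by exact: mulr_ge0.
pose a := Num.min (Num.min (a1 / 2) 1) (c' / (8 * (nK * W + 1))).
have den0 : 0 < 8 * (nK * W + 1) by lra.
have a0 : 0 < a by rewrite !lt_min divr_gt0 //= ltr01 divr_gt0.
pose C := 4 / c' * (nK * W * (1 + 2 / c') + c' * C' + 1).
have cV0 : 0 < 2 / c' by rewrite divr_gt0.
have C0 : 0 < C.
  apply: mulr_gt0; first by rewrite divr_gt0.
  have : 0 < c' * C' by exact: mulr_gt0.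
  have : 0 <= nK * W * (1 + 2 / c') by apply: mulr_ge0 => //; lra.
  lra.
exists C, a; split=> // j F p N L E lo hi b jk FF NF /andP[b0 ba] E0 lohi H.
have ba1 : b <= a1 / 2 by apply: le_trans ba _; rewrite !ge_min lexx.
have b1 : b <= 1 by apply: le_trans ba _; rewrite !ge_min lexx orbT.
have bK : b * (8 * (nK * W + 1)) <= c'.
  by rewrite -ler_pdivlMr //; apply: le_trans ba _; rewrite ge_min lexx orbT.
have jd : (j < d)%N by rewrite -jk addnS ltnS leq_addr.
have b0a1 : 0 <= b <= a1 / 2 by rewrite b0.
have Lm x y : (lo <= x <= y)%N -> (y <= hi)%N -> 0 <= L y - L x.
  by move=> xy yh; exact: le_trans (enorm_ge0 _) (outgoing_dist H xy yh).
pose Lam := L hi - L lo.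
have Lam0 : 0 <= Lam by apply: Lm => //; rewrite leqnn.
pose room := W * (E + 2 * b * Lam + 2 * (E / c')).
have room0 : 0 <= room.
  apply: mulr_ge0 => //; apply: addr_ge0; last by rewrite mulr_ge0 // divr_ge0 // ltW.
  by apply: addr_ge0 => //; rewrite !mulr_ge0.
pose rep x := xget 0 [set Z | [/\ Z *m F^T = 0, enorm Z <= W & cell Z = x]].
pose g x tau := dot (rep x) (p tau) + W * b * L tau.
(* Capping from below by [room] makes the total increase of [phi x] bounded; the
   cap is inactive from the first window of colour [x] on, by [window_room]. *)
pose phi x t := Num.max (height (g x) lo t) (height (g x) lo hi - room).
pose Phi t := \sum_x phi x t.
have phi_mono x t t' : (t <= t')%N -> phi x t <= phi x t'.
  move=> tt; rewrite ge_max /phi !le_max lexx orbT andbT.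
  by rewrite (height_mono (g x) lo tt).
have Phi_mono t t' : (t <= t')%N -> Phi t <= Phi t'.
  by move=> tt; apply: ler_sum => x _; exact: phi_mono.
have step t0 t1 : (lo <= t0 < t1)%N -> (t1 <= hi)%N ->
    thin F a' N t0 t1.-1 -> ~ thin F a' N t0 t1 ->
    c' / 2 * (L t1 - L t0) <= Phi t1 - Phi t0.
  move=> tw t1h th nth.
  have [i [i' [ii' it1 i't1 gain]]] := exists_gain s0 C'0 HC jk FF NF
    (ltW a'0) a's a'a a'C b0a1 c0 cC H tw t1h th.
  have cl_le : c' * (L t1 - L t0) <= E.
    by apply: le_trans gain _; apply: (gain_le H); nlia.
  have win x : (t0 <= x < t1)%N -> enorm (N x) <= 1 /\ N x *m F^T = 0.
    by move=> xw; split; [apply: (normal_le1 H)|apply: NF]; nlia.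
  have [//|[sg [sgw Hsg]]] := HB _ F N t0 t1 jk FF win.
  (* The weight [kap] leaves room to move the coefficients of [Z] without
     losing their sign, so a whole ball around [Z] consists of admissible [M]. *)
  pose Z := N i + kap *: \sum_(t < k.+1) N (sg t).
  have ZF : Z *m F^T = 0.
    rewrite mulmxDl -scalemxAl mulmx_suml (win i _).2; last by nlia.
    rewrite big1 ?scaler0 ?addr0 // => t _; exact: (win _ (sgw _ (ltn_ord t))).2.
  have ZW : enorm Z <= W.
    apply: le_trans (enormD _ _) _; apply: lerD; first by apply: (win _ _).1; nlia.
    rewrite enormZ gtr0_norm // -mulrA mulrCA ler_wpM2l ?(ltW kap0) //.
    apply: le_trans (enorm_sum _ _ _) _.
    apply: (@le_trans _ _ (\sum_(t < k.+1) 1)); last first.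
      by rewrite sumr_const card_ord; lra.
    by apply: ler_sum => t _; exact: (win _ (sgw _ (ltn_ord t))).1.
  set x := cell Z.
  have [MF MW cM] : [/\ rep x *m F^T = 0, enorm (rep x) <= W & cell (rep x) = x].
    suff /(xgetPex 0) : exists u, [set u | [/\ u *m F^T = 0, enorm u <= W & cell u = x]] u.
      by [].
    by exists Z; split.
  have near := Hcell _ _ MW ZW cM.
  have [be [beB ME]] : exists be : nat -> R,
      (forall t, (t < k.+1)%N -> `|be t| <= B * enorm (rep x - Z)) /\
      rep x - Z = \sum_(t < k.+1) be t *: N (sg t).
    by apply: Hsg; rewrite mulmxBl MF ZF subrr.
  pose c t := kap + be t.
  have cw t : (t < k.+1)%N -> 0 <= c t <= 2 * kap.
    move=> /beB; have : B * enorm (rep x - Z) <= kap.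
      by rewrite mulrC -ler_pdivlMr.
    by move=> h1 h2; have := le_trans h2 h1; rewrite ler_norml /c => /andP[h3 h4];
       apply/andP; split; lra.
  have {}ME : N i + \sum_(t < k.+1) c t *: N (sg t) = rep x.
    rewrite -[RHS](subrK Z) ME [RHS]addrC /Z -addrA; congr (_ + _).
    rewrite scaler_sumr -big_split /=.
    by apply: eq_bigr => t _; rewrite -scalerDl.
  have b01 : 0 <= b <= 1 by rewrite b0.
  have lot0 : (lo <= t0)%N by nlia.
  have := window_gain H lot0 t1h ii' it1 i't1 sgw cw b01 kapc gain.
  have := window_room H lot0 t1h ii' it1 i't1 sgw cw b01 E0.
  rewrite /= ME -/W -/(g x) => rm gn; apply: le_trans gn _.
  have r1 : height (g x) lo hi - room <= height (g x) lo t0.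
    rewrite lerBlDl -lerBlDr; apply: le_trans rm _; rewrite ler_wpM2l // lerD2l.
    by rewrite ler_wpM2l // ler_pdivlMr // mulrC.
  rewrite /Phi -sumrB (bigD1 x) //= -[leLHS]addr0; apply: lerD; last first.
    by apply: sumr_ge0 => y _; rewrite subr_ge0 phi_mono //; nlia.
  by rewrite {2}/phi (max_idPl r1) lerD2r /phi le_max lexx.
(* Greedy subdivision into minimal windows that are not thin; a thin remainder
   is short by [thin_length]. *)
have main n : forall t0, (lo <= t0 <= hi)%N -> (hi - t0 <= n)%N ->
    c' / 2 * (L hi - L t0) <= Phi hi - Phi t0 + c' * C' * E.
  elim: n => [|n IHn] t0 tw hn.
    have -> : t0 = hi by nlia.
    by rewrite !subrr mulr0 add0r !mulr_ge0 // ltW.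
  have [th|nth] := pselect (thin F a' N t0 hi).
    have h1 : L hi - L t0 <= 2 * C' * E.
      apply: (thin_length (p := p) C'0 HC jk FF _ (ltW a'0) a's a'a a'C b0a1 E0 _ _ th).
      - by move=> i iw; apply: NF; nlia.
      - by nlia.
      - by apply: (outgoing_sub H); nlia.
    have h2 : Phi t0 <= Phi hi by apply: Phi_mono; nlia.
    have : c' / 2 * (L hi - L t0) <= c' / 2 * (2 * C' * E).
      by rewrite ler_wpM2l // divr_ge0 // ltW.
    lra.
  pose P t := (t0 <= t <= hi)%N && `[< ~ thin F a' N t0 t >].
  have exP : exists t, P t.
    by exists hi; apply/andP; split; [nlia|exact/asboolP].
  case: (ex_minnP exP) => t1 /andP[t1w /asboolP nth1] t1min.
  have t01 : (t0 < t1)%N.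
    rewrite ltnNge; apply/negP => t10; apply: nth1.
    have [e [eF e1]] := exists_unit_perp F jd; exists e; split=> // i; nlia.
  have th1 : thin F a' N t0 t1.-1.
    apply: contrapT => nth2; have : P t1.-1.
      by apply/andP; split; [nlia|exact/asboolP].
    by move=> /t1min; nlia.
  have h1 : c' / 2 * (L t1 - L t0) <= Phi t1 - Phi t0 by apply: step => //; nlia.
  have h2 : c' / 2 * (L hi - L t1) <= Phi hi - Phi t1 + c' * C' * E.
    by apply: IHn; nlia.
  lra.
have fin : c' / 2 * Lam <= Phi hi - Phi lo + c' * C' * E.
  by apply: (main (hi - lo)%N); nlia.
have PhiB : Phi hi - Phi lo <= nK * room.
  have -> : nK * room = \sum_(x : K) room by rewrite sumr_const mulr_natl.
  rewrite /Phi -sumrB; apply: ler_sum => x _.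
  have h1 : phi x hi = height (g x) lo hi.
    by rewrite /phi (max_idPl _) // lerBlDr lerDl.
  have h2 : height (g x) lo hi - room <= phi x lo by rewrite /phi le_max lexx orbT.
  rewrite h1; lra.
have bLam : 2 * b * Lam * (nK * W) <= c' / 4 * Lam.
  have : b * (nK * W) <= c' / 8 by lra.
  nra.
have roomE : nK * room =
    nK * W * (1 + 2 / c') * E + 2 * b * Lam * (nK * W) by rewrite /room; ring.
have {fin PhiB bLam} : c' / 4 * Lam <= (nK * W * (1 + 2 / c') + c' * C' + 1) * E.
  by rewrite 2!mulrDl mul1r; rewrite roomE in PhiB; lra.
by rewrite -ler_pdivlMl ?divr_gt0 // invf_div mulrA.
Qed.

(** * Descent along quasi-convex level sets stays near the minimizer *)

(** Normals that support the future become, in reversed time, normals that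
    support the past; the empty frame puts no constraint on them. *)
Lemma reversed_length (R : realType) (d : nat) (s : R) : 0 < s ->
  exists2 C : R, 0 < C & forall (x N : nat -> 'rV[R]_d) (E : R) (a b : nat),
    (a <= b)%N -> 0 <= E ->
    (forall i, (a <= i <= b)%N -> enorm (N i) <= 1) ->
    (forall i j, (a <= i <= j)%N -> (j <= b)%N -> dot (N i) (x j - x i) <= 0) ->
    (forall i, (a <= i < b)%N ->
       s * enorm (x i.+1 - x i) <= dot (N i.+1) (x i - x i.+1)) ->
    (forall i j, (a <= j <= i)%N -> (i <= b)%N -> dot (N i) (x j - x i) <= E) ->
    enorm (x b - x a) <= C * E.
Proof.
move=> s0; have [C [a0 [C0 a00 HC]]] := outgoing_length d d s0.
exists C => // x N E a b ab E0 N1 fut clm gn.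
pose p i := x (b - i)%N.
pose L i := \sum_(t < i) enorm (p t.+1 - p t).
have LS i : L i.+1 - L i = enorm (p i.+1 - p i).
  by rewrite /L big_ord_recr /= addrAC subrr add0r.
have H : outgoing s 0 E p (fun i => N (b - i)%N) L 0 (b - a).
  split.
  - by move=> i iw; apply: N1; nlia.
  - by move=> i _; rewrite LS.
  - move=> i iw; rewrite LS /p.
    have e : (b - i)%N = (b - i.+1).+1 by nlia.
    by rewrite e enormB; apply: clm; nlia.
  - by move=> i j ij ib; rewrite mul0r; apply: fut; nlia.
  - by move=> i j ij ib jb; apply: gn; nlia.
have a00' : (0 : R) <= 0 <= a0 by rewrite lexx ltW.
apply: (@le_trans _ _ (L (b - a)%N - L 0%N)).
  have := outgoing_dist H (i := 0%N) (j := (b - a)%N).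
  by rewrite /p subn0 subKn // enormB; exact.
apply: (HC 0%N 0 p _ L E _ _ 0 (add0n d) _ _ a00' E0 (leq0n _) H).
  by rewrite (flatmx0 1%:M); exact: flatmx0.
by move=> i _; exact: thinmx0.
Qed.

(** At each scale [r * Th ^+ m] reached by the path, the length bound forces a
    large gain in some normal. The earlier of two almost equal normals of this
    kind could not support what the path gains along the later one, at a much
    larger scale. So the scales reached inject into a finite net of the ball. *)
Lemma discrete_excursion (R : realType) (d : nat) (s : R) : 0 < s ->
  exists2 C : R, 1 <= C & forall (n : nat) (x N : nat -> 'rV[R]_d) (r : R),
    0 < r -> enorm (x 0%N) <= r ->
    (forall i, (i < n)%N -> enorm (x i.+1 - x i) <= r) ->
    (forall i, (i <= n)%N -> enorm (N i) <= 1) ->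
    (forall i, (i <= n)%N -> 0 <= dot (N i) (x i)) ->
    (forall i j, (i <= j)%N -> (j <= n)%N -> dot (N i) (x j - x i) <= 0) ->
    (forall i, (i < n)%N ->
       s * enorm (x i.+1 - x i) <= dot (N i.+1) (x i - x i.+1)) ->
    enorm (x n) <= C * r.
Proof.
move=> s0; have [C C0 HC] := reversed_length d s0.
have CV0 : 0 < C^-1 by rewrite invr_gt0.
have eps0 : 0 < C^-1 / 16 by rewrite divr_gt0.
have [K [cell Hcell]] := finite_colouring d 1 eps0.
pose Th : R := 16 * C + 4.
have Th1 : 1 <= Th by rewrite /Th; lra.
exists (Th ^+ #|K|.+2); first exact: exprn_ege1.
move=> n x N r r0 x0 dx N1 Nx fut clm; rewrite leNgt; apply/negP => big.
pose far m i := r * Th ^+ m <= enorm (x i).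
pose tau m := find (far m) (iota 0 n.+1).
have ThX m : 0 < Th ^+ m by rewrite exprn_gt0 //; lra.
have tauP m : (m <= #|K|.+2)%N -> (tau m <= n)%N /\ far m (tau m).
  move=> mK; have hs : has (far m) (iota 0 n.+1).
    apply/hasP; exists n; first by rewrite mem_iota /= add0n leqnn.
    apply/ltW/(le_lt_trans _ big); rewrite mulrC ler_wpM2r ?(ltW r0) //.
    exact: ler_weXn2l.
  have tn : (tau m < n.+1)%N by rewrite /tau -{2}(size_iota 0 n.+1) -has_find.
  by split=> //; have := nth_find 0%N hs; rewrite nth_iota.
have tau_min m i : (i < tau m)%N -> (i <= n)%N -> enorm (x i) < r * Th ^+ m.
  move=> im ilen; have := before_find 0%N im.
  by rewrite nth_iota //= add0n /far leNgt => /negbFE.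
have tauS m : (m < #|K|.+2)%N -> (tau m <= tau m.+1)%N.
  move=> mK; rewrite leqNgt; apply/negP => h.
  have [h1 h2] := tauP _ mK.
  have := tau_min _ _ h h1; apply/negP; rewrite -leNgt; apply: le_trans h2.
  by rewrite ler_wpM2l ?(ltW r0) // ler_weXn2l.
have tau_mono m m' : (m <= m')%N -> (m' <= #|K|.+2)%N -> (tau m <= tau m')%N.
  move=> /subnK <-; elim: (m' - m)%N => [|q IH] h; first by rewrite add0n.
  by apply: leq_trans (IH (ltnW h)) _; apply: tauS.
have near m i : (0 < m <= #|K|.+2)%N -> (i <= tau m)%N -> enorm (x i) <= 2 * (r * Th ^+ m).
  move=> /andP[m0 mK] im; have [tn tf] := tauP _ mK.
  have rT : r <= r * Th ^+ m by rewrite ler_peMr ?(ltW r0) // exprn_ege1.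
  have [lt|ge] := ltnP i (tau m).
    have := tau_min _ _ lt; have : (i <= n)%N by nlia.
    by move=> h1 h2; have := h2 h1; lra.
  have {im ge} -> : i = tau m by nlia.
  case E : (tau m) => [|i']; first lra.
  have h1 : (i' < tau m)%N by rewrite E.
  have h2 : (i' < n)%N by nlia.
  have h3 := tau_min _ _ h1 (ltnW h2); have h4 := dx _ h2.
  have := enorm_le_sub (x i'.+1) (x i'); lra.
have seg (m : 'I_#|K|.+1) : exists ij : nat * nat,
    [/\ (tau m.+1 <= ij.2 <= ij.1)%N, (ij.1 <= tau m.+2)%N &
      r * Th ^+ m.+2 * (C^-1 / 4) < dot (N ij.1) (x ij.2)].
  have mK : (m.+2 <= #|K|.+2)%N by rewrite !ltnS; have := ltn_ord m.
  apply: contrapT => /forallNP no.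
  have [t2n t2f] := tauP _ mK.
  have t12 := tauS _ mK.
  have E0 : 0 <= r * Th ^+ m.+2 * (C^-1 / 4).
    by apply/ltW/mulr_gt0; [exact: mulr_gt0|rewrite divr_gt0].
  have := HC x N _ _ _ t12 E0.
  have nr1 : enorm (x (tau m.+1)) <= 2 * (r * Th ^+ m.+1).
    by apply: near => //; nlia.
  have := enorm_le_sub (x (tau m.+2)) (x (tau m.+1)).
  move=> h1 h2.
  have : enorm (x (tau m.+2) - x (tau m.+1)) <= C * (r * Th ^+ m.+2 * (C^-1 / 4)).
    apply: h2.
    - by move=> i iw; apply: N1; nlia.
    - by move=> i j ij jb; apply: fut; nlia.
    - by move=> i iw; apply: clm; nlia.
    - move=> i j ij ib; rewrite dotBr.
      have ni : 0 <= dot (N i) (x i) by apply: Nx; nlia.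
      suff : dot (N i) (x j) <= r * Th ^+ m.+2 * (C^-1 / 4) by lra.
      by rewrite leNgt; apply/negP => lt; apply: (no (i, j)).
  have -> : C * (r * Th ^+ m.+2 * (C^-1 / 4)) = r * Th ^+ m.+2 / 4.
    by rewrite mulrCA (mulrA C) mulfV ?mul1r // gt_eqF.
  move=> h3; move: t2f; rewrite /far => h4.
  have : r * Th ^+ m.+2 = Th * (r * Th ^+ m.+1) by rewrite (exprS Th m.+1) mulrCA.
  have := mulr_gt0 r0 (ThX m.+1); rewrite /Th; nra.
have [ij Hij] := choice seg.
have ninj : ~ injective (fun m => cell (N (ij m).1)).
  by move=> /leq_card; rewrite card_ord ltnn.
apply: ninj => m m' cc; apply: contrapT => mm'.
wlog lt : m m' cc mm' / (m' < m)%N => [W|].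
  have [h|h|/val_inj] := ltngtP m m'; [|exact: (W m m')|exact: mm'].
  by apply: (W m' m) => // e; apply: mm'.
have [h1 h2 h3] := Hij m; have [h1' h2' h3'] := Hij m'.
have mK := ltn_ord m.
have t2n : (tau m.+2 <= n)%N by apply: (tauP _ _).1.
have t12 : (tau m'.+2 <= tau m.+1)%N by apply: tau_mono; nlia.
have nn := Hcell _ _ (N1 (ij m).1 _) (N1 (ij m').1 _) cc.
have {}nn : enorm (N (ij m).1 - N (ij m').1) <= C^-1 / 16 by apply: nn; nlia.
have f1 : dot (N (ij m').1) (x (ij m).2 - x (ij m').1) <= 0 by apply: fut; nlia.
have f2 : dot (N (ij m').1) (x (ij m').1) <= 2 * (r * Th ^+ m.+1).
  apply: (@le_trans _ _ (1 * enorm (x (ij m').1))).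
    by apply: le_trans (dot_le _ _) _; rewrite ler_wpM2r ?enorm_ge0 // N1 //; nlia.
  by rewrite mul1r; apply: near; nlia.
have f3 : dot (N (ij m).1 - N (ij m').1) (x (ij m).2) <=
    C^-1 / 16 * (2 * (r * Th ^+ m.+2)).
  apply: le_trans (dot_le _ _) _; apply: ler_pM; rewrite ?enorm_ge0 //.
  by apply: near => //; nlia.
move: f1 f3; rewrite dotBr dotBl => f1 f3.
have e : r * Th ^+ m.+2 = Th * (r * Th ^+ m.+1) by rewrite (exprS Th m.+1) mulrCA.
rewrite e in h3 f3; have pos := mulr_gt0 r0 (ThX m.+1).
have CT : 16 <= C^-1 * Th.
  by rewrite /Th mulrDr mulrCA mulVf ?mulr1 ?gt_eqF // lerDl mulr_ge0 // ltW.
nra.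
Qed.

(** * Differentiable curves *)

Section Curves.
Variable R : realType.

Lemma is_derive_coord (V : normedModType R) d (g : V -> 'rV[R]_d) (t u : V)
    (v : 'rV[R]_d) i :
  is_derive t u g v -> is_derive t u (fun s => g s 0 i) (v 0 i).
Proof.
move=> [dg Dg]; have dgi : derivable (fun s => g s 0 i) t u.
  by move/derivable_mxP : (dg) => /(_ 0 i).
by apply: DeriveDef => //; rewrite -Dg derive_mx // mxE.
Qed.

Lemma is_derive_rV (V : normedModType R) d (g : V -> 'rV[R]_d) (t u : V)
    (v : 'rV[R]_d) :
  (forall i, is_derive t u (fun s => g s 0 i) (v 0 i)) -> is_derive t u g v.
Proof.
move=> H; have dg : derivable g t u.
  by apply/derivable_mxP => i j; rewrite ord1; case: (H j).
apply: DeriveDef => //; rewrite derive_mx //; apply/matrixP => i j.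
by rewrite ord1 mxE; case: (H j).
Qed.

Lemma is_derive_dot (V : normedModType R) d (w : 'rV[R]_d) (g : V -> 'rV[R]_d)
    (t u : V) (v : 'rV[R]_d) :
  is_derive t u g v -> is_derive t u (fun s => dot w (g s)) (dot w v).
Proof.
move=> H; have Hi i := is_derive_coord i H.
have -> : (fun s => dot w (g s)) = \sum_(i < d) (w 0 i \*: (fun s => g s 0 i)).
  by apply/funext => s; rewrite fct_sumE.
by apply: is_derive_eq.
Qed.

Lemma dot_continuous d (w : 'rV[R]_d) : continuous (dot w).
Proof.
move=> x; apply: differentiable_continuous.
have -> : dot w = \sum_(i < d) (w 0 i \*: (fun s : 'rV[R]_d => s 0 i)).
  by apply/funext => s; rewrite fct_sumE.
by apply: differentiable_sum => i; apply: differentiableZ; exact: differentiable_coord.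
Qed.

Lemma is_derive_comp (U W : normedModType R) (x : R -> U) (F : U -> W)
    (t : R) (v : U) :
  is_derive t 1 x v -> differentiable F (x t) ->
  is_derive t 1 (fun s => F (x s)) ('D_v F (x t)).
Proof.
move=> [dx Dx] dF; have dx' : differentiable x t by apply/derivable1_diffP.
have dFx : differentiable (F \o x) t by exact: differentiable_comp.
apply: DeriveDef; first exact: diff_derivable.
by rewrite deriveE // diff_comp //= -(deriveE (1 : R) dx') Dx (deriveE v dF).
Qed.

Lemma within_comp (U W : normedModType R) (A : set R) (x : R -> U) (F : U -> W) :
  continuous F -> {within A, continuous x} -> {within A, continuous (fun s => F (x s))}.
Proof. by move=> cF cx; apply: within_continuous_comp => // y _; exact: cF. Qed.

Lemma mean_value_dot d (g v : R -> 'rV[R]_d) (w : 'rV[R]_d) (a b : R) : a <= b ->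
  (forall t, t \in `]a, b[ -> is_derive t 1 g (v t)) ->
  {within `[a, b], continuous g} ->
  exists2 c, c \in `[a, b] & dot w (g b - g a) = dot w (v c) * (b - a).
Proof.
move=> ab dg cg; rewrite dotBr.
apply: (MVT_segment (f := fun s => dot w (g s)) (df := fun s => dot w (v s)) ab).
  by move=> t tab; apply: is_derive_dot; exact: dg.
by apply: within_comp cg; exact: dot_continuous.
Qed.

(** The mean value theorem is applied in the direction of the error itself. *)
Lemma increment_bound d (g v : R -> 'rV[R]_d) (u : 'rV[R]_d) (a b e : R) : a <= b ->
  (forall t, t \in `]a, b[ -> is_derive t 1 g (v t)) ->
  {within `[a, b], continuous g} ->
  (forall t, t \in `[a, b] -> enorm (v t - u) <= e) ->
  enorm (g b - g a - (b - a) *: u) <= (b - a) * e.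
Proof.
move=> ab dg cg ve; set w := g b - g a - _.
have [c cab cE] := mean_value_dot w ab dg cg.
have ww : dot w w = dot w (v c - u) * (b - a).
  by rewrite {2}/w dotBr cE dotZr dotBr; ring.
have [w0|wn0] := eqVneq (enorm w) 0.
  rewrite w0 mulr_ge0 ?subr_ge0 //; apply: le_trans (ve c cab); exact: enorm_ge0.
have w_gt0 : 0 < enorm w by rewrite lt_neqAle eq_sym wn0 enorm_ge0.
rewrite -(ler_pM2l w_gt0) -expr2 -dotvv ww mulrCA mulrC ler_wpM2l ?subr_ge0 //.
apply: le_trans (dot_le _ _) _; rewrite ler_wpM2l ?enorm_ge0 //; exact: ve.
Qed.

(** Uniform continuity on a segment. *)
Lemma heine (V : normedModType R) (g : R -> V) (a b e : R) : 0 < e ->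
  {within `[a, b], continuous g} ->
  exists2 h, 0 < h & forall s t, s \in `[a, b] -> t \in `[a, b] ->
    `|s - t| <= h -> `|g s - g t| <= e.
Proof.
move=> e0 cg.
have e20 : 0 < e / 2 by rewrite divr_gt0.
have /near_covering_withinP nc : near_covering `[a, b].
  exact/compact_near_coveringP/segment_compact.
have H := nc R 0^'+ (fun h s => forall t, t \in `[a, b] -> `|s - t| <= h ->
  `|g s - g t| <= e) _ _.
have {}H : \forall h \near 0^'+, 0 < h /\ (`[a, b]%classic `<=` (fun s => forall t,
    t \in `[a, b] -> `|s - t| <= h -> `|g s - g t| <= e)).
  apply: filterI; first exact: nbhs_right_gt.
  apply: H => x xab; have /subspace_continuousP /(_ x xab) := cg.
  move=> /cvgrPdist_le /(_ _ e20); rewrite near_withinE.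
  move=> /nbhs_ballP[r /= r0 Hr].
  have r20 : 0 < r / 2 by rewrite divr_gt0.
  exists (ball x (r / 2), [set h | h < r / 2]) => /=.
    by split; [exact: nbhsx_ballx|exact: nbhs_right_lt].
  move=> [s h] /= [xs hr] sab t tab st.
  rewrite /ball /= in xs.
  have xt : `|x - t| < r.
    have := ler_distD s x t; lra.
  have h1 : `|g x - g s| <= e / 2.
    by apply: Hr => //; rewrite /ball /=; apply: lt_trans xs _; lra.
  have h2 : `|g x - g t| <= e / 2 by apply: Hr.
  have := ler_distD (g x) (g s) (g t); rewrite (distrC (g s) (g x)); lra.
have [h [h0 hP]] := filter_ex H.
exists h => // s t sab tab; exact: (hP s sab t tab).
Qed.
End Curves.

(** * Excursions of differentiable curves *)

Section NormTopology.
Variables (R : realType) (d : nat).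
Implicit Types u v : 'rV[R]_d.

Lemma coord_le_norm u i : `|u 0 i| <= `|u|.
Proof.
rewrite [leRHS]/Num.Def.normr /= mx_normrE; apply/bigmax_geP; right => /=.
by exists (0, i).
Qed.

Lemma enorm_le_norm u : enorm u <= d%:R * `|u|.
Proof. by apply: enorm_le_coord => // i; exact: coord_le_norm. Qed.

Lemma norm_le_enorm u : `|u| <= enorm u.
Proof.
rewrite [leLHS]/Num.Def.normr /= mx_normrE.
apply: bigmax_le => [|[i j] _]; first exact: enorm_ge0.
by rewrite ord1; exact: coord_le_enorm.
Qed.

Lemma dotvv_differentiable u : differentiable (fun x : 'rV[R]_d => dot x x) u.
Proof.
have -> : (fun x : 'rV[R]_d => dot x x) =
    \sum_(i < d) ((fun x : 'rV[R]_d => x 0 i) * (fun x : 'rV[R]_d => x 0 i)).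
  by apply/funext => x; rewrite fct_sumE.
apply: differentiable_sum => i; apply: differentiableM; exact: differentiable_coord.
Qed.

Lemma enorm_continuous : continuous (@enorm R 1 d).
Proof.
have -> : @enorm R 1 d = (@Num.sqrt R) \o (fun x => dot x x).
  by apply/funext => x; rewrite /= -enormE.
move=> x; apply: continuous_comp; last exact: sqrt_continuous.
by apply: differentiable_continuous; exact: dotvv_differentiable.
Qed.

Lemma dist_continuous v : continuous (fun u => enorm (u - v)).
Proof.
have -> : (fun u => enorm (u - v)) = @enorm R 1 d \o (fun u => u - v) by [].
move=> u; apply: continuous_comp; last exact: enorm_continuous.
by apply: (@continuousB _ _ _ id (cst v)) => //; exact: cst_continuous.
Qed.

End NormTopology.

(** A fine subdivision of the curve satisfies the hypotheses of
    [discrete_excursion] with half the transversality constant, since the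
    velocity is uniformly continuous and bounded away from [0] on a segment. *)
Lemma continuous_excursion (R : realType) (d : nat) (s : R) : 0 < s ->
  exists2 C : R, 1 <= C & forall (g v N : R -> 'rV[R]_d) (a b r : R),
    a <= b -> 0 < r -> enorm (g a) <= r ->
    (forall t, t \in `[a, b] -> is_derive t 1 g (v t)) ->
    {within `[a, b], continuous v} ->
    (forall t, t \in `[a, b] -> v t != 0) ->
    (forall t, t \in `[a, b] -> enorm (N t) <= 1) ->
    (forall t, t \in `[a, b] -> 0 <= dot (N t) (g t)) ->
    (forall t t', t \in `[a, b] -> t' \in `[a, b] -> t <= t' ->
       dot (N t) (g t' - g t) <= 0) ->
    (forall t, t \in `[a, b] -> s * enorm (v t) <= - dot (N t) (v t)) ->
    enorm (g b) <= C * r.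
Proof.
move=> s0; have s20 : 0 < s / 2 by rewrite divr_gt0.
have [C C1 HC] := discrete_excursion d s20.
exists C => // g v N a b r ab r0 gar dg cv vn0 N1 Ng fut trans.
have [ab0|altb] : b = a \/ a < b.
  by move: ab; rewrite le_eqVlt => /orP[/eqP ->|]; [left|right].
  rewrite ab0; apply: le_trans gar _; rewrite ler_peMl // ltW //.
have aab : a \in `[a, b] by rewrite in_itv /= lexx.
have s1 : s <= 1.
  have va : 0 < enorm (v a).
    rewrite lt_neqAle enorm_ge0 andbT eq_sym.
    by apply: contra (vn0 a aab) => /eqP /enorm_eq0 ->.
  rewrite -(ler_pM2r va) mul1r; apply: le_trans (trans a aab) _.
  rewrite -dotNr; apply: le_trans (dot_le _ _) _; rewrite enormN.
  by rewrite -[leRHS]mul1r ler_wpM2r ?enorm_ge0 // N1.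
have cnv : {within `[a, b], continuous (fun t => enorm (v t))}.
  by apply: within_comp cv; exact: enorm_continuous.
have [c1 c1ab Hc1] := EVT_min ab cnv; have [c2 c2ab Hc2] := EVT_max ab cnv.
set mn := enorm (v c1) in Hc1; set mx := enorm (v c2) in Hc2.
have mn0 : 0 < mn.
  rewrite lt_neqAle enorm_ge0 andbT eq_sym.
  by apply: contra (vn0 c1 c1ab) => /eqP /enorm_eq0 ->.
have mx0 : 0 < mx by apply: lt_le_trans mn0 (Hc2 _ c1ab).
pose e := s * mn / 4.
have e0 : 0 < e by rewrite divr_gt0 // mulr_gt0.
have dS0 : 0 < d%:R + 1 :> R by rewrite ltr_wpDl.
have [h h0 Hh] := heine (divr_gt0 e0 dS0) cv.
have Hh' x y : x \in `[a, b] -> y \in `[a, b] -> `|x - y| <= h ->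
    enorm (v x - v y) <= e.
  move=> xab yab xy; apply: le_trans (enorm_le_norm _) _.
  have := Hh _ _ xab yab xy; rewrite ler_pdivlMr // mulrDr mulr1 mulrC => H.
  by apply: le_trans H; rewrite lerDl.
(* The number of steps makes each shorter than [h] in time and than [r] in space. *)
pose X := (b - a) / h + (b - a) * (mx + e) / r.
have ba0 : 0 < b - a by rewrite subr_gt0.
have X1 : 0 < (b - a) / h by rewrite divr_gt0.
have X2 : 0 < (b - a) * (mx + e) / r.
  by rewrite divr_gt0 // mulr_gt0 // addr_gt0.
pose n := (Num.truncn X).+1.
have Xn : X < n%:R by rewrite /n; have /andP[] := truncn_itv (ltW (addr_gt0 X1 X2)).
have n0 : 0 < n%:R :> R by rewrite ltr0n.
pose k := (b - a) / n%:R.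
have k0 : 0 < k by rewrite divr_gt0.
have kh : k <= h.
  rewrite /k ler_pdivrMr // (mulrC h) -ler_pdivrMr //.
  by apply: le_trans (ltW Xn); rewrite lerDl ltW.
have kr : k * (mx + e) <= r.
  rewrite /k mulrAC ler_pdivrMr // (mulrC r) -ler_pdivrMr //; apply/ltW.
  by apply: le_lt_trans Xn; rewrite lerDr ltW.
pose t i : R := a + i%:R * k.
have tn : t n = b by rewrite /t /k mulrC divfK ?gt_eqF // addrC subrK.
have tS i : t i.+1 = t i + k by rewrite /t -natr1 mulrDl mul1r addrA.
have tm i j : (i <= j)%N -> t i <= t j.
  by move=> ij; rewrite lerD2l ler_wpM2r ?(ltW k0) // ler_nat.
have tab i : (i <= n)%N -> t i \in `[a, b].
  move=> iln; rewrite in_itv /=; have := tm _ _ iln; rewrite tn => ->.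
  by rewrite andbT /t lerDl mulr_ge0 // ltW.
have inc i : (i < n)%N ->
    enorm (g (t i) - g (t i.+1) + k *: v (t i.+1)) <= k * e.
  move=> iln; have i1 := tab _ iln; have i2 := tab _ (ltnW iln).
  have sub x : x \in `[t i, t i.+1] -> x \in `[a, b].
    rewrite !in_itv /=; move: i1 i2; rewrite !in_itv /=.
    by move=> /andP[? ?] /andP[? ?] /andP[? ?]; apply/andP; split; lra.
  have kE : t i.+1 - t i = k by rewrite tS; ring.
  rewrite -enormN opprD opprB -kE.
  have dgi x : x \in `]t i, t i.+1[ -> is_derive x 1 g (v x).
    by move=> xt; apply/dg/sub; exact: subset_itv_oo_cc xt.
  have cgi : {within `[t i, t i.+1], continuous g}.
    by apply: derivable_within_continuous => x /sub /dg [].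
  apply: (increment_bound (tm _ _ (leqnSn i)) dgi cgi) => x xt.
  apply: Hh'; [exact: sub|exact: i1|].
  move: xt; rewrite in_itv /= => /andP[x1 x2]; rewrite ler_norml.
  by apply/andP; split; clear - kE kh h0 x1 x2; lra.
rewrite -tn; apply: (HC n (fun i => g (t i)) (fun i => N (t i))) => //.
- by rewrite /t mul0r addr0.
- move=> i iln; have Hi := inc _ iln.
  set w := g (t i) - g (t i.+1) + k *: v (t i.+1) in Hi.
  have -> : g (t i.+1) - g (t i) = k *: v (t i.+1) - w.
    by rewrite /w opprD opprB [RHS]addrC subrK.
  apply: le_trans (enormD _ _) _; rewrite enormN enormZ gtr0_norm //.
  have h1 : k * enorm (v (t i.+1)) <= k * mx.
    by rewrite ler_wpM2l ?(ltW k0) // Hc2 // tab.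
  clear - Hi h1 kr; lra.
- by move=> i iln; apply: N1; exact: tab.
- by move=> i iln; apply: Ng; exact: tab.
- by move=> i j ij jn; apply: fut; rewrite ?tab ?tm // (leq_trans ij).
- move=> i iln; have Hi := inc _ iln; have i1 := tab _ iln.
  set w := g (t i) - g (t i.+1) + k *: v (t i.+1) in Hi.
  have wE : g (t i) - g (t i.+1) = w - k *: v (t i.+1) by rewrite /w addrK.
  rewrite enormB wE dotBr dotZr.
  have h1 : - (k * e) <= dot (N (t i.+1)) w.
    have := normr_dot_le (N (t i.+1)) w; rewrite ler_norml => /andP[H _].
    apply: le_trans H; rewrite lerN2; apply: le_trans Hi.
    by rewrite -[leRHS]mul1r ler_wpM2r ?enorm_ge0 // N1.
  have h2 : enorm (w - k *: v (t i.+1)) <= k * e + k * enorm (v (t i.+1)).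
    apply: le_trans (enormD _ _) _; rewrite enormN enormZ (gtr0_norm k0).
    by rewrite lerD2r.
  have h3 := trans _ i1; have h4 : mn <= enorm (v (t i.+1)) := Hc1 _ i1.
  have h5 : s * enorm (v (t i.+1)) * k <= - dot (N (t i.+1)) (v (t i.+1)) * k.
    by rewrite ler_wpM2r // ltW.
  have h6 : e <= s * enorm (v (t i.+1)) / 4.
    by rewrite /e ler_wpM2r // ler_wpM2l // ltW.
  have h7 : k * e <= k * (s * enorm (v (t i.+1)) / 4) by rewrite ler_wpM2l // ltW.
  have h8 : s / 2 * enorm (w - k *: v (t i.+1)) <=
      s / 2 * (k * e + k * enorm (v (t i.+1))) by rewrite ler_wpM2l // ltW.
  have h9 : s / 2 * (k * e) <= k * e / 2.
    by rewrite mulrAC ler_wpM2r // -[leRHS]mul1r ler_wpM2r // ltW // mulr_gt0.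
  have h10 : 0 < k * e by exact: mulr_gt0.
  clear - h1 h5 h7 h8 h9 h10; lra.
Qed.

(** * Perturbed descent of a strongly convex function *)

Section Scalar.
Variable R : realType.

Lemma increment_le (phi dphi : R -> R) (a b c : R) : a <= b ->
  (forall t, t \in `]a, b[ -> is_derive t 1 phi (dphi t)) ->
  {within `[a, b], continuous phi} ->
  (forall t, t \in `[a, b] -> dphi t <= c) -> phi b - phi a <= c * (b - a).
Proof.
move=> ab dp cp H; have [t tab ->] := MVT_segment ab dp cp.
by rewrite ler_wpM2r ?subr_ge0 // H.
Qed.

Lemma last_exit (phi : R -> R) (T r : R) : 0 <= T ->
  {within `[0, T], continuous phi} -> phi 0 < r -> r < phi T ->
  exists a, [/\ 0 < a, a <= T, phi a <= r & forall t, t \in `[a, T] -> r <= phi t].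
Proof.
move=> T0 cp p0 pT.
pose S := [set t | t \in `[0, T] /\ phi t <= r].
have S0 : S 0 by split; [rewrite in_itv /= lexx|exact: ltW].
have ubS : ubound S T by move=> t [] /=; rewrite in_itv /= => /andP[].
have hS : has_sup S by split; [exists 0|exists T].
set a := sup S.
have a0 : 0 <= a by apply: sup_upper_bound.
have aT : a <= T by apply: sup_le_ub => //; exists 0.
have aI : a \in `[0, T] by rewrite in_itv /= a0.
have past t : a < t -> t <= T -> r < phi t.
  move=> at_ tT; rewrite ltNge; apply/negP => pt.
  have : t <= a.
    by apply: sup_upper_bound => //; split=> //; rewrite in_itv /= tT (le_trans a0) // ltW.
  by rewrite leNgt at_.
have pa : phi a <= r.
  rewrite leNgt; apply/negP => ra.
  have /subspace_continuousP /(_ a aI) /cvgrPdist_lt := cp.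
  have e0 : 0 < phi a - r by rewrite subr_gt0.
  move=> /(_ _ e0); rewrite near_withinE => /nbhs_ballP[e /= e1 He].
  have [t [tI pt] ta] := sup_adherent e1 hS.
  have ta' : t <= a by apply: sup_upper_bound.
  have : `|phi a - phi t| < phi a - r.
    by apply: He => //=; rewrite /ball /= ger0_norm ?subr_ge0 //; move: ta; rewrite -/a; lra.
  by move=> /(le_lt_trans (ler_norm _)); lra.
have ra t : t \in `[a, T] -> r <= phi t.
  rewrite in_itv /= => /andP[]; rewrite le_eqVlt => /orP[/eqP <- _|at_ tT]; last first.
    by apply/ltW/past.
  rewrite leNgt; apply/negP => par.
  have cpa : {within `[a, T], continuous phi}.
    apply: continuous_subspaceW cp => x /=; rewrite !in_itv /= => /andP[h ->].
    by rewrite (le_trans a0).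
  have [|c cI cE] := IVT (v := (phi a + r) / 2) aT cpa.
    by rewrite ge_min le_max; apply/andP; split; apply/orP; [left|right]; lra.
  move: cI; rewrite in_itv /= => /andP[]; rewrite le_eqVlt => /orP[/eqP ac _|ac cT].
    by move: cE; rewrite -ac; lra.
  by have := past _ ac cT; rewrite cE; lra.
exists a; split=> //; rewrite lt_neqAle a0 andbT; apply/eqP => a0E.
by have := ra a; rewrite -a0E in_itv /= lexx T0 => /(_ isT); lra.
Qed.

Lemma within_continuousM (A : set R) (phi psi : R -> R) :
  {within A, continuous phi} -> {within A, continuous psi} ->
  {within A, continuous (fun s => phi s * psi s)}.
Proof. by move=> cp cs x; apply: continuousM; [exact: cp|exact: cs]. Qed.

End Scalar.

Section StronglyConvex.
Variables (R : realType) (d : nat) (F : 'rV[R]_d -> R) (g : 'rV[R]_d -> 'rV[R]_d).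
Variables (rho : R) (us : 'rV[R]_d).
Hypothesis rho0 : 0 < rho.
Hypothesis sc : forall u v : 'rV[R]_d, F u + dot (g u) (v - u) + rho / 2 * enorm (v - u) ^+ 2 <= F v.
Hypothesis Fmin : forall v, F us <= F v.

Lemma sublevel_halfspace u v : F v <= F u -> dot (g u) (v - u) <= 0.
Proof.
move=> vu; have := sc u v; have : 0 <= rho / 2 * enorm (v - u) ^+ 2.
  by rewrite mulr_ge0 ?sqr_ge0 // divr_ge0 // ltW.
lra.
Qed.

Lemma gap_le u : F u - F us + rho / 2 * enorm (u - us) ^+ 2 <= dot (g u) (u - us).
Proof.
have := sc u us; rewrite enormB -(opprB u us) dotNr; lra.
Qed.

Lemma gap_le_norm u : F u - F us <= enorm (g u) * enorm (u - us).
Proof.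
apply: le_trans (dot_le _ _); apply: le_trans (gap_le u).
by rewrite lerDl mulr_ge0 ?sqr_ge0 // divr_ge0 // ltW.
Qed.

Lemma dist_le_grad u : rho / 2 * enorm (u - us) <= enorm (g u).
Proof.
have [->|un0] := eqVneq (enorm (u - us)) 0; first by rewrite mulr0 enorm_ge0.
have u0 : 0 < enorm (u - us) by rewrite lt_neqAle eq_sym un0 enorm_ge0.
rewrite -(ler_pM2r u0); apply: le_trans (dot_le _ _).
apply: le_trans (gap_le u); rewrite expr2 mulrA lerDr subr_ge0; exact: Fmin.
Qed.

(** The Polyak-Lojasiewicz inequality. *)
Lemma gap_le_grad u : 2 * rho * (F u - F us) <= enorm (g u) ^+ 2.
Proof.
have := gap_le u; have := dot_le (g u) (u - us).
set x := enorm (g u); set z := enorm (u - us) => h1 h2.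
have : 0 <= (x - rho * z) ^+ 2 by exact: sqr_ge0.
have : rho * (F u - F us + rho / 2 * z ^+ 2) <= rho * (x * z).
  by rewrite ler_wpM2l ?(ltW rho0) //; lra.
rewrite sqrrB; lra.
Qed.

(** Strong convexity at the midpoint of [u] and [us] bounds the gap from below
    without computing the gradient at the minimizer. *)
Lemma gap_ge u : rho / 4 * enorm (u - us) ^+ 2 <= F u - F us.
Proof.
pose w := 2^-1 *: (u + us).
have e1 : u - w = 2^-1 *: (u - us).
  by apply/rowP => i; rewrite !mxE; field.
have e2 : us - w = - (2^-1 *: (u - us)).
  by apply/rowP => i; rewrite !mxE; field.
have := sc w u; have := sc w us; have := Fmin w.
rewrite e1 e2 enormN dotNr enormZ ger0_norm ?invr_ge0 // exprMn.
set Z := enorm _ ^+ 2; lra.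
Qed.

Hypothesis dF : forall u : 'rV[R]_d, differentiable F u.
Hypothesis DF : forall u v : 'rV[R]_d, 'D_v F u = dot (g u) v.

Lemma is_derive_gap (eta v : R -> 'rV[R]_d) (t : R) :
  is_derive t 1 eta (v t) ->
  is_derive t 1 (fun s => F (eta s) - F us) (dot (g (eta t)) (v t)).
Proof.
move=> H; have := is_derive_comp H (dF (eta t)); rewrite DF => H'.
have -> : (fun s => F (eta s) - F us) = (fun s => F (eta s)) - cst (F us) by [].
by apply: is_derive_eq; rewrite subr0.
Qed.

Lemma gap_continuous (A : set R) (eta : R -> 'rV[R]_d) :
  {within A, continuous eta} -> {within A, continuous (fun s => F (eta s) - F us)}.
Proof.
move=> ce; apply: (within_comp (F := fun u => F u - F us)) ce => u.
apply: differentiable_continuous.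
have -> : (fun u => F u - F us) = F - cst (F us) by [].
exact: differentiableB.
Qed.

End StronglyConvex.

(** * Exponential decay of perturbed descent curves *)

Section Decay.
Variables (R : realType) (d : nat) (F : 'rV[R]_d -> R) (g : 'rV[R]_d -> 'rV[R]_d).
Variables (rho : R) (us : 'rV[R]_d).
Hypothesis rho0 : 0 < rho.
Hypothesis sc : forall u v : 'rV[R]_d, F u + dot (g u) (v - u) + rho / 2 * enorm (v - u) ^+ 2 <= F v.
Hypothesis Fmin : forall v, F us <= F v.
Hypothesis dF : forall u : 'rV[R]_d, differentiable F u.
Hypothesis DF : forall u v : 'rV[R]_d, 'D_v F u = dot (g u) v.
Variables (q Lam L1 rhog : R).
Hypotheses (q0 : 0 < q) (Lam0 : 0 < Lam) (L10 : 0 < L1) (rhog0 : 0 < rhog).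

(** [eta] moves with velocity [v], which is transverse to the level sets of [F] up
    to an input of size at most [Y0 * expR (- rhog * t)]. *)
Record driven (Y0 : R) (eta v : R -> 'rV[R]_d) : Prop := Driven {
  driven_cont : {within `[0, +oo[, continuous eta};
  driven_derive : forall t : R, 0 < t -> is_derive t 1 eta (v t);
  driven_velocity : forall t : R, 0 < t -> {for t, continuous v};
  driven_descent : forall t : R, 0 < t -> dot (g (eta t)) (v t) <=
    - q * enorm (g (eta t)) ^+ 2 + L1 * enorm (g (eta t)) * (Y0 * expR (- rhog * t));
  driven_speed : forall t : R, 0 < t ->
    enorm (v t) <= Lam * enorm (g (eta t)) + L1 * (Y0 * expR (- rhog * t))
}.

Lemma within_sub (V : normedModType R) (f : R -> V) (a b : R) : 0 <= a ->
  {within `[0, +oo[, continuous f} -> {within `[a, b], continuous f}.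
Proof.
move=> a0; apply: continuous_subspaceW => x /=; rewrite !in_itv /= => /andP[ax _].
by rewrite andbT (le_trans a0).
Qed.

(** While [eta] is further than [r] from the minimizer, strong convexity makes the
    gradient dominate the input, so the curve crosses the level sets at a fixed
    angle. *)
Lemma driven_excursion : exists2 C : R, 1 <= C & forall Y0 eta v r,
  driven Y0 eta v -> 0 <= Y0 -> 4 * L1 * Y0 <= q * rho * r -> 0 < r ->
  enorm (eta 0 - us) < r -> forall t : R, 0 <= t -> enorm (eta t - us) <= C * r.
Proof.
have s0 : 0 < (q / 2) / (Lam + q / 2) by rewrite divr_gt0 ?addr_gt0 ?divr_gt0.
have [C C1 HC] := continuous_excursion d s0.
exists C => // Y0 eta v r H Y00 Yr r0 e0 T T0.
have [small|big] := leP (enorm (eta T - us)) r.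
  by apply: le_trans small _; rewrite ler_peMl // ltW.
have cn : {within `[0, T], continuous (fun t => enorm (eta t - us))}.
  apply: (within_comp (F := fun u => enorm (u - us))); last first.
    exact: within_sub (driven_cont H).
  exact: dist_continuous.
have [a [a0 aT ar Hr]] := last_exit T0 cn e0 big.
have pos t : t \in `[a, T] -> 0 < t.
  by rewrite in_itv /= => /andP[at_ _]; exact: lt_le_trans at_.
have Yt t : t \in `[a, T] -> L1 * (Y0 * expR (- rhog * t)) <= q / 2 * enorm (g (eta t)).
  move=> tI; have h1 := dist_le_grad sc Fmin (eta t).
  have h2 : Y0 * expR (- rhog * t) <= Y0.
    rewrite ler_piMr // -expR0 ler_expR mulNr oppr_le0 mulr_ge0 // ltW //; exact: pos.
  have h3 : L1 * (Y0 * expR (- rhog * t)) <= L1 * Y0 by rewrite ler_wpM2l // ltW.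
  have h4 : q * (rho / 2 * r) <= q * enorm (g (eta t)).
    rewrite ler_wpM2l ?(ltW q0) //; apply: le_trans h1.
    by rewrite ler_wpM2l ?divr_ge0 ?(ltW rho0) // Hr.
  lra.
have gpos t : t \in `[a, T] -> 0 < enorm (g (eta t)).
  move=> tI; apply: lt_le_trans (dist_le_grad sc Fmin (eta t)).
  by rewrite mulr_gt0 ?divr_gt0 //; apply: lt_le_trans r0 (Hr _ tI).
have desc t : t \in `[a, T] -> q / 2 * enorm (g (eta t)) ^+ 2 <= - dot (g (eta t)) (v t).
  move=> tI; have h1 := driven_descent H (pos _ tI); have h2 := Yt _ tI.
  have h3 := gpos _ tI; set x := enorm _ in h1 h2 h3 *.
  set y := Y0 * _ in h1 h2.
  have h4 : x * (L1 * y) <= x * (q / 2 * x) by rewrite ler_wpM2l // ltW.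
  lra.
have ct : {within `[a, T], continuous eta} by apply: within_sub (driven_cont H); exact: ltW.
have deta t : t \in `[a, T] -> is_derive t 1 (fun s => eta s - us) (v t).
  move=> tI; have := driven_derive H (pos _ tI) => H'.
  have -> : (fun s => eta s - us) = eta - cst us by [].
  by apply: is_derive_eq; rewrite subr0.
have mono t t' : t \in `[a, T] -> t' \in `[a, T] -> t <= t' -> F (eta t') <= F (eta t).
  move=> tI t'I tt'; have tpos := pos _ tI.
  have sub x : x \in `[t, t'] -> x \in `[a, T].
    move: tI t'I; rewrite !in_itv /= => /andP[x1 x2] /andP[x3 x4] /andP[x5 x6].
    by apply/andP; split; [exact: le_trans x5|exact: le_trans x4].
  pose phi s := F (eta s) - F us; pose dphi s := dot (g (eta s)) (v s).
  have h1 x : x \in `]t, t'[ -> is_derive x 1 phi (dphi x).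
    move=> xI; apply: (is_derive_gap us dF DF); apply: (driven_derive H).
    by apply: pos; apply: sub; exact: subset_itv_oo_cc xI.
  have h2 : {within `[t, t'], continuous phi}.
    by apply: (gap_continuous dF); apply: within_sub (driven_cont H); exact: ltW.
  have h3 x : x \in `[t, t'] -> dphi x <= 0.
    move=> /sub /desc; rewrite lerNr => h; apply: le_trans h _.
    by rewrite oppr_le0 mulr_ge0 ?sqr_ge0 // divr_ge0 // ltW.
  have := increment_le tt' h1 h2 h3; rewrite mul0r /phi; lra.
have := HC (fun s => eta s - us) v (fun t => (enorm (g (eta t)))^-1 *: g (eta t))
  a T r aT r0 ar deta; apply.
- apply: continuous_in_subspaceT => t; rewrite inE => tI.
  by apply: (driven_velocity H); exact: pos.
- move=> t tI; apply/eqP => v0; have := desc _ tI; rewrite v0 dot0r oppr0.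
  by rewrite leNgt mulr_gt0 ?divr_gt0 // exprn_gt0 // gpos.
- move=> t tI; rewrite enormZ ger0_norm ?invr_ge0 ?enorm_ge0 // mulVf //.
  by rewrite gt_eqF // gpos.
- move=> t tI; rewrite dotZl mulr_ge0 ?invr_ge0 ?enorm_ge0 //.
  apply: le_trans (gap_le us sc (eta t)); rewrite addr_ge0 ?subr_ge0 //.
  by rewrite mulr_ge0 ?sqr_ge0 // divr_ge0 // ltW.
- move=> t t' tI t'I tt'; rewrite opprB addrA subrK dotZl.
  rewrite pmulr_rle0 ?invr_gt0 ?gpos //; apply: (sublevel_halfspace rho0 sc).
  exact: mono.
- move=> t tI; have gp := gpos _ tI; rewrite dotZl -mulrN.
  have h1 := driven_speed H (pos _ tI); have h2 := Yt _ tI; have h3 := desc _ tI.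
  have h4 : enorm (v t) <= (Lam + q / 2) * enorm (g (eta t)).
    by lra.
  have P : 0 < Lam + q / 2 by rewrite addr_gt0 // divr_gt0.
  have h5 : enorm (v t) / (Lam + q / 2) <= enorm (g (eta t)).
    by rewrite ler_pdivrMr // mulrC.
  rewrite ler_pdivlMl //; apply: le_trans h3.
  have h6 : q / 2 * enorm (g (eta t)) * (enorm (v t) / (Lam + q / 2)) <=
      q / 2 * enorm (g (eta t)) * enorm (g (eta t)).
    by rewrite ler_wpM2l // mulr_ge0 ?enorm_ge0 // divr_ge0 // ltW.
  by lra.
Qed.

Lemma is_derive_expRM (c t : R) :
  is_derive t 1 (fun s : R => expR (c * s)) (c * expR (c * t)).
Proof.
have h : is_derive t 1 (fun s : R => c * s) c.
  have -> : (fun s : R => c * s) = c \*: id by [].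
  by apply: is_derive_eq; rewrite -[c *: 1]/(c * 1) mulr1.
have h' : is_derive t 1 (expR \o (fun s : R => c * s)) (expR (c * t) * c).
  exact: is_derive1_comp.
by move: h'; rewrite mulrC.
Qed.

Lemma expRM_continuous (A : set R) (c : R) :
  {within A, continuous (fun s : R => expR (c * s))}.
Proof.
apply: continuous_subspaceT => t; apply: differentiable_continuous.
by apply/derivable1_diffP; case: (is_derive_expRM c t).
Qed.

(** The input can raise the gap by its total effect only. *)
Lemma gap_bound (eta v : R -> 'rV[R]_d) (K gam : R) : 0 < gam ->
  {within `[0, +oo[, continuous eta} ->
  (forall t : R, 0 < t -> is_derive t 1 eta (v t)) ->
  (forall t : R, 0 < t -> dot (g (eta t)) (v t) <= K * expR (- gam * t)) ->
  0 <= K -> forall t : R, 0 <= t ->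
  F (eta t) - F us <= F (eta 0) - F us + K / gam.
Proof.
move=> gam0 ce de dv K0 T T0.
pose phi t := F (eta t) - F us + (K / gam) *: expR (- gam * t).
pose dphi t := dot (g (eta t)) (v t) + (K / gam) *: (- gam * expR (- gam * t)).
have h1 x : x \in `]0, T[ -> is_derive x 1 phi (if 0 < x then dphi x else 0).
  rewrite in_itv /= => /andP[x0 _]; rewrite x0.
  have H1 := is_derive_gap us dF DF (de _ x0); have H2 := is_derive_expRM (- gam) x.
  exact: is_deriveD.
have h2 : {within `[0, T], continuous phi}.
  apply: within_continuousD.
    by apply: (gap_continuous dF); exact: within_sub.
  apply: (within_comp (F := fun x : R => (K / gam) *: x)).
    exact: scaler_continuous.
  exact: expRM_continuous.
have h3 x : x \in `[0, T] -> (if 0 < x then dphi x else 0) <= 0.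
  move=> _; case: ifP => // x0; have := dv _ x0; rewrite /dphi.
  have -> : (K / gam) *: (- gam * expR (- gam * x)) = - (K * expR (- gam * x)).
    by rewrite -[LHS]/(_ * _) mulrA mulrN divfK ?gt_eqF // mulNr.
  lra.
have := increment_le T0 h1 h2 h3; rewrite mul0r /phi mulr0 expR0.
have : 0 <= K / gam * expR (- gam * T) by rewrite mulr_ge0 ?expR_ge0 // divr_ge0 // ltW.
rewrite -![_ *: _]/(_ * _); lra.
Qed.

(** Before time [1] the gap may be arbitrarily large compared with [r ^+ 2], as
    the gradient of [F] need not be Lipschitz; but a convex function satisfies
    [F u - F us <= enorm (g u) * enorm (u - us)], so a large gap over a bounded
    region forces a large gradient and is consumed in unit time. *)
Lemma gap_at1 : exists2 K : R, 0 <= K & forall Y0 eta v r,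
  driven Y0 eta v -> 0 <= Y0 -> 4 * L1 * Y0 <= q * rho * r -> 0 < r ->
  enorm (eta 0 - us) < r -> F (eta 1) - F us <= K * r ^+ 2.
Proof.
have [C C1 HC] := driven_excursion.
have K0 : 0 <= 2 * C ^+ 2 / q + q * rho ^+ 2 / 32.
  apply: addr_ge0; apply: divr_ge0 => //; last by apply: mulr_ge0; [exact: ltW|exact: sqr_ge0].
  - by apply: mulr_ge0 => //; exact: sqr_ge0.
  - exact: ltW.
exists (2 * C ^+ 2 / q + q * rho ^+ 2 / 32) => //.
move=> Y0 eta v r H Y00 Yr r0 e0.
have far := HC _ _ _ _ H Y00 Yr r0 e0.
pose V s := F (eta s) - F us.
(* The weight [s ^+ 2] vanishes at [0], where [V] is not controlled, and its
   derivative pairs with [V <= X * (C * r)] to be absorbed by [- X ^+ 2]. *)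
pose phi s := s ^+ 2 * V s.
pose dphi s := s ^+ 2 *: dot (g (eta s)) (v s) + V s *: ((s + s) *: 1).
have h1 (x : R) : x \in `]0, 1[ -> is_derive x 1 phi (dphi x).
  rewrite in_itv /= => /andP[x0 _].
  have H1 := is_derive_gap us dF DF (driven_derive H x0).
  have H2 : is_derive x 1 (fun s : R => s ^+ 2) ((x + x) *: 1).
    have -> : (fun s : R => s ^+ 2) = id * id by apply/funext => s; rewrite expr2.
    by apply: is_derive_eq; rewrite scalerDl.
  exact: is_deriveM.
have h2 : {within `[0, 1], continuous phi}.
  have c1 : {within `[0, 1], continuous V}.
    by apply: (gap_continuous dF); exact: within_sub (driven_cont H).
  have c2 : {within `[0, 1], continuous (fun s : R => s ^+ 2)}.
    by apply: continuous_subspaceT => s; exact: exprn_continuous.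
  exact: within_continuousM.
have h3 (x : R) : x \in `[0, 1] -> dphi x <= (2 * C ^+ 2 / q + q * rho ^+ 2 / 32) * r ^+ 2.
  rewrite in_itv /= => /andP[]; rewrite le_eqVlt => /orP[/eqP <- _|x0 x1].
    rewrite /dphi expr0n /= !scale0r addr0 scale0r scaler0 addr0.
    by rewrite mulr_ge0 ?sqr_ge0.
  have := driven_descent H x0; set X := enorm (g (eta x)); set y := Y0 * _ => d1.
  have X0 : 0 <= X by exact: enorm_ge0.
  have V1 : V x <= X * (C * r).
    apply: le_trans (gap_le_norm us rho0 sc (eta x)) _.
    by rewrite ler_wpM2l // far // ltW.
  have y1 : L1 * y <= q * rho * r / 4.
    have : y <= Y0.
      by rewrite /y ler_piMr // -expR0 ler_expR mulNr oppr_le0 mulr_ge0 // ltW.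
    move=> /(ler_wpM2l (ltW L10)) => h; move: Yr h; lra.
  have y0 : 0 <= L1 * y by rewrite mulr_ge0 ?mulr_ge0 ?expR_ge0 // ltW.
  pose z := L1 * y / q; pose kap := C * r / q.
  have z0 : 0 <= z by rewrite divr_ge0 // ltW.
  have zE : L1 * y = q * z by rewrite /z [RHS]mulrC divfK // gt_eqF.
  have kE : C * r = q * kap by rewrite /kap [RHS]mulrC divfK // gt_eqF.
  have z1 : z <= rho * r / 4.
    by rewrite /z ler_pdivrMr //; apply: le_trans y1 _; rewrite le_eqVlt; apply/orP; left; apply/eqP; ring.
  have x20 : 0 <= x ^+ 2 by exact: sqr_ge0.
  have A1 : x ^+ 2 * dot (g (eta x)) (v x) <= x ^+ 2 * (q / 2 * (z ^+ 2 - X ^+ 2)).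
    rewrite ler_wpM2l //; apply: le_trans d1 _.
    have : 0 <= q * (X - z) ^+ 2 by rewrite mulr_ge0 ?sqr_ge0 // ltW.
    by rewrite mulrAC zE; lra.
  have A2 : V x * (x + x) <= X * (C * r) * (x + x) by rewrite ler_wpM2r //; lra.
  have A3 : x ^+ 2 * (q / 2 * z ^+ 2) <= 1 * (q / 2 * (rho * r / 4) ^+ 2).
    have x21 : x ^+ 2 <= 1 by rewrite expr_le1 // ltW.
    have q20 : 0 <= q / 2 by rewrite divr_ge0 // ltW.
    apply: ler_pM => //; first by rewrite mulr_ge0 // sqr_ge0.
    by rewrite ler_wpM2l // lerXn2r // nnegrE (le_trans z0).
  have A4 : 0 <= q / 2 * (x * X - 2 * kap) ^+ 2.
    by rewrite mulr_ge0 ?sqr_ge0 // divr_ge0 // ltW.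
  have A5 : 2 * C ^+ 2 / q * r ^+ 2 = 2 * q * kap ^+ 2.
    by rewrite /kap; field; rewrite gt_eqF.
  rewrite /dphi -/(V x) -![_ *: _]/(_ * _) mulr1 [in leRHS]mulrDl A5.
  move: A2; rewrite kE; lra.
have := increment_le ler01 h1 h2 h3.
by rewrite /phi expr0n mul0r expr1n mul1r !subr0 mulr1.
Qed.

(** Up to time [1] the bound on excursions is enough. Later, a part [eps] of the
    rate [q * rho] that exceeds [rho1] absorbs the input, so that the gap,
    weighted by [expR (2 * rho1 * t)] and corrected by the remaining effect of
    the input, does not increase. *)
Theorem driven_decay (rho1 : R) : 0 <= rho1 -> rho1 < q * rho -> rho1 < rhog ->
  exists2 C : R, 1 <= C & forall Y0 eta v r,
  driven Y0 eta v -> 0 <= Y0 -> 4 * L1 * Y0 <= q * rho * r -> 0 < r ->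
  enorm (eta 0 - us) < r ->
  forall t : R, 0 <= t -> enorm (eta t - us) <= C * expR (- rho1 * t) * r.
Proof.
move=> rho10 rho1q rho1g.
have [C C1 HC] := driven_excursion; have [K1 K10 HK1] := gap_at1.
pose eps := q - rho1 / rho; pose mu := rhog - rho1.
have mu0 : 0 < mu by rewrite subr_gt0.
have eps0 : 0 < eps by rewrite subr_gt0 ltr_pdivrMr.
have rho1E : rho * (q - eps) = rho1 by rewrite /eps; field; rewrite gt_eqF.
pose K3 := expR (2 * rho1) * K1 + (q * rho / 4) ^+ 2 / (8 * eps * mu).
have K30 : 0 <= K3.
  apply: addr_ge0; first by apply: mulr_ge0 => //; exact: expR_ge0.
  by apply: divr_ge0; [exact: sqr_ge0|apply/ltW/mulr_gt0 => //; exact: mulr_gt0].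
have K3rho : 0 <= 4 * K3 / rho by rewrite divr_ge0 // ?mulr_ge0 // ltW.
have e1 : 1 <= expR rho1 by rewrite -expR0 ler_expR.
have C0 : 0 <= C by exact: le_trans C1.
exists (C * expR rho1 + Num.sqrt (4 * K3 / rho)).
  have : 1 * 1 <= C * expR rho1 by apply: ler_pM.
  have := sqrtr_ge0 (4 * K3 / rho); lra.
move=> Y0 eta v r H Y00 Yr r0 e0 t t0.
have [t1|t1] := leP t 1.
  apply: le_trans (HC _ _ _ _ H Y00 Yr r0 e0 t t0) _.
  rewrite ler_wpM2r ?(ltW r0) //.
  apply: (@le_trans _ _ (C * expR rho1 * expR (- rho1 * t))); last first.
    by rewrite ler_wpM2r ?expR_ge0 // lerDl sqrtr_ge0.
  rewrite -mulrA -expRD -[leLHS]mulr1 ler_wpM2l // -expR0 ler_expR.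
  by rewrite mulNr -{1}[rho1]mulr1 -mulrBr mulr_ge0 // subr_ge0.
have g1 := HK1 _ _ _ _ H Y00 Yr r0 e0.
pose V s := F (eta s) - F us.
pose K2 := (L1 * Y0) ^+ 2 / (8 * eps * mu).
pose phi s := expR (2 * rho1 * s) * V s + K2 *: expR (- (2 * mu) * s).
pose dphi s := expR (2 * rho1 * s) *: dot (g (eta s)) (v s) +
  V s *: (2 * rho1 * expR (2 * rho1 * s)) + K2 *: (- (2 * mu) * expR (- (2 * mu) * s)).
have pos (x : R) : x \in `[1, t] -> 0 < x.
  by rewrite in_itv /= => /andP[x1 _]; exact: lt_le_trans x1.
have h1 (x : R) : x \in `]1, t[ -> is_derive x 1 phi (dphi x).
  move=> xI; have x0 : 0 < x by apply/pos; exact: subset_itv_oo_cc xI.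
  have H1 := is_derive_gap us dF DF (driven_derive H x0).
  have H2 := is_derive_expRM (2 * rho1) x.
  have H3 := is_derive_expRM (- (2 * mu)) x.
  have HM := is_deriveM H2 H1; have HZ := is_deriveZ K2 H3.
  exact: is_deriveD.
have h2 : {within `[1, t], continuous phi}.
  apply: within_continuousD.
    apply: within_continuousM; first exact: expRM_continuous.
    by apply: (gap_continuous dF); exact: within_sub (driven_cont H).
  apply: (within_comp (F := fun x : R => K2 *: x)); first exact: scaler_continuous.
  exact: expRM_continuous.
have h3 (x : R) : x \in `[1, t] -> dphi x <= 0.
  move=> xI; have x0 := pos _ xI.
  have := driven_descent H x0; set X := enorm (g (eta x)).
  set y := expR (- rhog * x) => d1.
  have V1 : 2 * rho * V x <= X ^+ 2 by exact: gap_le_grad us rho0 sc (eta x).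
  pose z := L1 * Y0 * y / (2 * eps).
  have zE : L1 * (Y0 * y) = 2 * eps * z.
    by rewrite /z [RHS]mulrC divfK ?mulrA // gt_eqF // mulr_gt0.
  have d2 : dot (g (eta x)) (v x) <= - (2 * rho1) * V x + eps * z ^+ 2.
    apply: le_trans d1 _; rewrite mulrAC zE.
    have P1 : 0 <= eps * (X - z) ^+ 2 by rewrite mulr_ge0 ?sqr_ge0 // ltW.
    have P2 : (q - eps) * (2 * rho * V x) <= (q - eps) * X ^+ 2.
      by rewrite ler_wpM2l // /eps opprB addrCA subrr addr0 divr_ge0 // ltW.
    have P3 : (q - eps) * (2 * rho * V x) = 2 * rho1 * V x by rewrite -rho1E; ring.
    move: P2; rewrite P3; lra.
  have E1 : expR (2 * rho1 * x) * y ^+ 2 = expR (- (2 * mu) * x).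
    rewrite /y expr2 -!expRD; congr expR; rewrite /mu; ring.
  have E2 : expR (2 * rho1 * x) * (eps * z ^+ 2) = 2 * mu * K2 * expR (- (2 * mu) * x).
    rewrite -E1 /z /K2; field; rewrite !gt_eqF //.
  rewrite /dphi -![_ *: _]/(_ * _).
  have := ler_wpM2l (expR_ge0 (2 * rho1 * x)) d2; rewrite mulrDr E2; lra.
have := increment_le (ltW t1) h1 h2 h3; rewrite mul0r /phi -![_ *: _]/(_ * _) !mulr1.
set e2 := expR (- (2 * mu)); set e3 := expR (- (2 * mu) * t) => mono.
have K20 : 0 <= K2.
  by apply: divr_ge0; [exact: sqr_ge0|apply/ltW/mulr_gt0 => //; exact: mulr_gt0].
have K2r : K2 <= (q * rho / 4) ^+ 2 / (8 * eps * mu) * r ^+ 2.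
  rewrite mulrAC -exprMn ler_wpM2r ?invr_ge0 ?mulr_ge0 ?(ltW eps0) ?(ltW mu0) //.
  rewrite lerXn2r // ?nnegrE.
  - by rewrite mulr_ge0 // ltW.
  - by rewrite !mulr_ge0 ?(ltW q0) ?(ltW rho0) ?(ltW r0).
  - lra.
have e21 : e2 <= 1 by rewrite -expR0 ler_expR oppr_le0 mulr_ge0 // ltW.
have b2 : K2 * e2 <= K2 by rewrite ler_piMr.
have b3 : 0 <= K2 * e3 by rewrite mulr_ge0 ?expR_ge0.
have b1 := ler_wpM2l (expR_ge0 (2 * rho1)) g1.
have b4 : expR (2 * rho1 * t) * V t <= K3 * r ^+ 2.
  by rewrite /K3; move: mono b1; rewrite /V; lra.
have b5 := gap_ge sc Fmin (eta t).
have b6 : (expR (rho1 * t) * enorm (eta t - us)) ^+ 2 <= (Num.sqrt (4 * K3 / rho) * r) ^+ 2.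
  rewrite !exprMn (sqr_sqrtr K3rho).
  have -> : expR (rho1 * t) ^+ 2 = expR (2 * rho1 * t).
    by rewrite expr2 -expRD; congr expR; ring.
  have -> : 4 * K3 / rho * r ^+ 2 = 4 * K3 * r ^+ 2 / rho by ring.
  rewrite ler_pdivlMr //.
  have := ler_wpM2l (expR_ge0 (2 * rho1 * t)) b5; rewrite -/(V t); lra.
have b7 : expR (rho1 * t) * enorm (eta t - us) <= Num.sqrt (4 * K3 / rho) * r.
  move: b6; rewrite ler_pXn2r // ?nnegrE.
  - by rewrite mulr_ge0 ?expR_ge0 ?enorm_ge0.
  - by rewrite mulr_ge0 ?sqrtr_ge0 // ltW.
rewrite mulNr expRN mulrAC ler_pdivlMr ?expR_gt0 // mulrC; apply: le_trans b7 _.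
rewrite ler_wpM2r ?(ltW r0) // lerDr mulr_ge0 // expR_ge0.
Qed.

End Decay.

(** * Global solutions of bounded Lipschitz equations *)

Section Picard.
Variable R : realType.

(** Continuation by a constant to the negative half-line. *)
Lemma cont_max0 (V : normedModType R) (phi : R -> V) :
  {within `[0, +oo[, continuous phi} -> continuous (fun t : R => phi (Num.max 0 t)).
Proof.
move=> /subspace_continuousP cp x.
have mI (t : R) : `[0, +oo[%classic (Num.max 0 t).
  by rewrite /= in_itv /= andbT le_max lexx.
apply/cvgrPdist_le => e e0; have := cp _ (mI x).
move=> /cvgrPdist_le /(_ _ e0); rewrite near_withinE => /nbhs_ballP[r /= r0 Hr].
apply/nbhs_ballP; exists r => //= t; rewrite /ball /= => xt.
apply: Hr; [apply: le_lt_trans xt|exact: mI].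
by rewrite ler_norml; apply/andP; split; rewrite /Num.max;
  case: ltP => h1; case: ltP => h2; have := ler_norm (x - t);
  have := ler_norm (t - x); rewrite (distrC t x); lra.
Qed.

(** Integration starts at [-1] so that [0] is an interior point, where the
    derivative is two-sided. *)
Lemma primitive (phi : R -> R) : {within `[0, +oo[, continuous phi} ->
  exists Phi : R -> R, Phi 0 = 0 /\ forall t : R, 0 <= t -> is_derive t 1 Phi (phi t).
Proof.
move=> cp; pose psi t := phi (Num.max 0 t).
have cpsi : continuous psi by exact: cont_max0.
pose P x := (\int[lebesgue_measure]_(t in `[-1, x]) psi t)%R.
exists (fun x => P x - P 0); split; first by rewrite subrr.
move=> t t0; have tt : t < t + 1 by rewrite ltrDl.
have t1 : -1 < t by apply: lt_le_trans t0; rewrite ltrN10.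
have int : lebesgue_measure.-integrable `[-1, (t + 1)] (EFin \o psi).
  apply: continuous_compact_integrable; first exact: segment_compact.
  exact: continuous_subspaceT.
have [dP DP] := continuous_FTC1_closed tt int t1 (cpsi t).
have dP' : is_derive t 1 P (phi t).
  apply: DeriveDef => //; rewrite -derive1E DP /psi; congr phi.
  by apply/max_idPr.
have -> : (fun x => P x - P 0) = P - cst (P 0) by [].
by apply: is_derive_eq; rewrite subr0.
Qed.

Lemma primitive_rV d (phi : R -> 'rV[R]_d) : {within `[0, +oo[, continuous phi} ->
  exists Phi : R -> 'rV[R]_d,
    Phi 0 = 0 /\ forall t : R, 0 <= t -> is_derive t 1 Phi (phi t).
Proof.
move=> cp.
have H i : exists Phi : R -> R,
    Phi 0 = 0 /\ forall t : R, 0 <= t -> is_derive t 1 Phi (phi t 0 i).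
  apply: primitive; apply: (within_comp (F := fun u : 'rV[R]_d => u 0 i)) cp.
  exact: coord_continuous.
have [P HP] := choice H.
exists (fun t => \row_i P i t); split.
  by apply/rowP => i; rewrite !mxE; case: (HP i).
move=> t t0; apply: is_derive_rV => i.
have -> : (fun s => (\row_i P i s) 0 i) = P i by apply/funext => s; rewrite mxE.
exact: (HP i).2.
Qed.

Lemma derive_within_cont (V : normedModType R) (phi dphi : R -> V) :
  (forall t : R, 0 <= t -> is_derive t 1 phi (dphi t)) ->
  {within `[0, +oo[, continuous phi}.
Proof.
move=> H; apply: derivable_within_continuous => x.
by rewrite in_itv /= andbT => /H [].
Qed.

(** Integration gains a factor [gam] in the norm weighted by [expR (- gam * t)]. *)
Lemma exp_bound (phi dphi : R -> R) (c gam t : R) : 0 < gam ->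
  phi 0 = 0 -> (forall t : R, 0 <= t -> is_derive t 1 phi (dphi t)) ->
  (forall t : R, 0 <= t -> `|dphi t| <= c * (gam * expR (gam * t))) ->
  0 <= c -> 0 <= t -> `|phi t| <= c * expR (gam * t).
Proof.
move=> gam0 p0 dp Hp c0 t0.
suff main (psi dpsi : R -> R) : psi 0 = 0 ->
    (forall t : R, 0 <= t -> is_derive t 1 psi (dpsi t)) ->
    (forall t : R, 0 <= t -> dpsi t <= c * (gam * expR (gam * t))) ->
    psi t <= c * expR (gam * t).
  rewrite ler_norml lerNl; apply/andP; split.
    apply: (main (- phi) (- dphi)) => [|s s0|s s0].
    - by rewrite -[(- phi) 0]/(- phi 0) p0 oppr0.
    - exact: is_deriveN (dp _ s0).
    - by apply: le_trans (Hp _ s0); rewrite -[(- dphi) s]/(- dphi s) -normrN ler_norm.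
  by apply: (main phi dphi) => // s s0; apply: le_trans (Hp _ s0); exact: ler_norm.
move=> q0 dq Hq.
pose w s := psi s - (c *: expR (gam * s)).
pose dw s := dpsi s - (c *: (gam * expR (gam * s))).
have dww (s : R) : 0 <= s -> is_derive s 1 w (dw s).
  move=> s0; have H1 := dq _ s0; have H2 := is_derive_expRM gam s.
  have H3 := is_deriveZ c H2; exact: is_deriveB.
have h1 (s : R) : s \in `]0, t[ -> is_derive s 1 w (dw s).
  by rewrite in_itv /= => /andP[/ltW s0 _]; exact: dww.
have h2 : {within `[0, t], continuous w}.
  by apply: within_sub (lexx 0) _; exact: derive_within_cont dww.
have h3 (s : R) : s \in `[0, t] -> dw s <= 0.
  by rewrite in_itv /= => /andP[s0 _]; rewrite subr_le0; exact: Hq.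
have := increment_le t0 h1 h2 h3; rewrite mul0r /w q0 mulr0 expR0.
by rewrite -![_ *: _]/(_ * _) mulr1; lra.
Qed.

Lemma half_pow_small (c e : R) : 0 <= c -> 0 < e -> exists k : nat, c * 2^-1 ^+ k <= e.
Proof.
move=> c0 e0; pose k := (Num.truncn (c / e)).+1; exists k.
have kc : c / e < k%:R by have /andP[] := truncn_itv (divr_ge0 c0 (ltW e0)).
have kk : k%:R <= 2 ^+ k :> R by rewrite -natrX ler_nat; apply/ltnW/ltn_expl.
have k20 : 0 < 2 ^+ k :> R by rewrite exprn_gt0.
have := le_lt_trans (lexx _) (lt_le_trans kc kk).
by rewrite ltr_pdivrMr // mulrC -ltr_pdivrMr // exprVn => /ltW.
Qed.

Lemma half_pow_eq0 (x c : R) : 0 <= c -> (forall k : nat, `|x| <= c * 2^-1 ^+ k) -> x = 0.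
Proof.
move=> c0 H; apply/eqP; rewrite -normr_le0 leNgt; apply/negP => x0.
have x20 : 0 < `|x| / 2 by rewrite divr_gt0.
have [k Hk] := half_pow_small c0 x20.
by have := H k; lra.
Qed.

Lemma geometric_limit (a : nat -> R) (c : R) : 0 <= c ->
  (forall k, `|a k.+1 - a k| <= c * 2^-1 ^+ k) ->
  exists l, forall k, `|l - a k| <= 2 * c * 2^-1 ^+ k.
Proof.
move=> c0 H; pose b k := 2 * c * 2^-1 ^+ k.
have b0 k : 0 <= b k by rewrite !mulr_ge0 // exprn_ge0 // invr_ge0.
have bS k : b k.+1 = b k - c * 2^-1 ^+ k.
  by rewrite /b exprS; field.
have st k : a k - b k <= a k.+1 - b k.+1 /\ a k.+1 + b k.+1 <= a k + b k.
  by have := H k; rewrite bS ler_norml => /andP[? ?]; split; lra.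
have lo m k : a k - b k <= a (m + k)%N - b (m + k)%N.
  by elim: m => // m IH; apply: le_trans IH _; case: (st (m + k)%N).
have hi m k : a (m + k)%N + b (m + k)%N <= a k + b k.
  by elim: m => // m IH; apply: le_trans IH; case: (st (m + k)%N).
have lh j k : a j - b j <= a k + b k.
  have h1 := lo k j; have h2 := hi j k; rewrite addnC in h2; have := b0 (k + j)%N.
  by lra.
pose S := [set a j - b j | j in setT].
have hS : has_sup S by split; [exists (a 0%N - b 0%N), 0%N|exists (a 0%N + b 0%N) => _ [j _ <-]].
exists (sup S) => k; rewrite ler_norml; apply/andP; split.
  have : a k - b k <= sup S by apply: sup_upper_bound => //; exists k.
  by rewrite -/(b k); lra.
have : sup S <= a k + b k.
  by apply: sup_le_ub; [case: hS|move=> _ [j _ <-]].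
by rewrite -/(b k); lra.
Qed.

Lemma norm_le_coord d (u : 'rV[R]_d) (r : R) : 0 <= r ->
  (forall i, `|u 0 i| <= r) -> `|u| <= r.
Proof.
move=> r0 ur; rewrite [leLHS]/Num.Def.normr /= mx_normrE.
by apply: bigmax_le => // -[i j] _; rewrite ord1.
Qed.

Section Iteration.
Variables (d : nat) (f : R -> 'rV[R]_d -> 'rV[R]_d) (K Mf : R) (u0 : 'rV[R]_d).
Hypotheses (K0 : 0 < K) (Mf0 : 0 <= Mf).
Hypothesis flip : forall (t : R) u v, 0 <= t -> `|f t u - f t v| <= K * `|u - v|.
Hypothesis fbnd : forall (t : R) u, 0 <= t -> `|f t u| <= Mf.
Hypothesis fcont : forall x : R -> 'rV[R]_d, {within `[0, +oo[, continuous x} ->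
  {within `[0, +oo[, continuous (fun t => f t (x t))}.

Let solves (x a : R -> 'rV[R]_d) : Prop :=
  x 0 = u0 /\ forall t : R, 0 <= t -> is_derive t 1 x (f t (a t)).

Let solves_exists (a : R -> 'rV[R]_d) : {within `[0, +oo[, continuous a} -> exists x, solves x a.
Proof.
move=> /fcont /primitive_rV[P [P0 dP]]; exists (fun t => u0 + P t).
split=> [|t t0]; first by rewrite P0 addr0.
have -> : (fun s => u0 + P s) = cst u0 + P by [].
have H := dP _ t0; by apply: is_derive_eq; rewrite add0r.
Qed.

(** In the norm weighted by [expR (- 2 * K * t)] the iteration contracts by [1/2]
    on the whole half-line at once. *)
Let contraction (x y a b : R -> 'rV[R]_d) (c : R) : 0 <= c -> solves x a -> solves y b ->
  (forall t : R, 0 <= t -> `|a t - b t| <= c * expR (2 * K * t)) ->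
  forall t : R, 0 <= t -> `|x t - y t| <= c / 2 * expR (2 * K * t).
Proof.
move=> c0 [x0 dx] [y0 dy] ab t t0.
have c20 : 0 <= c / 2 by rewrite divr_ge0.
apply: norm_le_coord => [|i]; first by rewrite mulr_ge0 ?expR_ge0.
rewrite !mxE.
apply: (exp_bound (phi := fun t => x t 0 i - y t 0 i)
  (dphi := fun t => f t (a t) 0 i - f t (b t) 0 i)) => //.
- by rewrite mulr_gt0.
- by rewrite x0 y0 subrr.
- move=> s s0; have H1 := is_derive_coord i (dx _ s0).
  have H2 := is_derive_coord i (dy _ s0); exact: is_deriveB.
- move=> s s0; have := coord_le_norm (f s (a s) - f s (b s)) i; rewrite !mxE => h.
  apply: le_trans h _; apply: le_trans (flip _ _ s0) _.
  have := ler_wpM2l (ltW K0) (ab s s0); lra.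
Qed.

Let next (a : R -> 'rV[R]_d) : R -> 'rV[R]_d := xget (cst u0) [set x | solves x a].
Let x_ k := iter k next (cst u0).

Let nextP (a : R -> 'rV[R]_d) : {within `[0, +oo[, continuous a} -> solves (next a) a.
Proof. by move=> /solves_exists ex; exact: (xgetPex (cst u0) ex). Qed.

Let x_cont k : {within `[0, +oo[, continuous (x_ k)}.
Proof.
elim: k => [|k IH]; first by apply: continuous_subspaceT => t; exact: cst_continuous.
exact: derive_within_cont (nextP IH).2.
Qed.

Let x_spec k : solves (x_ k.+1) (x_ k).
Proof. exact: (@nextP (x_ k) (@x_cont k)). Qed.

Let M := Mf / (2 * K).

Let M0 : 0 <= M.
Proof. by rewrite divr_ge0 // mulr_ge0 // ltW. Qed.

Let x_step k (t : R) : 0 <= t ->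
  `|x_ k.+1 t - x_ k t| <= M * 2^-1 ^+ k * expR (2 * K * t).
Proof.
elim: k t => [|k IH] t t0; last first.
  have -> : M * 2^-1 ^+ k.+1 = M * 2^-1 ^+ k / 2 by rewrite exprSr mulrA.
  have c0 : 0 <= M * 2^-1 ^+ k by rewrite mulr_ge0 // exprn_ge0 // invr_ge0.
  exact: (@contraction (x_ k.+2) (x_ k.+1) (x_ k.+1) (x_ k) _ c0 (@x_spec k.+1) (@x_spec k) IH t t0).
have [x0 dx] := @x_spec 0%N; rewrite expr0 mulr1.
apply: norm_le_coord => [|i]; first by rewrite mulr_ge0 ?expR_ge0.
rewrite !mxE /=.
apply: (exp_bound (phi := fun t => x_ 1 t 0 i - u0 0 i)
  (dphi := fun t => f t u0 0 i - 0)) => //.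
- by rewrite mulr_gt0.
- by rewrite [x_ 1 0]x0 subrr.
- move=> s s0; have H1 := is_derive_coord i (dx _ s0).
  have H2 : is_derive s 1 (cst (u0 0 i)) 0 by exact: is_derive_cst.
  exact: is_deriveB.
- move=> s s0; rewrite subr0; apply: le_trans (coord_le_norm _ i) _.
  apply: le_trans (fbnd _ s0) _; rewrite mulrA /M divfK ?gt_eqF ?mulr_gt0 //.
  by rewrite ler_peMr // -expR0 ler_expR !mulr_ge0 // ltW.
Qed.

(** The iterates converge geometrically at each time, locally uniformly, so the
    limit is continuous; it is identified with its own image [z] by
    [contraction]. *)
Theorem picard : exists x : R -> 'rV[R]_d,
  x 0 = u0 /\ forall t : R, 0 <= t -> is_derive t 1 x (f t (x t)).
Proof.
have lim (t : R) : exists l : 'rV[R]_d, 0 <= t -> forall k,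
    `|l - x_ k t| <= 2 * M * expR (2 * K * t) * 2^-1 ^+ k.
  have [t0|t0] := leP 0 t; last by exists 0.
  have Me0 : 0 <= M * expR (2 * K * t) by rewrite mulr_ge0 ?expR_ge0.
  have li i : exists l, forall k, `|l - x_ k t 0 i| <= 2 * (M * expR (2 * K * t)) * 2^-1 ^+ k.
    apply: geometric_limit => // k; have := coord_le_norm (x_ k.+1 t - x_ k t) i.
    rewrite !mxE => h; apply: le_trans h _; apply: le_trans (x_step _ t0) _.
    by rewrite mulrAC.
  have [l Hl] := choice li; exists (\row_i l i) => _ k.
  apply: norm_le_coord => [|i].
    apply: mulr_ge0; last by rewrite exprn_ge0 // invr_ge0.
    by apply: mulr_ge0; [exact: mulr_ge0|exact: expR_ge0].
  by rewrite !mxE -(mulrA 2); exact: Hl.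
have [x Hx] := choice lim.
have e2 t : 0 <= expR (2 * K * t) by exact: expR_ge0.
have x_c : {within `[0, +oo[, continuous x}.
  apply/subspace_continuousP => t /=; rewrite in_itv /= andbT => t0.
  apply/cvgrPdist_le => e e0.
  have c0 : 0 <= 2 * M * expR (2 * K * (t + 1)).
    by apply: mulr_ge0; [exact: mulr_ge0|exact: expR_ge0].
  have e30 : 0 < e / 3 by rewrite divr_gt0.
  have [k Hk] := half_pow_small c0 e30.
  have near s : 0 <= s -> s <= t + 1 -> `|x s - x_ k s| <= e / 3.
    move=> s0 st; apply: le_trans (Hx s s0 k) _; apply: le_trans Hk.
    apply: ler_wpM2r; first by rewrite exprn_ge0 // invr_ge0.
    apply: ler_wpM2l; first exact: mulr_ge0.
    by rewrite ler_expR ler_wpM2l // mulr_ge0 // ltW.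
  have /subspace_continuousP /(_ t) := @x_cont k; rewrite /= in_itv /= andbT => /(_ t0).
  move=> /cvgrPdist_le /(_ _ e30); rewrite !near_withinE.
  move=> /nbhs_ballP[r /= r0 Hr]; apply/nbhs_ballP.
  exists (Num.min r 1) => /=; first by rewrite lt_min r0 ltr01.
  move=> s; rewrite /ball /= lt_min => /andP[sr s1]; rewrite in_itv /= andbT => s0.
  have h1 : `|x_ k t - x_ k s| <= e / 3 by apply: Hr => //=; rewrite in_itv /= andbT.
  have h2 : `|x t - x_ k t| <= e / 3 by apply: near => //; rewrite lerDl.
  have h3 : `|x s - x_ k s| <= e / 3.
    apply: near => //; move: s1; rewrite ltr_norml => /andP[? ?]; lra.
  have -> : x t - x s = (x t - x_ k t) + (x_ k t - x_ k s) - (x s - x_ k s).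
    by rewrite opprB 2!addrA !subrK.
  have := ler_normB ((x t - x_ k t) + (x_ k t - x_ k s)) (x s - x_ k s).
  have := ler_normD (x t - x_ k t) (x_ k t - x_ k s); lra.
have [z zs] := solves_exists x_c; exists z; split; first by case: zs.
suff xz (t : R) : 0 <= t -> x t = z t by move=> t t0; rewrite -xz //; exact: zs.2.
move=> t0; apply/eqP; rewrite -subr_eq0 -normr_eq0; apply/eqP.
apply: (half_pow_eq0 (c := 2 * M * expR (2 * K * t))) => [|k].
  by apply: mulr_ge0; [exact: mulr_ge0|exact: expR_ge0].
rewrite normr_id.
have h1 := Hx t t0 k.+1.
have h2 : `|z t - x_ k.+1 t| <= 2 * M * 2^-1 ^+ k / 2 * expR (2 * K * t).
  have c0 : 0 <= 2 * M * 2^-1 ^+ k by apply: mulr_ge0; [exact: mulr_ge0|rewrite exprn_ge0 // invr_ge0].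
  apply: (@contraction z (x_ k.+1) x (x_ k) _ c0 zs (@x_spec k) _ t t0) => s s0.
  by rewrite mulrAC; exact: Hx.
have := ler_normB (x t - x_ k.+1 t) (z t - x_ k.+1 t).
rewrite opprB addrA subrK => h3; apply: le_trans h3 _.
apply: le_trans (lerD h1 h2) _; rewrite exprS le_eqVlt; apply/orP; left; apply/eqP.
by field.
Qed.

End Iteration.

End Picard.

(** * Truncated equations *)

Definition cutoff (R : realType) d (us : 'rV[R]_d) (B : R) (u : 'rV[R]_d) : R :=
  Num.max 0 (Num.min 1 (B + 1 - enorm (u - us))).

Section Cutoff.
Variables (R : realType) (d : nat) (us : 'rV[R]_d) (B : R).
Let chi := cutoff us B.

Lemma cutoff_itv u : 0 <= chi u <= 1.
Proof. by rewrite le_max lexx ge_max ler01 ge_min lexx. Qed.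

Lemma cutoff1 u : enorm (u - us) <= B -> chi u = 1.
Proof.
move=> uB; rewrite /chi /cutoff; have -> : Num.min 1 (B + 1 - enorm (u - us)) = 1.
  by apply/min_idPl; lra.
by apply/max_idPr.
Qed.

Lemma cutoff0 u : B + 1 < enorm (u - us) -> chi u = 0.
Proof.
move=> uB; apply/max_idPl; rewrite ge_min; apply/orP; right; lra.
Qed.

Lemma cutoff_lipschitz u v : `|chi u - chi v| <= enorm (u - v).
Proof.
have h1 := enorm_le_sub (u - us) (v - us); have h2 := enorm_le_sub (v - us) (u - us).
move: h1 h2; rewrite !opprB !addrA !subrK (enormB v u) /chi /cutoff.
set x := enorm (u - us); set y := enorm (v - us); set z := enorm (u - v) => h1 h2.
have z0 : 0 <= z by exact: enorm_ge0.
rewrite ler_norml /Num.max /Num.min.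
by case: (ltP 1 (B + 1 - x)) => a1; case: (ltP 1 (B + 1 - y)) => a2;
  case: ltP => a3; case: ltP => a4; apply/andP; split; lra.
Qed.

Lemma cutoff_continuous : continuous chi.
Proof.
move=> u; apply/(@cvgrPdist_le R R 'rV[R]_d (nbhs u) (nbhs_filter u)) => e e0.
have d1 : 0 < d%:R + 1 :> R by rewrite ltr_wpDl.
apply/nbhs_ballP; exists (e / (d%:R + 1)) => /=; first by rewrite divr_gt0.
move=> v; rewrite -ball_normE /= ltr_pdivlMr // => uv.
apply: le_trans (cutoff_lipschitz u v) _; apply: le_trans (enorm_le_norm _) _.
by apply: le_trans (ltW uv); rewrite mulrDr mulr1 mulrC lerDl.
Qed.

(** The cutoff makes a locally Lipschitz field globally bounded and Lipschitz. *)
Lemma truncated_solution (W : R -> 'rV[R]_d -> 'rV[R]_d) (Kw : R) u0 : 0 <= Kw ->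
  (forall (t : R) u v, 0 <= t -> enorm (u - us) <= B + 1 -> enorm (v - us) <= B + 1 ->
     enorm (W t u) <= Kw /\ enorm (W t u - W t v) <= Kw * enorm (u - v)) ->
  (forall x : R -> 'rV[R]_d, {within `[0, +oo[, continuous x} ->
     {within `[0, +oo[, continuous (fun t => W t (x t))}) ->
  exists x : R -> 'rV[R]_d, x 0 = u0 /\
    forall t : R, 0 <= t -> is_derive t 1 x (- (chi (x t) *: W t (x t))).
Proof.
move=> Kw0 HW cW.
have one (t : R) u v : 0 <= t -> enorm (u - us) <= B + 1 ->
    enorm (- (chi u *: W t u) - - (chi v *: W t v)) <= 2 * Kw * enorm (u - v).
  move=> t0 uB; have uv0 := enorm_ge0 (u - v).
  have /andP[cu0 cu1] := cutoff_itv u; have /andP[cv0 cv1] := cutoff_itv v.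
  have cuv := cutoff_lipschitz u v.
  have -> : - (chi u *: W t u) - - (chi v *: W t v) =
      - ((chi u - chi v) *: W t u + chi v *: (W t u - W t v)).
    by rewrite scalerBl scalerBr addrA subrK opprD.
  rewrite enormN.
  have [vB|vB] := leP (enorm (v - us)) (B + 1); last first.
    rewrite (cutoff0 vB) scale0r addr0 subr0 enormZ.
    rewrite (cutoff0 vB) subr0 in cuv; have [h1 _] := HW t u u t0 uB uB.
    have := ler_pM (normr_ge0 _) (enorm_ge0 _) cuv h1.
    have : 0 <= Kw * enorm (u - v) by exact: mulr_ge0.
    by move=> h2 h3; apply: le_trans h3 _; rewrite (mulrC (enorm (u - v))); lra.
  have [h1 h2] := HW t u v t0 uB vB.
  apply: le_trans (enormD _ _) _; rewrite !enormZ (ger0_norm cv0).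
  have := ler_pM (normr_ge0 _) (enorm_ge0 _) cuv h1.
  have := ler_pM cv0 (enorm_ge0 _) cv1 h2; rewrite mul1r (mulrC (enorm (u - v))); lra.
have far (t : R) u : B + 1 < enorm (u - us) -> - (chi u *: W t u) = 0.
  by move=> uB; rewrite (cutoff0 uB) scale0r oppr0.
have d0 : 0 <= d%:R :> R by [].
have K0 : 0 < 2 * Kw * d%:R + 1 by rewrite ltr_wpDl // !mulr_ge0.
apply: (picard (f := fun t u => - (chi u *: W t u)) u0 K0 Kw0).
- move=> t u v t0; apply: le_trans (norm_le_enorm _) _.
  have H : enorm (- (chi u *: W t u) - - (chi v *: W t v)) <= 2 * Kw * enorm (u - v).
    have [uB|uB] := leP (enorm (u - us)) (B + 1); first exact: one.
    have [vB|vB] := leP (enorm (v - us)) (B + 1).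
      have H := one t v u t0 vB; rewrite (enormB v u) in H.
      by apply: le_trans H; rewrite enormB.
    by rewrite !far // subrr enorm0 !mulr_ge0 ?enorm_ge0.
  apply: le_trans H _; apply: (@le_trans _ _ (2 * Kw * (d%:R * `|u - v|))).
    by apply: ler_wpM2l; [rewrite mulr_ge0|exact: enorm_le_norm].
  by rewrite mulrA; apply: ler_wpM2r; rewrite ?lerDl.
- move=> t u t0; apply: le_trans (norm_le_enorm _) _.
  have [uB|uB] := leP (enorm (u - us)) (B + 1); last by rewrite far // enorm0.
  have [h1 _] := HW t u u t0 uB uB; have /andP[cu0 cu1] := cutoff_itv u.
  by rewrite enormN enormZ ger0_norm // -[leRHS]mul1r ler_pM ?enorm_ge0.
- move=> x cx t; apply: cvgN; apply: cvgZ.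
    by apply: (within_comp (F := chi)) cx t; exact: cutoff_continuous.
  exact: (cW x cx).
Qed.

End Cutoff.

(** * Calculus of smooth maps *)

Section SmoothCalculus.
Variable R : realType.

Lemma smooth_differentiable (V W : normedModType R) (f : V -> W) x :
  smooth f -> differentiable f x.
Proof. by move=> sf; case: (sf 1%N) => df _; exact: df. Qed.

Lemma smooth_continuous (V W : normedModType R) (f : V -> W) :
  smooth f -> continuous f.
Proof. by move=> sf x; apply: differentiable_continuous; exact: smooth_differentiable. Qed.

Lemma smooth_derive (V W : normedModType R) (f : V -> W) v :
  smooth f -> smooth ('D_v f).
Proof. by move=> sf k; case: (sf k.+1) => _; apply. Qed.

Lemma smooth_coord (V : normedModType R) k (g : V -> 'rV[R]_k) i :
  smooth g -> smooth (fun x => g x 0 i).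
Proof.
move=> sg j; elim: j g sg => [|j IH] g sg.
  have cg := smooth_continuous sg; move=> x.
  apply: (@continuous_comp _ _ _ g (fun u : 'rV[R]_k => u 0 i)); first exact: cg.
  exact: coord_continuous.
have dg x := smooth_differentiable x sg; split=> [x|v].
  apply: (@differentiable_comp _ _ _ _ g (fun u : 'rV[R]_k => u 0 i)) => //.
  exact: differentiable_coord.
have -> : 'D_v (fun x => g x 0 i) = (fun x => ('D_v g) x 0 i).
  apply/funext => x.
  have H : is_derive x v g ('D_v g x) by apply: derivableP; exact: diff_derivable.
  by case: (is_derive_coord i H).
by apply: IH; exact: smooth_derive.
Qed.

Lemma derive_nabla n k (g : 'rV[R]_n -> 'rV[R]_k) x v :
  smooth g -> 'D_v g x = v *m nabla g x.
Proof. by move=> sg; rewrite deriveEjacobian //; exact: smooth_differentiable. Qed.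

Lemma nablaE n k (g : 'rV[R]_n -> 'rV[R]_k) x i j :
  smooth g -> nabla g x i j = ('D_(delta_mx 0 i) g x) 0 j.
Proof. by move=> sg; rewrite derive_nabla // -rowE [RHS]mxE. Qed.

Lemma derive_grad n (f : 'rV[R]_n -> R) x v :
  differentiable f x -> 'D_v f x = dot (grad f x)^T v.
Proof.
move=> df; rewrite deriveE // {1}(row_sum_delta v) linear_sum /=.
apply: eq_bigr => i _; rewrite linearZ /= !mxE deriveE //.
exact: mulrC.
Qed.

Lemma derive_lipschitz n k (g : 'rV[R]_n -> 'rV[R]_k) (L : R) x v :
  differentiable g x -> (forall u w, enorm (g u - g w) <= L * enorm (u - w)) ->
  enorm ('D_v g x) <= L * enorm v.
Proof.
move=> dg Lg; have dv : derivable g x v by exact: diff_derivable.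
apply: (@closed_cvg _ _ (0^') _ (fun h : R => h^-1 *: ((g \o shift x) (h *: v) - g x))
  (fun u => enorm u <= L * enorm v)) dv; last first.
- near=> h; have h0 : h != 0 by near: h; exact: nbhs_dnbhs_neq.
  rewrite /= enormZ; apply: (@le_trans _ _ (`|h^-1| * (L * (`|h| * enorm v)))).
    rewrite ler_wpM2l //; apply: le_trans (Lg _ _) _.
    by rewrite addrK enormZ.
  by rewrite normfV mulrCA (mulrA (`|h|^-1)) mulVf ?mul1r // normr_eq0.
- apply: (@closed_comp _ _ (@enorm R 1 k) [set r | r <= L * enorm v]); last exact: closed_le.
  by move=> u _; exact: enorm_continuous.
Unshelve. all: by end_near. Qed.

Lemma is_derive_pair (U W : normedModType R) (x : R -> U) (y : R -> W) (t : R)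
    (v : U) (w : W) :
  is_derive t 1 x v -> is_derive t 1 y w -> is_derive t 1 (fun s => (x s, y s)) (v, w).
Proof.
move=> [dx <-] [dy <-].
have dx' : differentiable x t by apply/derivable1_diffP.
have dy' : differentiable y t by apply/derivable1_diffP.
have dxy : differentiable (fun s => (x s, y s)) t by exact: differentiable_pair.
apply: DeriveDef; first exact: diff_derivable.
by rewrite !deriveE // diff_pair.
Qed.

Lemma within_pair (U W : normedModType R) (A : set R) (x : R -> U) (y : R -> W) :
  {within A, continuous x} -> {within A, continuous y} ->
  {within A, continuous (fun s => (x s, y s))}.
Proof. by move=> cx cy s; apply: cvg_pair; [exact: cx|exact: cy]. Qed.

Lemma derive_comp (U V W : normedModType R) (f : U -> V) (g : V -> W) x v :
  differentiable f x -> differentiable g (f x) ->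
  'D_v (fun u => g (f u)) x = 'D_('D_v f x) g (f x).
Proof.
move=> df dg; have dc : differentiable (g \o f) x by exact: differentiable_comp.
rewrite deriveE // (deriveE v df) (deriveE _ dg).
by rewrite -[LHS]/('d (g \o f) x v) diff_comp.
Qed.

(** A diffeomorphism inverts its own derivative. *)
Lemma derive_cancel (U W : normedModType R) (Phi : U -> W) (Psi : W -> U) x v :
  smooth Phi -> smooth Psi -> cancel Phi Psi -> 'D_('D_v Phi x) Psi (Phi x) = v.
Proof.
move=> sPhi sPsi PK; rewrite -derive_comp; try exact: smooth_differentiable.
by rewrite (_ : (fun u => Psi (Phi u)) = id) ?derive_id //; apply/funext => u; exact: PK.
Qed.

Lemma derive_pairE (U V W : normedModType R) (f : U -> V) (g : U -> W) x v :
  differentiable f x -> differentiable g x ->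
  'D_v (fun u => (f u, g u)) x = ('D_v f x, 'D_v g x).
Proof.
move=> df dg; rewrite !deriveE //; last exact: differentiable_pair.
by rewrite diff_pair.
Qed.

End SmoothCalculus.

(** * Lipschitz bounds on bounded sets *)

Definition bounded_lipschitz (R : realType) n (phi : 'rV[R]_n -> R) : Prop :=
  forall B : R, exists2 K : R, 0 <= K & forall u v, enorm u <= B -> enorm v <= B ->
    `|phi u| <= K /\ `|phi u - phi v| <= K * enorm (u - v).

Section BoundedLipschitz.
Variables (R : realType) (n : nat).

Lemma bounded_on_ball (phi : 'rV[R]_n -> R) (B : R) : continuous phi ->
  exists2 K : R, 0 <= K & forall u, enorm u <= B -> `|phi u| <= K.
Proof.
move=> cp; have [B0|B0] := ltP B 0.
  exists 0 => // u uB; have := le_trans (enorm_ge0 u) uB.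
  by rewrite leNgt B0.
pose A := [set u : 'rV[R]_n | enorm u <= B].
have cA : compact A.
  apply: bounded_closed_compact.
    exists B; split; first exact: num_real.
    by move=> M BM u /= uB; apply: le_trans (norm_le_enorm u) _; apply: le_trans uB (ltW BM).
  apply: (@closed_comp _ _ (@enorm R 1 n) [set r | r <= B]); last exact: closed_le.
  by move=> u _; exact: enorm_continuous.
have A0 : A !=set0 by exists 0; rewrite /A /= enorm0.
have cn : {within A, continuous (fun u => `|phi u|)}.
  apply: continuous_subspaceT => u; apply: (continuous_comp (cp u)); exact: norm_continuous.
have [c cA' Hc] := compact_EVT_max A0 cA cn.
by exists `|phi c| => // u uB; apply: Hc; rewrite inE.
Qed.

(** The segment between two points of a ball stays in it. *)
Lemma mean_value_ball (phi : 'rV[R]_n -> R) (B K : R) u v :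
  (forall w, differentiable phi w) ->
  (forall w i, enorm w <= B -> `|'D_(delta_mx 0 i) phi w| <= K) -> 0 <= K ->
  enorm u <= B -> enorm v <= B ->
  `|phi u - phi v| <= n%:R * K * enorm (u - v).
Proof.
move=> dphi HK K0 uB vB.
pose l (s : R) : 'rV[R]_n := v + s *: (u - v).
have dl (s : R) : is_derive s 1 l (u - v).
  apply: is_derive_rV => i.
  have -> : (fun s => l s 0 i) = (cst (v 0 i) + (u 0 i - v 0 i) \*: id).
    by apply/funext => x; rewrite /l !mxE /= mulrC.
  by apply: is_derive_eq; rewrite add0r -[LHS]/(_ * 1) mulr1 !mxE.
have dp (s : R) : is_derive s 1 (fun s => phi (l s)) (dot (grad phi (l s))^T (u - v)).
  by have := is_derive_comp (dl s) (dphi (l s)); rewrite derive_grad.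
have cp : {within `[0, 1], continuous (fun s => phi (l s))}.
  by apply: derivable_within_continuous => s _; case: (dp s).
have [c cI cE] := MVT_segment ler01 (fun s _ => dp s) cp.
have -> : phi u - phi v = dot (grad phi (l c))^T (u - v).
  by move: cE; rewrite /l scale1r scale0r addr0 subr0 mulr1 (addrC v) subrK.
apply: le_trans (normr_dot_le _ _) _; rewrite ler_wpM2r ?enorm_ge0 //.
apply: enorm_le_coord => // i; rewrite !mxE; apply: HK.
move: cI; rewrite in_itv /= => /andP[c0 c1].
have -> : l c = (1 - c) *: v + c *: u.
  by rewrite /l scalerBr scalerBl scale1r addrA addrAC.
apply: le_trans (enormD _ _) _; rewrite !enormZ !ger0_norm ?subr_ge0 //.
have h1 : (1 - c) * enorm v <= (1 - c) * B by rewrite ler_wpM2l // subr_ge0.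
have h2 : c * enorm u <= c * B by rewrite ler_wpM2l.
lra.
Qed.

Lemma smooth_bounded_lipschitz (phi : 'rV[R]_n -> R) :
  smooth phi -> bounded_lipschitz phi.
Proof.
move=> sp B.
have [K0 K00 HK0] := bounded_on_ball B (smooth_continuous sp).
have H i : exists K : R, 0 <= K /\
    forall w, enorm w <= B -> `|'D_(delta_mx 0 i) phi w| <= K.
  have [K K1 HK] := bounded_on_ball B (smooth_continuous (smooth_derive (delta_mx 0 i) sp)).
  by exists K.
have [K HK] := choice H.
have sK0 : 0 <= \sum_i K i by apply: sumr_ge0 => i _; case: (HK i).
exists (K0 + n%:R * \sum_i K i); first by rewrite addr_ge0 // mulr_ge0.
move=> u v uB vB; split.
  by apply: le_trans (HK0 _ uB) _; rewrite lerDl mulr_ge0.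
have dp w : differentiable phi w by exact: smooth_differentiable.
apply: le_trans (mean_value_ball dp _ sK0 uB vB) _.
  move=> w i wB; apply: le_trans ((HK i).2 w wB) _.
  by rewrite (bigD1 i) //= lerDl; apply: sumr_ge0 => j _; case: (HK j).
by rewrite ler_wpM2r ?enorm_ge0 // lerDr.
Qed.

Lemma bounded_lipschitzM (phi psi : 'rV[R]_n -> R) :
  bounded_lipschitz phi -> bounded_lipschitz psi ->
  bounded_lipschitz (fun u => phi u * psi u).
Proof.
move=> Hp Hq B; have [K K0 HK] := Hp B; have [L L0 HL] := Hq B.
exists (K * L + K * L); first by rewrite addr_ge0 // mulr_ge0.
move=> u v uB vB; have [a1 a2] := HK _ _ uB vB; have [b1 b2] := HL _ _ uB vB.
have [c1 _] := HK _ _ vB uB.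
split.
  by rewrite normrM; apply: le_trans (ler_pM _ _ a1 b1) _ => //; rewrite lerDl mulr_ge0.
have -> : phi u * psi u - phi v * psi v =
    (phi u - phi v) * psi u + phi v * (psi u - psi v) by ring.
apply: le_trans (ler_normD _ _) _; rewrite !normrM mulrDl; apply: lerD.
  by rewrite mulrAC; apply: ler_pM.
by rewrite -mulrA; apply: ler_pM.
Qed.

Lemma bounded_lipschitz_sum (I : finType) (phi : I -> 'rV[R]_n -> R) :
  (forall i, bounded_lipschitz (phi i)) -> bounded_lipschitz (fun u => \sum_i phi i u).
Proof.
move=> H B; have H' i : exists K : R, 0 <= K /\ forall u v, enorm u <= B -> enorm v <= B ->
    `|phi i u| <= K /\ `|phi i u - phi i v| <= K * enorm (u - v).
  by have [K K0 HK] := H i B; exists K.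
have [K HK] := choice H'.
exists (\sum_i K i); first by apply: sumr_ge0 => i _; case: (HK i).
move=> u v uB vB; split.
  apply: le_trans (ler_norm_sum _ _ _) _; apply: ler_sum => i _.
  by case: ((HK i).2 u v uB vB).
rewrite -sumrB; apply: le_trans (ler_norm_sum _ _ _) _; rewrite mulr_suml.
by apply: ler_sum => i _; case: ((HK i).2 u v uB vB).
Qed.

Lemma bounded_lipschitz_rV d (w : 'rV[R]_n -> 'rV[R]_d) (B : R) :
  (forall i, bounded_lipschitz (fun u => w u 0 i)) ->
  exists2 K : R, 0 <= K & forall u v, enorm u <= B -> enorm v <= B ->
    enorm (w u) <= K /\ enorm (w u - w v) <= K * enorm (u - v).
Proof.
move=> H; have H' i : exists K : R, 0 <= K /\ forall u v, enorm u <= B -> enorm v <= B ->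
    `|w u 0 i| <= K /\ `|w u 0 i - w v 0 i| <= K * enorm (u - v).
  by have [K K0 HK] := H i B; exists K.
have [K HK] := choice H'.
have K0 i : 0 <= K i by case: (HK i).
have sK0 : 0 <= \sum_i K i by exact: sumr_ge0.
have le i : K i <= \sum_i K i by rewrite (bigD1 i) //= lerDl; exact: sumr_ge0.
exists (d%:R * \sum_i K i); first by rewrite mulr_ge0.
move=> u v uB vB; split.
  apply: enorm_le_coord => // i; apply: le_trans (le i).
  by case: ((HK i).2 u v uB vB).
rewrite -mulrA; apply: enorm_le_coord; first by rewrite mulr_ge0 ?enorm_ge0.
move=> i; rewrite !mxE; apply: le_trans ((HK i).2 u v uB vB).2 _.
by rewrite ler_wpM2r ?enorm_ge0.
Qed.

End BoundedLipschitz.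

(** * The feedback-linearization dynamics in the coordinates [(h x, q x)] *)

Lemma enorm2_ge1 (R : realType) p r (w : 'rV[R]_p * 'rV[R]_r) : enorm w.1 <= enorm2 w.
Proof.
rewrite -[leLHS]ger0_norm ?enorm_ge0 // -sqrtr_sqr; apply: ler_wsqrtr.
by rewrite lerDl sqr_ge0.
Qed.

Lemma enorm2_ge2 (R : realType) p r (w : 'rV[R]_p * 'rV[R]_r) : enorm w.2 <= enorm2 w.
Proof.
rewrite -[leLHS]ger0_norm ?enorm_ge0 // -sqrtr_sqr; apply: ler_wsqrtr.
by rewrite lerDr sqr_ge0.
Qed.

Lemma enorm2_le (R : realType) p r (w : 'rV[R]_p * 'rV[R]_r) :
  enorm2 w <= enorm w.1 + enorm w.2.
Proof.
have s0 : 0 <= enorm w.1 + enorm w.2 by rewrite addr_ge0 ?enorm_ge0.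
rewrite -[leRHS]ger0_norm // -sqrtr_sqr; apply: ler_wsqrtr.
by rewrite sqrrD -addrA addrCA addrC lerDl mulrn_wge0 // mulr_ge0 ?enorm_ge0.
Qed.

Lemma loewner_scalar (R : realType) p (A : 'M[R]_p) (a : R) (v : 'rV[R]_p) :
  loewner_ge A a%:M -> a * dot v v <= dot v (v *m A).
Proof.
case=> As /(_ v^T); rewrite trmxK mulmxBr mulmxBl mul_mx_scalar !mxE.
have -> : \sum_j (v *m A) 0 j * v^T j 0 = dot v (v *m A).
  by apply: eq_bigr => j _; rewrite [v^T j 0]mxE mulrC.
have -> : \sum_j (a *: v) 0 j * v^T j 0 = a * dot v v.
  by rewrite mulr_sumr; apply: eq_bigr => j _; rewrite !mxE mulrA.
by rewrite subr_ge0.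
Qed.

Lemma loewner_unitmx (R : realType) p (A : 'M[R]_p) (a : R) : 0 < a ->
  loewner_ge A a%:M -> A \in unitmx.
Proof.
move=> a0 HA; rewrite -row_free_unit -kermx_eq0.
apply/eqP/row_matrixP => i; rewrite row0; set v := row i _.
have vA : v *m A = 0 by rewrite /v -row_mul mulmx_ker row0.
have := loewner_scalar v HA; rewrite vA dot0r pmulr_rle0 // dotvv => h.
by apply/enorm_eq0/eqP; rewrite -sqrf_eq0 eq_le h sqr_ge0.
Qed.

Section Dynamics.
Variables (R : realType) (n m : nat).
Variables (f : 'rV[R]_n -> R) (h : 'rV[R]_n -> 'rV[R]_m) (q : 'rV[R]_n -> 'rV[R]_(n - m)).
Variables (Psi : 'rV[R]_m * 'rV[R]_(n - m) -> 'rV[R]_n) (G : 'rV[R]_m -> 'rV[R]_m).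
Variables (q_low m_low rho_eta c_g rho_g L_Phi L_Psi L1 : R) (xstar : 'rV[R]_n).
Hypotheses (smooth_f : smooth f) (smooth_h : smooth h) (smooth_q : smooth q).
Hypothesis q_low_gt0 : 0 < q_low.
Hypothesis gram_q : forall x, loewner_ge (gram q x) (q_low%:M).
Hypothesis orth_qh : forall x, (nabla q x)^T *m nabla h x = 0.
Hypothesis Phi_diffeo : diffeomorphism (fun x => (h x, q x)) Psi.
Hypothesis m_low_gt0 : 0 < m_low.
Hypothesis gram_h : forall x, loewner_ge (gram h x) (m_low%:M).
Hypothesis rho_eta_gt0 : 0 < rho_eta.
Hypothesis strong : strongly_convex rho_eta (fun eta : 'rV[R]_(n - m) => f (Psi (0, eta))).
Hypotheses (c_g_ge1 : 1 <= c_g) (rho_g_gt0 : 0 < rho_g).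
Hypothesis ges_G : globally_exp_stable G 0 c_g rho_g.
Hypothesis lip_Phi : forall x1 x2 : 'rV[R]_n,
  enorm2 ((h x1, q x1) - (h x2, q x2)) <= L_Phi * enorm (x1 - x2).
Hypothesis lip_Psi : forall w1 w2 : 'rV[R]_m * 'rV[R]_(n - m),
  enorm (Psi w1 - Psi w2) <= L_Psi * enorm2 (w1 - w2).
Hypothesis L1_gt0 : 0 < L1.
Hypothesis lip_drift : forall (y : 'rV[R]_m) (eta : 'rV[R]_(n - m)),
  let xt := Psi (y, eta) in let p := Psi (0, eta) in
  enorm ((nabla q xt)^T *m grad f xt - (nabla q p)^T *m grad f p) <= L1 * enorm y.
Hypothesis xstar_opt : global_minimizer f h xstar.

Let sPsi : smooth Psi. Proof. by case: Phi_diffeo. Qed.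
Let sPhi : smooth (fun x => (h x, q x)). Proof. by case: Phi_diffeo. Qed.
Let PhiK x : Psi (h x, q x) = x. Proof. by case: Phi_diffeo => _ _ K _; exact: K. Qed.
Let PsiK w : (h (Psi w), q (Psi w)) = w. Proof. by case: Phi_diffeo => _ _ _ K; exact: K. Qed.
Let hPsi y eta : h (Psi (y, eta)) = y. Proof. by have [] := PsiK (y, eta). Qed.
Let qPsi y eta : q (Psi (y, eta)) = eta. Proof. by have [] := PsiK (y, eta). Qed.

Let LP : R := `|L_Phi|.
Let LS : R := `|L_Psi|.

Let h_lip u v : enorm (h u - h v) <= LP * enorm (u - v).
Proof.
apply: le_trans (enorm2_ge1 ((h u, q u) - (h v, q v))) _; apply: le_trans (lip_Phi u v) _.
by rewrite ler_wpM2r ?enorm_ge0 // ler_norm.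
Qed.

Let q_lip u v : enorm (q u - q v) <= LP * enorm (u - v).
Proof.
apply: le_trans (enorm2_ge2 ((h u, q u) - (h v, q v))) _; apply: le_trans (lip_Phi u v) _.
by rewrite ler_wpM2r ?enorm_ge0 // ler_norm.
Qed.

Let Psi_lip y eta y' eta' :
  enorm (Psi (y, eta) - Psi (y', eta')) <= LS * (enorm (y - y') + enorm (eta - eta')).
Proof.
apply: le_trans (lip_Psi _ _) _.
have e20 : 0 <= enorm2 ((y, eta) - (y', eta')) by exact: sqrtr_ge0.
apply: (@le_trans _ _ (LS * enorm2 ((y, eta) - (y', eta')))).
  by rewrite ler_wpM2r // ler_norm.
by apply: ler_wpM2l; [exact: normr_ge0|exact: (enorm2_le ((y, eta) - (y', eta')))].
Qed.

(** Along the flow [q x] has velocity [- w x]: see [flow_q]. *)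
Let w (x : 'rV[R]_n) : 'rV[R]_(n - m) := (grad f x)^T *m nabla q x.

Let F (eta : 'rV[R]_(n - m)) : R := f (Psi (0, eta)).
Let g (eta : 'rV[R]_(n - m)) : 'rV[R]_(n - m) := (grad F eta)^T.

Let dF eta : differentiable F eta.
Proof.
have dP : differentiable (fun e : 'rV[R]_(n - m) => Psi (0, e)) eta.
  apply: (@differentiable_comp _ _ _ _ (fun e => (0, e)) Psi).
    by apply: differentiable_pair; [exact: differentiable_cst|exact: ex_diff].
  exact: smooth_differentiable.
by apply: (@differentiable_comp _ _ _ _ (fun e => Psi (0, e)) f) => //;
  exact: smooth_differentiable.
Qed.

Let DF eta v : 'D_v F eta = dot (g eta) v.
Proof. exact: derive_grad. Qed.

Let sc u v : F u + dot (g u) (v - u) + rho_eta / 2 * enorm (v - u) ^+ 2 <= F v.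
Proof. by have := strong u v; rewrite dot_mulmx. Qed.

Let us := q xstar.

Let xstarE : xstar = Psi (0, us).
Proof. by case: xstar_opt => h0 _; rewrite -h0 PhiK. Qed.

Let Fmin v : F us <= F v.
Proof. by rewrite /F -xstarE; case: xstar_opt => _; apply; exact: hPsi. Qed.

Let drift_lip y eta : enorm (w (Psi (y, eta)) - w (Psi (0, eta))) <= L1 * enorm y.
Proof.
have tE (A : 'cV[R]_(n - m)) : enorm A^T = enorm A.
  rewrite /enorm exchange_big /=; congr Num.sqrt.
  by apply: eq_bigr => i _; apply: eq_bigr => j _; rewrite mxE.
have wE x : w x = ((nabla q x)^T *m grad f x)^T by rewrite /w trmx_mul trmxK.
by rewrite !wE -raddfB tE; exact: lip_drift.
Qed.

(** On the constraint manifold the drift is [gram q *m grad F], because the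
    columns of [nabla q] are tangent to it. *)
Let drift_gram eta (v : 'rV[R]_(n - m)) :
  dot (w (Psi (0, eta))) v = dot (g eta) (v *m gram q (Psi (0, eta))).
Proof.
set p := Psi (0, eta); pose a := v *m (nabla q p)^T.
have ah : 'D_a h p = 0 by rewrite derive_nabla // /a -mulmxA orth_qh mulmx0.
have aq : 'D_a q p = v *m gram q p by rewrite derive_nabla // /a -mulmxA.
have aE : 'D_(0, v *m gram q p) Psi (0, eta) = a.
  have := derive_cancel p a sPhi sPsi PhiK.
  rewrite derive_pairE ?ah ?aq /p ?hPsi ?qPsi //; exact: smooth_differentiable.
have -> : dot (w p) v = dot (grad f p)^T a.
  by rewrite -!dot_mulmx /w /a trmx_mul trmxK mulmxA.
rewrite -derive_grad; last exact: smooth_differentiable.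
have dP : differentiable (fun e : 'rV[R]_(n - m) => (0 : 'rV[R]_m, e)) eta.
  by apply: differentiable_pair; [exact: differentiable_cst|exact: ex_diff].
have dPs := smooth_differentiable (0 : 'rV[R]_m, eta) sPsi.
have dfp := smooth_differentiable p smooth_f.
have dc : differentiable (fun e : 'rV[R]_(n - m) => Psi (0, e)) eta.
  exact: (differentiable_comp dP dPs).
set u := v *m gram q p in aE *.
have E1 := derive_comp u dc dfp; have E2 := derive_comp u dP dPs.
have E3 : 'D_u (fun e : 'rV[R]_(n - m) => (0 : 'rV[R]_m, e)) eta = (0, u).
  rewrite derive_pairE; [|exact: differentiable_cst|exact: ex_diff].
  by rewrite derive_cst derive_id.
by rewrite -DF [RHS]E1 E2 E3 aE.
Qed.

Let mul_self (x b : R) : 0 <= x -> 0 <= b -> x ^+ 2 <= b * x -> x <= b.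
Proof.
move=> x0 b0; rewrite expr2; have [->//|xn0] := eqVneq x 0.
by rewrite ler_pM2r // lt_neqAle eq_sym xn0.
Qed.

Let gram_le x (v : 'rV[R]_(n - m)) : enorm (v *m gram q x) <= LP ^+ 2 * enorm v.
Proof.
pose a := v *m (nabla q x)^T.
have aq : 'D_a q x = v *m gram q x by rewrite derive_nabla // /a -mulmxA.
have h1 : enorm (v *m gram q x) <= LP * enorm a.
  by rewrite -aq; apply: derive_lipschitz q_lip; exact: smooth_differentiable.
have h2 : enorm a ^+ 2 = dot (v *m gram q x) v.
  by rewrite -dotvv -!dot_mulmx /a trmx_mul trmxK !mulmxA.
have h3 := dot_le (v *m gram q x) v.
apply: mul_self; [exact: enorm_ge0|by apply: mulr_ge0; [exact: sqr_ge0|exact: enorm_ge0]|].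
apply: (@le_trans _ _ ((LP * enorm a) ^+ 2)).
  by rewrite lerXn2r // nnegrE ?enorm_ge0 // mulr_ge0 ?enorm_ge0 // normr_ge0.
rewrite exprMn h2 -mulrA ler_wpM2l ?sqr_ge0 //; apply: le_trans h3 _.
by rewrite mulrC.
Qed.

Let drift_coercive eta :
  q_low * enorm (g eta) ^+ 2 <= dot (g eta) (w (Psi (0, eta))).
Proof. by rewrite -dotvv dotC drift_gram; exact: loewner_scalar. Qed.

Let drift_le eta : enorm (w (Psi (0, eta))) <= LP ^+ 2 * enorm (g eta).
Proof.
set u := w _.
apply: mul_self; [exact: enorm_ge0|by apply: mulr_ge0; [exact: sqr_ge0|exact: enorm_ge0]|].
rewrite -dotvv drift_gram; apply: le_trans (dot_le _ _) _.
have H := ler_wpM2l (enorm_ge0 (g eta)) (gram_le (Psi (0, eta)) u).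
by apply: le_trans H _; rewrite mulrCA mulrA.
Qed.

Let flow_h x : 'D_(fl_field f h G x) h x = G (h x).
Proof.
rewrite derive_nabla //; have := fl_field_output f G (loewner_unitmx m_low_gt0 (gram_h x)).
by move=> /(congr1 trmx); rewrite trmx_mul !trmxK.
Qed.

Let flow_q x : 'D_(fl_field f h G x) q x = - w x.
Proof.
rewrite derive_nabla // /fl_field linearB /= mulmxBl linearN /= mulNmx -/(w x).
have -> : (nabla h x *m fl_multiplier f h G x)^T *m nabla q x = 0.
  rewrite trmx_mul -mulmxA -[nabla q x]trmxK -trmx_mul orth_qh trmx0 mulmx0.
  by [].
by rewrite subr0.
Qed.

(** The coordinates of [w] are sums of products of partial derivatives. *)
Let w_coord i : bounded_lipschitz (fun x => w x 0 i).
Proof.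
have -> : (fun x => w x 0 i) =
    (fun x => \sum_j 'D_(delta_mx 0 j) f x * ('D_(delta_mx 0 j) q x) 0 i).
  apply/funext => x; rewrite mxE; apply: eq_bigr => j _; congr (_ * _).
    by rewrite !mxE.
  exact: nablaE.
apply: bounded_lipschitz_sum => j; apply: bounded_lipschitzM.
  exact/smooth_bounded_lipschitz/smooth_derive.
apply: smooth_bounded_lipschitz; apply: smooth_coord; exact: smooth_derive.
Qed.

Let w_cont : continuous w.
Proof.
move=> x; apply/(@cvgrPdist_le R 'rV[R]_(n - m) 'rV[R]_n (nbhs x) (nbhs_filter x)) => e e0.
have [K K0 HK] := bounded_lipschitz_rV (enorm x + n%:R) w_coord.
have K1 : 0 < K * n%:R + 1 by rewrite ltr_wpDl // mulr_ge0.
apply/nbhs_ballP; exists (Num.min 1 (e / (K * n%:R + 1))) => /=.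
  by rewrite lt_min ltr01 divr_gt0.
move=> y; rewrite -ball_normE /= lt_min => /andP[y1 y2].
have xy : enorm (x - y) <= n%:R * `|x - y| by exact: enorm_le_norm.
have yB : enorm y <= enorm x + n%:R.
  have := enorm_le_sub y x; rewrite (enormB y) => h1; apply: le_trans h1 _.
  by rewrite lerD2l; apply: le_trans xy _; rewrite ler_piMr // ltW.
have xB : enorm x <= enorm x + n%:R by rewrite lerDl.
have [_ H] := HK _ _ xB yB.
apply: le_trans (norm_le_enorm _) _; apply: le_trans H _.
apply: (@le_trans _ _ (K * (n%:R * `|x - y|))); first by rewrite ler_wpM2l.
rewrite ltr_pdivlMr // in y2; apply: le_trans (ltW y2).
by rewrite mulrA mulrC mulrDr mulr1 lerDl.
Qed.

Let sol_output x : solution (fl_field f h G) x -> solution G (fun t => h (x t)).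
Proof.
case=> cx dx; split; first by apply: within_comp cx; exact: smooth_continuous.
move=> t t0; have H := is_derive_comp (dx t t0) (smooth_differentiable (x t) smooth_h).
by rewrite flow_h in H.
Qed.

Let output_decay y : solution G y -> forall t, 0 <= t ->
  enorm (y t) <= c_g * enorm (y 0) * expR (- rho_g * t).
Proof. by move=> /(ges_G.2 _) H t /H; rewrite !subr0 mulrAC. Qed.

(** The coordinate [eta] of a solution descends along [F], perturbed by the output. *)
Let descent y eta (Y : R) : enorm y <= Y ->
  dot (g eta) (- w (Psi (y, eta))) <=
    - q_low * enorm (g eta) ^+ 2 + L1 * enorm (g eta) * Y.
Proof.
move=> yY; have g0 := enorm_ge0 (g eta).
have h1 := drift_coercive eta; have h2 := drift_lip y eta.
have h3 := dot_le (g eta) (w (Psi (0, eta)) - w (Psi (y, eta))).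
rewrite enormB in h3.
have h4 : enorm (g eta) * enorm (w (Psi (y, eta)) - w (Psi (0, eta))) <=
    enorm (g eta) * (L1 * Y).
  rewrite ler_wpM2l //; apply: le_trans h2 _; rewrite ler_wpM2l // ltW //.
have -> : - w (Psi (y, eta)) =
    (w (Psi (0, eta)) - w (Psi (y, eta))) - w (Psi (0, eta)).
  by rewrite addrAC subrr add0r.
rewrite dotBr; lra.
Qed.

Let speed y eta (Y : R) : enorm y <= Y ->
  enorm (- w (Psi (y, eta))) <= (LP ^+ 2 + 1) * enorm (g eta) + L1 * Y.
Proof.
move=> yY; rewrite enormN; have h1 := drift_le eta; have h2 := drift_lip y eta.
have h3 := enorm_le_sub (w (Psi (y, eta))) (w (Psi (0, eta))).
have h4 : L1 * enorm y <= L1 * Y by rewrite ler_wpM2l // ltW.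
apply: le_trans h3 _; apply: le_trans (lerD h1 (le_trans h2 h4)) _.
by rewrite lerD2r mulrDl mul1r lerDl enorm_ge0.
Qed.

Let sol_driven x : solution (fl_field f h G) x ->
  driven g q_low (LP ^+ 2 + 1) L1 rho_g (c_g * enorm (h (x 0)))
    (fun t => q (x t)) (fun t => - w (x t)).
Proof.
move=> sx; have [cx dx] := sx; have sy := sol_output sx.
have xE t : x t = Psi (h (x t), q (x t)) by rewrite PhiK.
split.
- by apply: within_comp cx; exact: smooth_continuous.
- move=> t t0; have H := is_derive_comp (dx t t0) (smooth_differentiable (x t) smooth_q).
  by rewrite flow_q in H.
- move=> t t0; apply: continuousN.
  apply: (@continuous_comp _ _ _ x w); last exact: w_cont.
  by apply: differentiable_continuous; apply/derivable1_diffP; case: (dx t t0).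
- move=> t t0; rewrite [in X in dot _ (- w X)]xE; apply: descent.
  exact: (output_decay sy (ltW t0)).
- move=> t t0; rewrite [in X in enorm (- w X)]xE; apply: speed.
  exact: (output_decay sy (ltW t0)).
Qed.

(** [driven_decay] is applied at a radius [r] that dominates the initial distance
    of [eta] to [us] strictly and the input [Y0]; both are of the order of
    [D = enorm (x 0 - xstar)]. The margin [dl] makes [r] positive when [D = 0]. *)
Let estimate (rho1 : R) : 0 <= rho1 -> rho1 < q_low * rho_eta -> rho1 < rho_g ->
  exists2 c1 : R, 1 <= c1 & forall x, solution (fl_field f h G) x -> forall t : R, 0 <= t ->
    enorm (x t - xstar) <= c1 * expR (- rho1 * t) * enorm (x 0 - xstar).
Proof.
move=> r10 r1q r1g.
have LP0 : 0 <= LP by exact: normr_ge0.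
have LS0 : 0 <= LS by exact: normr_ge0.
have Lam0 : 0 < LP ^+ 2 + 1 by rewrite ltr_wpDl // sqr_ge0.
have [C C1 HC] := driven_decay rho_eta_gt0 sc Fmin dF DF q_low_gt0 Lam0 L1_gt0 rho_g_gt0
  r10 r1q r1g.
have cg0 : 0 <= c_g by apply: (@le_trans _ _ 1).
have qr0 : 0 < q_low * rho_eta by exact: mulr_gt0.
pose A := LP + 4 * L1 * c_g * LP / (q_low * rho_eta) + 1.
have A1 : 0 <= 4 * L1 * c_g * LP / (q_low * rho_eta).
  apply: divr_ge0; last exact: ltW.
  by rewrite !mulr_ge0 // ltW.
have A0 : 0 < A by rewrite /A; lra.
have C0 : 0 <= C by exact: le_trans ler01 C1.
exists (LS * (c_g * LP + C * A) + 1).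
  rewrite lerDr; apply: mulr_ge0 => //; apply: addr_ge0; apply: mulr_ge0 => //.
  exact: ltW.
move=> x sx t t0; set D := enorm (x 0 - xstar).
have D0 : 0 <= D by exact: enorm_ge0.
have hx0 : enorm (h (x 0)) <= LP * D.
  by have := h_lip (x 0) xstar; case: xstar_opt => -> _; rewrite subr0.
set e := expR (- rho1 * t); have e0 : 0 <= e by exact: expR_ge0.
have etab : enorm (q (x t) - us) <= C * e * (A * D).
  apply/ler_addgt0Pr => dl dl0.
  have P0 : 0 < C * e * A + 1 by rewrite ltr_wpDl // !mulr_ge0 // ltW.
  pose r := A * (D + dl / (C * e * A + 1)).
  have dl' : 0 < dl / (C * e * A + 1) by rewrite divr_gt0.
  have r0 : 0 < r by rewrite mulr_gt0 // ltr_wpDl.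
  have Dr : A * D <= r by rewrite ler_wpM2l ?(ltW A0) // lerDl ltW.
  have b1 : 4 * L1 * (c_g * enorm (h (x 0))) <= q_low * rho_eta * r.
    have b2 : 4 * L1 * (c_g * enorm (h (x 0))) <= 4 * L1 * (c_g * (LP * D)).
      by rewrite ler_wpM2l ?mulr_ge0 ?(ltW L1_gt0) // ler_wpM2l.
    have b3 : 4 * L1 * (c_g * (LP * D)) =
        q_low * rho_eta * (4 * L1 * c_g * LP / (q_low * rho_eta) * D).
      by field; rewrite !gt_eqF.
    apply: le_trans b2 _; rewrite b3 ler_wpM2l ?(ltW qr0) //; apply: le_trans Dr.
    by rewrite ler_wpM2r // /A; lra.
  have b4 : enorm (q (x 0) - us) < r.
    apply: le_lt_trans (q_lip _ _) _; rewrite -/D.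
    apply: (@le_lt_trans _ _ (A * D)); first by rewrite ler_wpM2r // /A; lra.
    by rewrite ltr_pM2l // ltrDl.
  have Y0 : 0 <= c_g * enorm (h (x 0)) by rewrite mulr_ge0 ?enorm_ge0.
  apply: le_trans (HC _ _ _ _ (sol_driven sx) Y0 b1 r0 b4 t t0) _.
  have b5 : C * e * A * (dl / (C * e * A + 1)) <= dl.
    by rewrite mulrCA ler_piMr ?(ltW dl0) // ler_pdivrMr // mul1r lerDl.
  by rewrite -/e /r 2!mulrDr lerD2l mulrA.
have yb : enorm (h (x t)) <= c_g * LP * D * e.
  apply: le_trans (output_decay (sol_output sx) t0) _.
  apply: ler_pM; rewrite ?mulr_ge0 ?enorm_ge0 ?expR_ge0 //.
    by rewrite -mulrA ler_wpM2l.
  by rewrite ler_expR !mulNr lerN2 ler_wpM2r // ltW.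
rewrite -{1}(PhiK (x t)) xstarE; apply: le_trans (Psi_lip _ _ _ _) _; rewrite subr0.
have h1 : enorm (h (x t)) + enorm (q (x t) - us) <= (c_g * LP + C * A) * (D * e) by lra.
have h2 := ler_wpM2l LS0 h1; apply: le_trans h2 _.
have -> : (LS * (c_g * LP + C * A) + 1) * e * D =
    LS * ((c_g * LP + C * A) * (D * e)) + e * D by ring.
by rewrite lerDl mulr_ge0.
Qed.

(** A truncation that the Lyapunov estimate shows to be inactive along the
    solution from [x0] makes the equation for [eta] globally solvable. *)
Let existence x0 : exists2 x, solution (fl_field f h G) x & x 0 = x0.
Proof.
have [y sy y0E] := ges_G.1 (h x0); have [cy dy] := sy.
pose Y0 := c_g * enorm (h x0).
have cg0 : 0 <= c_g by apply: (@le_trans _ _ 1).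
have Y00 : 0 <= Y0 by rewrite mulr_ge0 ?enorm_ge0.
have yb (t : R) : 0 <= t -> enorm (y t) <= Y0 * expR (- rho_g * t).
  by move=> t0; have := output_decay sy t0; rewrite y0E.
have yb0 (t : R) : 0 <= t -> enorm (y t) <= Y0.
  move=> t0; apply: le_trans (yb t t0) _; apply: ler_piMr => //.
  by rewrite -expR0 ler_expR mulNr oppr_le0 mulr_ge0 // ltW.
(* The input raises the gap at most at the rate [K * expR (- (2 * rho_g) * t)],
   the maximum over the size of the gradient of the bound in [descent]. *)
pose K := L1 ^+ 2 * Y0 ^+ 2 / (4 * q_low).
have K0 : 0 <= K by apply: divr_ge0; [rewrite mulr_ge0 ?sqr_ge0|rewrite mulr_ge0 ?ltW].
pose E := F (q x0) - F us + K / (2 * rho_g).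
have rg2 : 0 < 2 * rho_g by rewrite mulr_gt0.
have E0 : 0 <= E.
  by rewrite /E addr_ge0 ?subr_ge0 // divr_ge0 // ltW.
(* By [gap_ge] a gap of at most [E] keeps [eta] within [B] of [us]. *)
pose B : R := 1 + 4 * E / rho_eta.
have [Kw Kw0 HK] := bounded_lipschitz_rV (enorm xstar + LS * (Y0 + (B + 1))) w_coord.
have LS0 : 0 <= LS by exact: normr_ge0.
pose W (t : R) u := w (Psi (y t, u)).
have HW (t : R) u v : 0 <= t -> enorm (u - us) <= B + 1 -> enorm (v - us) <= B + 1 ->
    enorm (W t u) <= Kw + Kw * LS /\
    enorm (W t u - W t v) <= (Kw + Kw * LS) * enorm (u - v).
  move=> t0 uB vB.
  have inB z : enorm (z - us) <= B + 1 ->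
      enorm (Psi (y t, z)) <= enorm xstar + LS * (Y0 + (B + 1)).
    move=> zB; have h1 := enorm_le_sub (Psi (y t, z)) xstar.
    have h2 := Psi_lip (y t) z 0 us; rewrite -xstarE subr0 in h2.
    have h3 := ler_wpM2l LS0 (lerD (yb0 t t0) zB).
    by apply: le_trans h1 _; rewrite lerD2l; apply: le_trans h2 h3.
  have [h1 h2] := HK _ _ (inB u uB) (inB v vB); split.
    by apply: le_trans h1 _; rewrite lerDl mulr_ge0.
  have h3 := Psi_lip (y t) u (y t) v; rewrite subrr enorm0 add0r in h3.
  apply: le_trans h2 _; apply: le_trans (ler_wpM2l Kw0 h3) _.
  by rewrite mulrA mulrDl lerDr mulr_ge0 ?enorm_ge0.
have cW (e : R -> 'rV[R]_(n - m)) : {within `[0, +oo[, continuous e} ->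
    {within `[0, +oo[, continuous (fun t => W t (e t))}.
  move=> ce; have cp := within_pair cy ce.
  have cx := within_comp (smooth_continuous sPsi) cp.
  exact: (within_comp w_cont cx).
have K'0 : 0 <= Kw + Kw * LS by rewrite addr_ge0 ?mulr_ge0.
have [eta [eta0 deta]] := truncated_solution (q x0) K'0 HW cW.
have ceta := derive_within_cont deta.
have gapb (t : R) : 0 <= t -> F (eta t) - F us <= E.
  move=> t0; have := gap_bound us dF DF rg2 ceta (fun t t0 => deta t (ltW t0)).
  move=> /(_ K); rewrite eta0 => H; rewrite /E; apply: H => // s s0.
  set X := enorm (g (eta s)); set Y := Y0 * expR (- rho_g * s).
  have X0 : 0 <= X by exact: enorm_ge0.
  have h1 := descent (eta s) (yb s (ltW s0)); rewrite -/X -/Y -/(W s (eta s)) in h1.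
  have -> : K * expR (- (2 * rho_g) * s) = L1 ^+ 2 * Y ^+ 2 / (4 * q_low).
    have -> : - (2 * rho_g) * s = - rho_g * s + - rho_g * s by ring.
    by rewrite expRD /K /Y; field; rewrite gt_eqF.
  set M := L1 ^+ 2 * Y ^+ 2 / (4 * q_low).
  have h2 : - q_low * X ^+ 2 + L1 * X * Y <= M.
    rewrite /M ler_pdivlMr ?mulr_gt0 // -subr_ge0.
    by rewrite (_ : _ - _ = (2 * q_low * X - L1 * Y) ^+ 2) ?sqr_ge0 //; ring.
  have M0 : 0 <= M by apply: divr_ge0; apply: mulr_ge0; rewrite ?sqr_ge0 ?(ltW q_low_gt0).
  have /andP[c0 c1] := cutoff_itv us B (eta s).
  rewrite -scalerN dotZr; apply: le_trans (ler_wpM2l c0 (le_trans h1 h2)) _.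
  by rewrite ler_piMl.
have inside (t : R) : 0 <= t -> enorm (eta t - us) <= B.
  move=> t0; have h1 := gap_ge sc Fmin (eta t).
  have h2 := le_trans h1 (gapb t t0); set D := enorm _ in h2 *.
  have D0 : 0 <= D by exact: enorm_ge0.
  have h3 : D ^+ 2 <= 4 * E / rho_eta.
    by rewrite ler_pdivlMr //; lra.
  have [D1|D1] := leP D 1; first by
    rewrite /B; apply: le_trans D1 _; rewrite lerDl (le_trans _ h3) ?sqr_ge0.
  have : D <= D ^+ 2 by rewrite expr2 ler_peMl // ltW.
  by rewrite /B; lra.
have deta1 (t : R) : 0 <= t -> is_derive t 1 eta (- W t (eta t)).
  by move=> t0; have := deta t t0; rewrite (cutoff1 (inside t t0)) scale1r.
exists (fun t => Psi (y t, eta t)); last by rewrite y0E eta0 PhiK.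
split; first exact: (within_comp (smooth_continuous sPsi) (within_pair cy ceta)).
move=> t t0; set x := Psi (y t, eta t).
have H := is_derive_comp (is_derive_pair (dy t t0) (deta1 t (ltW t0)))
  (smooth_differentiable (y t, eta t) sPsi).
have := derive_cancel x (fl_field f h G x) sPhi sPsi PhiK.
rewrite derive_pairE; [|exact: smooth_differentiable|exact: smooth_differentiable].
by rewrite flow_h flow_q hPsi qPsi => <-.
Qed.

(** A negative rate [rho1] is covered by the rate [0]. *)
Theorem flow_stable rho1 : rho1 < Num.min (q_low * rho_eta) rho_g ->
  exists2 c1 : R, 1 <= c1 & globally_exp_stable (fl_field f h G) xstar c1 rho1.
Proof.
rewrite lt_min => /andP[r1 r2].
pose r := Num.max rho1 0.
have [c1 c11 H] : exists2 c1 : R, 1 <= c1 & forall x, solution (fl_field f h G) x ->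
    forall t : R, 0 <= t ->
    enorm (x t - xstar) <= c1 * expR (- r * t) * enorm (x 0 - xstar).
  by apply: estimate; rewrite ?le_max ?lexx ?orbT // gt_max ?r1 ?r2 ?mulr_gt0.
exists c1 => //; split; first exact: existence.
move=> x sx t t0; apply: le_trans (H x sx t t0) _.
rewrite ler_wpM2r ?enorm_ge0 // ler_wpM2l ?(le_trans ler01) //.
by rewrite ler_expR ler_wpM2r // lerN2 le_max lexx.
Qed.

End Dynamics.

Theorem theorem2 (R : realType) (n m : nat) (le_mn : (m <= n)%N)
  (f : 'rV[R]_n -> R) (h : 'rV[R]_n -> 'rV[R]_m)
  (q : 'rV[R]_n -> 'rV[R]_(n - m))
  (Psi : 'rV[R]_m * 'rV[R]_(n - m) -> 'rV[R]_n)
  (G : 'rV[R]_m -> 'rV[R]_m)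
  (q_low m_low rho_eta c_g rho_g L_Phi L_Psi L1 : R) (xstar : 'rV[R]_n)
  (smooth_f : smooth f) (smooth_h : smooth h) (smooth_q : smooth q)
  (q_low_gt0 : 0 < q_low)
  (gram_q : forall x, loewner_ge (gram q x) (q_low%:M))
  (orth_qh : forall x, (nabla q x)^T *m nabla h x = 0)
  (Phi_diffeo : diffeomorphism (fun x => (h x, q x)) Psi)
  (m_low_gt0 : 0 < m_low)
  (gram_h : forall x, loewner_ge (gram h x) (m_low%:M))
  (conn : connected [set x : 'rV[R]_n | h x = 0])
  (rho_eta_gt0 : 0 < rho_eta)
  (sc : strongly_convex rho_eta (fun eta : 'rV[R]_(n - m) => f (Psi (0, eta))))
  (c_g_ge1 : 1 <= c_g) (rho_g_gt0 : 0 < rho_g)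
  (ges_G : globally_exp_stable G 0 c_g rho_g)
  (lip_Phi : forall x1 x2 : 'rV[R]_n,
     enorm2 ((h x1, q x1) - (h x2, q x2)) <= L_Phi * enorm (x1 - x2))
  (lip_Psi : forall w1 w2 : 'rV[R]_m * 'rV[R]_(n - m),
     enorm (Psi w1 - Psi w2) <= L_Psi * enorm2 (w1 - w2))
  (L1_gt0 : 0 < L1)
  (lip_drift : forall (y : 'rV[R]_m) (eta : 'rV[R]_(n - m)),
     let xt := Psi (y, eta) in
     let p := Psi (0, eta) in
     enorm ((nabla q xt)^T *m grad f xt - (nabla q p)^T *m grad f p)
       <= L1 * enorm y)
  (xstar_opt : global_minimizer f h xstar) :
  forall rho1 : R, rho1 < Num.min (q_low * rho_eta) rho_g ->
    exists2 c1 : R, 1 <= c1 &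
      globally_exp_stable (fl_field f h G) xstar c1 rho1.
Proof.
move=> rho1 rho1_lt.
exact: (flow_stable smooth_f smooth_h smooth_q q_low_gt0 gram_q orth_qh Phi_diffeo
  m_low_gt0 gram_h rho_eta_gt0 sc c_g_ge1 rho_g_gt0 ges_G lip_Phi lip_Psi L1_gt0
  lip_drift xstar_opt rho1_lt).
Qed.
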